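(* Let $(X,\mu,\mathcal{R})$ be a discrete p.m.p. equivalence relation and let $\mathcal{F}=\{\mathcal{F}_r\}_{r\in\mathbb{I}}$ be a Borel family of subset functions for $\mathcal{R}$. If $\mathcal{F}$ is either (asymptotically invariant and regular) or (asymptotically invariant, uniform and tempered), then $\mathcal{F}$ is a pointwise ergodic family in $L^1$: for every class-bijective extension $\pi:(\widetilde X,\widetilde\mu,\widetilde{\mathcal{R}})\to(X,\mu,\mathcal{R})$ and every $f\in L^1(\widetilde X,\widetilde\mu)$, $\mathbb{A}[f|\widetilde{\mathcal{F}}_r]$ converges pointwise a.e. to $\mathbb{E}[f|\mathcal{I}(\widetilde{\mathcal{R}})]$ as $r\to\infty$, where $\widetilde{\mathcal{F}}$ is the lift of $\mathcal{F}$.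
   Context: $\mathbb{I}$ denotes either $\mathbb{N}$ or $\mathbb{R}_{>0}$. A discrete p.m.p. equivalence relation $(X,\mu,\mathcal{R})$: $(X,\mu)$ is a standard probability space, $\mathcal{R}\subset X\times X$ is a Borel equivalence relation with every class $[x]$ at most countable, and $\mu$ is $\mathcal{R}$-invariant, i.e. $\mu\times c$ and $c\times\mu$ agree on $\mathcal{R}$, where $c$ is counting measure. $\mathrm{Inn}(\mathcal{R})$ is the group of Borel automorphisms of $X$ with graph contained in $\mathcal{R}$. $\Psi\subset\mathrm{Inn}(\mathcal{R})$ generates $\mathcal{R}$ if for $(\mu\times c)$-a.e. $(x,y)\in\mathcal{R}$ there is $\psi$ in the group $\langle\Psi\rangle$ generated by $\Psi$ with $\psi(x)=y$. A subset function $U$ assigns to each $x\in X$ a subset $U(x)\subset[x]$; $U^{-1}(y)=\{x:y\in U(x)\}$; $U_1U_2(x)=\bigcup_{y\in U_2(x)}U_1(y)$. A Borel family of subset functions is a family $\mathcal{F}=\{\mathcal{F}_r\}_{r\in\mathbb{I}}$ of subset functions with $\{(x,y,r):y\in\mathcal{F}_r(x)\}$ Borel and $\bigcup_{s\le r}\mathcal{F}_s(x)$ finite for all $x,r$. $\mathcal{F}$ is: (i) asymptotically invariant if $|\mathcal{F}_r(x)|\ge1$ for a.e. $x$ and all $r$, and there is a countable generating set $\Psi\subset\mathrm{Inn}(\mathcal{R})$ such that for every $\psi\in\Psi$ and a.e. $x$, $\lim_{r\to\infty}|\mathcal{F}_r(x)\,\Delta\,\psi(\mathcal{F}_r(x))|/|\mathcal{F}_r(x)|=0$;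 (ii) uniform if there are constants $C_u,a_r,b_r>0$ with $b_r\le C_ua_r$, $a_r\le|\mathcal{F}_r(x)|\le b_r$ and $a_r\le|\mathcal{F}_r^{-1}(x)|\le b_r$ for all $r$ and a.e. $x$; (iii) regular if there is $C_{reg}>0$ with $\left|\bigcup_{s\le r}\mathcal{F}_s^{-1}\mathcal{F}_r(x)\right|\le C_{reg}|\mathcal{F}_r(x)|$ for a.e. $x$ and every $r$; (iv) tempered if $\mathbb{I}=\mathbb{N}$ and there is $C_t$ with $\left|\bigcup_{m\le n-1}\mathcal{F}_m^{-1}\mathcal{F}_n(x)\right|\le C_t|\mathcal{F}_n(x)|$ for a.e. $x$ and every $n$. A class-bijective extension of $(X,\mu,\mathcal{R})$ is a discrete p.m.p. equivalence relation $(\widetilde X,\widetilde\mu,\widetilde{\mathcal{R}})$ with a Borel map $\pi:\widetilde X\to X$ such that $\pi_*\widetilde\mu=\mu$, $(x,x')\in\widetilde{\mathcal{R}}$ implies $(\pi(x),\pi(x'))\in\mathcal{R}$, and for a.e. $x\in\widetilde X$, $\pi$ restricted to the class $[x]$ is a bijection onto the class $[\pi(x)]$. The lift of $\mathcal{F}$ is $\widetilde{\mathcal{F}}_r(x)=\pi^{-1}(\mathcal{F}_r(\pi(x)))\cap[x]$ for $x\in\widetilde X$. Averages: $\mathbb{A}[f|\widetilde{\mathcal{F}}_r](x)=\frac{1}{|\widetilde{\mathcal{F}}_r(x)|}\sum_{x'\in\widetilde{\mathcal{F}}_r(x)}f(x')$. $\mathcal{I}(\widetilde{\mathcal{R}})$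 is the $\sigma$-algebra of $\widetilde{\mathcal{R}}$-invariant measurable sets (unions of classes up to measure zero), and $\mathbb{E}[f|\mathcal{I}(\widetilde{\mathcal{R}})]$ is conditional expectation. *)

(* Defs.v *)
From HB Require Import structures.
From mathcomp Require Import all_boot all_order all_algebra.
From mathcomp Require Import finmap.
From mathcomp Require Import all_classical all_reals all_analysis.

Set Implicit Arguments.
Unset Strict Implicit.
Unset Printing Implicit Defensive.

Import Order.TTheory GRing.Theory Num.Theory.
Import numFieldNormedType.Exports.

Local Open Scope classical_set_scope.
Local Open Scope ring_scope.

Section BorelEquivalenceRelations.
Context (R : realType) (d : measure_display) (X : measurableType d).

(* Measurably isomorphic to a Polish space with its Borel sigma-algebra.  The
   real numbers [R] only serve as the values of the metric. *)
Definition standard_borel : Prop :=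
  exists (P : completePseudoMetricType R) (f : X -> P),
    [/\ hausdorff_space P, @second_countable P, bijective f
      & forall A : set P, <<s @open P >> A <-> measurable (f @^-1` A)].

Implicit Types (mu : probability X R) (E : set (X * X)) (U : X -> set X).

Definition eqclass E (x : X) : set X := [set y | E (x, y)].

(* The measures [mu x c] and [c x mu], with [c] the counting measure.  The
   product measure of the library requires sigma-finite factors, so they are
   written as integrals of the cardinalities of the sections. *)
Definition left_count mu (A : set (X * X)) : \bar R :=
  (\int[mu]_x counting (xsection A x))%E.

Definition right_count mu (A : set (X * X)) : \bar R :=
  (\int[mu]_y counting (ysection A y))%E.

Record discrete_pmp mu E : Prop := DiscretePmp {
  pmp_standard : standard_borel;
  pmp_measurable : measurable E;
  pmp_refl : forall x, E (x, x);
  pmp_sym : forall x y, E (x, y) -> E (y, x);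
  pmp_trans : forall x y z, E (x, y) -> E (y, z) -> E (x, z);
  pmp_countable : forall x, countable (eqclass E x);
  pmp_invariant : forall A, measurable A -> A `<=` E ->
    left_count mu A = right_count mu A }.

Definition Inn E : set (X -> X) := [set psi |
  (exists psi', [/\ cancel psi psi', cancel psi' psi,
     measurable_fun setT psi & measurable_fun setT psi'])
  /\ forall x, E (x, psi x)].

Inductive generated_group (Psi : set (X -> X)) : set (X -> X) :=
| generated_mem f : Psi f -> generated_group Psi f
| generated_id : generated_group Psi id
| generated_comp f g : generated_group Psi f -> generated_group Psi g ->
    generated_group Psi (f \o g)
| generated_inv f g : generated_group Psi f -> cancel f g -> cancel g f ->
    generated_group Psi g.

Definition generates mu E (Psi : set (X -> X)) : Prop :=
  exists N : set (X * X), [/\ measurable N, N `<=` E, left_count mu N = 0%E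
    & forall x y, E (x, y) -> ~ N (x, y) ->
        exists2 psi, generated_group Psi psi & psi x = y].

Definition sf_inv U (y : X) : set X := [set x | U x y].

Definition sf_comp (U1 U2 : X -> set X) (x : X) : set X :=
  \bigcup_(y in U2 x) U1 y.

(* The sigma-algebra of invariant sets. *)
Definition invariant_sets mu E : set (set X) := [set A | measurable A /\
  exists B : set X, (forall x y, E (x, y) -> B x -> B y) /\
    mu.-negligible (A `+` B)].

(* [g] is a version of the conditional expectation of [f] given the
   sigma-algebra [G]. *)
Definition is_cond_exp mu (G : set (set X)) (f g : X -> R) : Prop :=
  [/\ (forall B : set R, measurable B -> G (g @^-1` B)),
      mu.-integrable setT (EFin \o g)
    & forall A, G A ->
        (\int[mu]_(x in A) (g x)%:E = \int[mu]_(x in A) (f x)%:E)%E].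

End BorelEquivalenceRelations.

(* The index set is a subset of [R], so that the naturals and the positive reals
   are treated alike; families are only constrained at indices in that set. *)
Definition natI (R : realType) : set R := range (fun n : nat => n%:R).
Definition posI (R : realType) : set R := [set r | 0 < r].
Arguments natI : clear implicits.
Arguments posI : clear implicits.

Definition upto (R : realType) (I : set R) (r : R) : set R :=
  [set s | I s /\ s <= r].

Section Families.
Context (R : realType) (d : measure_display) (X : measurableType d).
Implicit Types (I : set R) (mu : probability X R) (E : set (X * X)).
Implicit Types (F : R -> X -> set X).

(* Junk value 0 on infinite sets; [counting] gives +oo instead. *)
Definition cardR (A : set X) : R := (#|` fset_set A |)%:R.

Record borel_family I E F : Prop := BorelFamily {
  family_sub : forall r x, I r -> F r x `<=` eqclass E x;
  family_measurable : measurable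
    [set p : X * X * measurableTypeR R | I p.2 /\ F p.2 p.1.1 p.1.2];
  family_finite : forall r x, I r ->
    finite_set (\bigcup_(s in upto I r) F s x) }.

Definition asymptotically_invariant I mu E F : Prop :=
  {ae mu, forall x, forall r, I r -> (1 <= counting (F r x) :> \bar R)%E} /\
  exists Psi : set (X -> X),
    [/\ countable Psi, Psi `<=` Inn E, generates mu E Psi
      & forall psi, Psi psi -> {ae mu, forall x,
          cardR (F r x `+` psi @` F r x) / cardR (F r x)
            @[r --> within I (pinfty_nbhs R)] --> (0 : R)}].

Definition uniform I mu F : Prop :=
  exists (Cu : R) (a b : R -> R), 0 < Cu /\
    forall r, I r ->
    [/\ 0 < a r, 0 < b r, b r <= Cu * a r
      & {ae mu, forall x,
          ((a r)%:E <= counting (F r x) <= (b r)%:E)%E /\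
          ((a r)%:E <= counting (sf_inv (F r) x) <= (b r)%:E)%E}].

Definition regular I mu F : Prop :=
  exists2 Creg : R, 0 < Creg & {ae mu, forall x, forall r, I r ->
    (counting (\bigcup_(s in upto I r)
       sf_comp (sf_inv (F s)) (F r) x) <= Creg%:E * counting (F r x))%E}.

Definition tempered I mu F : Prop :=
  I = natI R /\ exists Ct : R, {ae mu, forall x, forall n, I n ->
    (counting (\bigcup_(m in upto I (n - 1)%R)
       sf_comp (sf_inv (F m)) (F n) x) <= Ct%:E * counting (F n x))%E}.

Definition average F (f : X -> R) (r : R) (x : X) : R :=
  (cardR (F r x))^-1 * \sum_(y \in F r x) f y.

End Families.

Section Extensions.
Context (R : realType) (d d' : measure_display).
Context (X : measurableType d) (X' : measurableType d').

Record class_bijective_extension (mu : probability X R) (E : set (X * X))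
    (mu' : probability X' R) (E' : set (X' * X')) (pi : X' -> X) : Prop :=
  ClassBijectiveExtension {
  ext_pmp : discrete_pmp mu' E';
  ext_measurable : measurable_fun setT pi;
  ext_pushforward : forall A, measurable A -> pushforward mu' pi A = mu A;
  ext_morph : forall x y, E' (x, y) -> E (pi x, pi y);
  ext_bij : {ae mu', forall x,
    set_bij (eqclass E' x) (eqclass E (pi x)) pi} }.

Definition lift_family (E' : set (X' * X')) (pi : X' -> X)
    (F : R -> X -> set X) (r : R) (x : X') : set X' :=
  pi @^-1` (F r (pi x)) `&` eqclass E' x.

End Extensions.

Definition pointwise_ergodic_family_L1 (R : realType) (d : measure_display)
    (X : measurableType d) (I : set R) (mu : probability X R)
    (E : set (X * X)) (F : R -> X -> set X) : Prop :=
  forall (d' : measure_display) (X' : measurableType d')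
    (mu' : probability X' R) (E' : set (X' * X')) (pi : X' -> X),
  class_bijective_extension mu E mu' E' pi ->
  forall f : X' -> R, mu'.-integrable setT (EFin \o f) ->
  exists2 g : X' -> R, is_cond_exp mu' (invariant_sets mu' E') f g &
    {ae mu', forall x, average (lift_family E' pi F) f r x
       @[r --> within I (pinfty_nbhs R)] --> g x}.

(* Main.v *)
Require Import Defs.
From mathcomp Require Import all_boot all_order all_algebra.
From mathcomp Require Import finmap.
From mathcomp Require Import all_classical all_reals all_analysis.
From mathcomp Require Import measurable_realfun lra.

(** The averages of an invariant function are constant, those of a bounded coboundary
    [g - g \o psi] tend to [0] by asymptotic invariance, and every [f] in [L^1] is [h + c + e] with
    [h] invariant, [c] a bounded coboundary and [e] of small norm.  Hence the theorem follows, by the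
    Banach principle, from a weak type (1,1) inequality for the maximal function of the averages.

    That inequality is transferred from finite sets.  Let [D] be the set of points [z] at which some
    average over [F_s(z)] of a function [k >= 0] exceeds [lam].  Inside the finite set [F_r(x)], a
    greedy selection of the sets [F_s(z)], by decreasing [s] and as long as half of the [k]-mass of
    the set is not covered yet, bounds the number of points of [D] by [4C / lam] times the sum of [k];
    the points [z] for which [F_s(z)] leaves [F_r(x)] are few for [r] large, by asymptotic invariance.
    Integrating over [x] and letting [r] tend to infinity bounds the measure of [D].  The selection
    only uses two bounds on overlaps, at equal and at smaller index, and these hold for regular as well
    as for uniform tempered families.

    For a real index, [D] is the projection of a measurable set, so its measurability modulo null sets
    rests on the measurable projection theorem.  The same theorem makes a countable group that
    generates the relation lift to measurable maps of a class-bijective extension; after modification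
    on an invariant null set, everything takes place in the orbits of countably many invertible
    measure preserving maps. *)

Set Implicit Arguments.
Unset Strict Implicit.
Unset Printing Implicit Defensive.

Import Order.TTheory GRing.Theory Num.Theory.
Import numFieldNormedType.Exports.

Local Open Scope classical_set_scope.
Local Open Scope ring_scope.

(** * Measurable hulls *)

(** Two obstacles shape the estimates. For uniform tempered families no bound proportional to the
    size of [F_n(x)] is available for the number of sets [F_n(z)] of the same index that meet it;
    only the number of those through a given point is controlled. A selection of disjoint sets is
    thus out of reach, and the rule of the uncovered half replaces it: overlaps at equal index are
    counted point by point, with weights inverse to the sizes of the sets. The factor [4 * C] is
    [2 * C] for the points whose set meets a selected set of larger index, plus [2 * C] for the
    others.

    Moreover, averaging does not preserve integrals, so the mean of the averages of an indicator of
    [D] is not the measure of [D]. It is eventually at least this measure minus [e], by the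
    decomposition into invariant part, coboundary and small error, which is therefore used already
    for the maximal inequality. Averaging has norm at most [C] on integrable functions, and this is
    the origin of the second factor in the final constant [4 * C ^+ 2 / lam]. *)

Lemma ler_eps (R : realType) (a b : R) : (forall e : R, 0 < e -> a <= b + e) -> a <= b.
Proof. by move=> h; apply/ler_addgt0Pr => e; exact: h. Qed.

Lemma ex_invS_lt (R : realType) (e : R) : 0 < e -> exists n : nat, n.+1%:R^-1 < e.
Proof.
by move=> e0; have [n] := ltr_add_invr (y := 0) (x := e) e0; rewrite add0r; exists n.
Qed.

Section OuterHull.
Context (R : realType) (d : measure_display) (X : measurableType d).
Variable mu : probability X R.

Lemma fin_probability (A : set X) : measurable A -> mu A \is a fin_num.
Proof. by move=> mA; exact: fin_num_measure. Qed.

Lemma hull_exists (E : set X) : exists H, [/\ measurable H, E `<=` H &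
  forall H', measurable H' -> E `<=` H' -> (mu H <= mu H')%E].
Proof.
pose S := [set fine (mu H) | H in [set H | measurable H /\ E `<=` H]].
have hS : has_inf S.
  split; first by exists (fine (mu setT)); exists setT.
  by exists 0 => _ [H [mH _] <-]; rewrite fine_ge0.
have /choice[H hH] : forall n : nat, exists H,
    [/\ measurable H, E `<=` H & fine (mu H) < inf S + n.+1%:R^-1].
  move=> n; have e0 : 0 < n.+1%:R^-1 :> R by rewrite invr_gt0.
  by have [_ [H [mH EH] <-] ltH] := inf_adherent e0 hS; exists H.
exists (\bigcap_n H n); split.
- by apply: bigcapT_measurable => n; have [] := hH n.
- by move=> x Ex n _; have [_ + _] := hH n; exact.
move=> H' mH' EH'.
have mI : measurable (\bigcap_n H n).
  by apply: bigcapT_measurable => n; have [] := hH n.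
rewrite -(fineK (fin_probability mI)) -(fineK (fin_probability mH')) lee_fin.
have lb : inf S <= fine (mu H') by apply: ge_inf; [exact: hS.2|exists H'].
apply: le_trans lb; apply: ler_eps => e e0.
have [n hn] := ex_invS_lt e0.
have [mHn _ ltn] := hH n.
apply: (@le_trans _ _ (fine (mu (H n)))).
  rewrite fine_le ?fin_probability// le_measure ?inE//.
  exact: bigcap_inf.
by apply: ltW; apply: (lt_trans ltn); rewrite ltrD2l.
Qed.

(** A measurable cover of least measure, fixed once and for all; its measure is the outer measure of
    the set. *)
Definition hull (E : set X) : set X := xget setT [set H | [/\ measurable H, E `<=` H &
  forall H', measurable H' -> E `<=` H' -> (mu H <= mu H')%E]].

Lemma hullP E : [/\ measurable (hull E), E `<=` hull E &
  forall H', measurable H' -> E `<=` H' -> (mu (hull E) <= mu H')%E].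
Proof.
have [H hH] := hull_exists E; rewrite /hull.
by case: xgetP => [_ _ //|/(_ H)]; case.
Qed.

Lemma measurable_hull E : measurable (hull E). Proof. by have [] := hullP E. Qed.

Lemma sub_hull E : E `<=` hull E. Proof. by have [] := hullP E. Qed.

Lemma hull_min E H : measurable H -> E `<=` H -> (mu (hull E) <= mu H)%E.
Proof. by have [_ _] := hullP E; exact. Qed.

Definition outer (E : set X) : R := fine (mu (hull E)).

Lemma outerE E : mu (hull E) = (outer E)%:E.
Proof. by rewrite fineK// fin_probability//; exact: measurable_hull. Qed.

Lemma outer_le E H : measurable H -> E `<=` H -> ((outer E)%:E <= mu H)%E.
Proof. by move=> mH EH; rewrite -outerE hull_min. Qed.

Lemma le_outer E E' : E `<=` E' -> outer E <= outer E'.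
Proof.
move=> EE'; rewrite -lee_fin -(outerE E'); apply: outer_le.
  exact: measurable_hull.
exact: subset_trans EE' (@sub_hull _).
Qed.

(** The intersections [G n] of the later hulls are measurable, increase, and lie between [F n] and
    [hull (F n)]; continuity of [mu] along them gives continuity of the outer measure from below,
    for arbitrary sets. *)
Lemma outer_bigcup (F : nat -> set X) (e : R) : {homo F : n m / (n <= m)%N >-> n `<=` m} ->
  0 < e -> exists n, outer (\bigcup_n F n) - e < outer (F n).
Proof.
move=> homoF e0; pose G n := \bigcap_(k in [set k | (n <= k)%N]) hull (F k).
have mG n : measurable (G n).
  by apply: bigcap_measurableType => // k _; exact: measurable_hull.
have mU : measurable (\bigcup_n G n) by exact: bigcup_measurable.
have homoG : {homo G : n m / (n <= m)%N >-> (n <= m)%O}.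
  by move=> n m nm; apply/subsetPset => x Gx k /= mk; apply: Gx; exact: leq_trans mk.
have sG n : F n `<=` G n.
  by move=> x Fx k /= nk; apply: sub_hull; exact: homoF Fx.
have : mu (G n) @[n --> \oo] --> (fine (mu (\bigcup_n G n)))%:E.
  by rewrite fineK ?fin_probability//; exact: nondecreasing_cvg_mu.
move=> /fine_cvgP[_].
move=> /cvgr_dist_lt/(_ e e0)[N _ /(_ N)] /= /(_ (leqnn _)) hN.
exists N.
have h1 : outer (\bigcup_n F n) <= fine (mu (\bigcup_n G n)).
  rewrite -lee_fin [leRHS]fineK ?fin_probability//; apply: outer_le => //.
  by apply: subset_bigcup => n _; exact: sG.
have h2 : fine (mu (G N)) <= outer (F N).
  rewrite -lee_fin -outerE [leLHS]fineK ?fin_probability//.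
  rewrite le_measure ?inE//; first exact: measurable_hull.
  by apply: bigcap_inf => /=.
by move: hN; rewrite ltr_norml => /andP[_]; lra.
Qed.

(** The union of the inner approximations has the measure of the hull, so what it misses of [E] lies
    in a null set. *)
Lemma negligible_outer (E : set X) (L : nat -> set X) :
  (forall n, [/\ measurable (L n), L n `<=` E & outer E - n.+1%:R^-1 <= fine (mu (L n))]) ->
  exists A, [/\ measurable A, A `<=` E & mu.-negligible (E `\` A)].
Proof.
move=> hL; pose A := \bigcup_n L n.
have mA : measurable A by apply: bigcup_measurable => n _; have [] := hL n.
exists A; split => //; first by move=> x [n _]; have [_ + _] := hL n; exact.
have AH : A `<=` hull E.
  by move=> x [n _ Lx]; apply: sub_hull; have [_ + _] := hL n; exact.
exists (hull E `\` A); split.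
- by apply: measurableD => //; exact: measurable_hull.
- have mHA : measurable (hull E `&` A) by apply: measurableI => //; exact: measurable_hull.
  have -> : mu (hull E `\` A) = (mu (hull E) - mu A)%E.
    rewrite measureD//; last by rewrite ltey_eq fin_probability//; exact: measurable_hull.
      by rewrite (setIidr AH).
    exact: measurable_hull.
  rewrite outerE -(fineK (fin_probability mA)) -EFinB; congr EFin.
  apply/eqP; rewrite eq_le; apply/andP; split.
    rewrite subr_le0; apply: ler_eps => e e0.
    have [n hn] := ex_invS_lt e0.
    have [mL LE hle] := hL n.
    have hA : fine (mu (L n)) <= fine (mu A).
      rewrite fine_le ?fin_probability// le_measure ?inE//; exact: bigcup_sup.
    by move: hle hn hA; set c := _^-1; lra.
  rewrite subr_ge0 -lee_fin [leLHS]fineK ?fin_probability// -outerE.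
  by rewrite le_measure ?inE//; exact: measurable_hull.
- by move=> x [Ex nAx]; split => //; exact: sub_hull.
Qed.

End OuterHull.

(** * Suslin sets and measurable projections *)

Lemma countable_enum (T : Type) (A : set T) (a : T) : countable A -> A a ->
  exists f : nat -> T, (forall n, A (f n)) /\ forall x, A x -> exists n, f n = x.
Proof.
move=> /countable_injP[g gI] Aa.
exists (fun n => if pselect (exists x, A x /\ g x = n) is left h then sval (cid h) else a).
split=> [n|x Ax]; first by case: pselect => // h; case: (cid h) => z [].
exists (g x); case: pselect => [h|[]]; last by exists x.
by case: (cid h) => z [Az gz] /=; apply: gI => //; rewrite inE.
Qed.

Section Suslin.
Context (R : realType) (d : measure_display) (X : measurableType d).
Variable P : completePseudoMetricType R.

(* [A n s x /\ K n s y] is the [n]-th condition imposed by the branch [s]; it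
   is decided by a finite initial segment of [s]. *)
Definition suslin_scheme (A : nat -> (nat -> nat) -> set X)
    (K : nat -> (nat -> nat) -> set P) :=
  [/\ forall n s, measurable (A n s), forall n s, closed (K n s)
    & forall n s, exists m, forall t, (forall k, (k < m)%N -> t k = s k) ->
        A n t = A n s /\ K n t = K n s].

Definition suslin (B : set (X * P)) := exists A K, suslin_scheme A K /\
  forall x y, B (x, y) <-> exists s, forall n, A n s x /\ K n s y.

Lemma suslin_rect A K : measurable A -> closed K -> suslin (A `*` K).
Proof.
move=> mA cK; exists (fun _ _ => A), (fun _ _ => K); split.
  by split => // n s; exists 0%N.
move=> x y; split=> [[/= Ax Ky]|[s /(_ 0%N)//]].
by exists (fun=> 0%N).
Qed.

(** The first entry of a branch chooses [i], the rest is a branch for [F i]. *)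
Lemma suslin_bigcup (F : nat -> set (X * P)) :
  (forall i, suslin (F i)) -> suslin (\bigcup_i F i).
Proof.
move=> /choice[A /choice[K hAK]].
exists (fun n s => A (s 0%N) n (fun k => s k.+1)), (fun n s => K (s 0%N) n (fun k => s k.+1)).
split.
  split=> n s; have [[mA cK dep] _] := hAK (s 0%N); first exact: mA.
    exact: cK.
  have [m hm] := dep n (fun k => s k.+1).
  exists m.+1 => t ts; rewrite (ts 0%N)//.
  by apply: hm => k km; exact: ts.
move=> x y; split.
  move=> [i _ Fi]; have [_ h] := hAK i.
  by have [s hs] := (h x y).1 Fi; exists (fun k => if k is k'.+1 then s k' else i).
move=> [s hs]; exists (s 0%N) => //; have [_ h] := hAK (s 0%N).
by apply/h; exists (fun k => s k.+1).
Qed.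

(** An index that decodes to nothing merely repeats the condition coded by [(0, 0)]. *)
Let unp (n : nat) : nat * nat := odflt (0%N, 0%N) (choice.unpickle n).

Let unpK (p : nat * nat) : unp (choice.pickle p) = p.
Proof. by rewrite /unp choice.pickleK. Qed.

(** By the pairing of integers, one branch carries a branch for every [F i]. *)
Lemma suslin_bigcap (F : nat -> set (X * P)) :
  (forall i, suslin (F i)) -> suslin (\bigcap_i F i).
Proof.
move=> /choice[A /choice[K hAK]].
exists (fun n s => A (unp n).1 (unp n).2 (fun k => s (choice.pickle ((unp n).1, k)))).
exists (fun n s => K (unp n).1 (unp n).2 (fun k => s (choice.pickle ((unp n).1, k)))).
split.
  split=> n s; move: (unp n) => [i j] /=; have [[mA cK dep] _] := hAK i; first exact: mA.
    exact: cK.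
  have [m hm] := dep j (fun k => s (choice.pickle (i, k))).
  (* The sum of the successors exceeds each of the positions consulted. *)
  exists (\sum_(k < m) (choice.pickle (i, val k)).+1)%N => t ts.
  apply: hm => k km; apply: ts.
  by rewrite (bigD1 (Ordinal km))//= leq_addr.
move=> x y; split.
  move=> h; have /choice[s hs] : forall i, exists s, forall n, A i n s x /\ K i n s y.
    by move=> i; have [_ hi] := hAK i; apply/hi/h.
  exists (fun n => s (unp n).1 (unp n).2) => n.
  have -> : (fun k => s (unp (choice.pickle ((unp n).1, k))).1 (unp (choice.pickle ((unp n).1, k))).2) = s (unp n).1.
    by apply/funext => k; rewrite unpK.
  exact: hs.
move=> [s hs] i _; have [_ hi] := hAK i; apply/hi.
exists (fun k => s (choice.pickle (i, k))) => n.
by have := hs (choice.pickle (i, n)); rewrite unpK.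
Qed.

Hypothesis scP : @second_countable P.

Lemma countable_base : exists U : nat -> set P,
  (forall i, open (U i)) /\ forall y V, nbhs y V -> exists i, U i y /\ U i `<=` V.
Proof.
have [B cB [oB nB]] := scP.
have B0 : B !=set0.
  have [U [BU _] _] := nB point setT filterT; by exists U.
have [U0 BU0] := B0.
have [f [Bf fB]] := countable_enum cB BU0.
exists f; split=> [i|y V /nB[U [BU Uy] UV]]; first exact: oB.
by have [i fi] := fB _ BU; exists i; rewrite fi.
Qed.

Section Capacity.
Variables (mu : probability X R) (A : nat -> (nat -> nat) -> set X).
Variable K : nat -> (nat -> nat) -> set P.
Hypothesis hAK : suslin_scheme A K.

(** The index of a set of level [j] locates a point up to [1/(j+1)], and bounds on these indices
    provide total boundedness in [P]. Basic sets that are too large are replaced by the empty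
    set. *)
Lemma small_cover : exists V : nat -> nat -> set P,
  (forall j i, exists p, V j i `<=` ball p (j.+1%:R^-1)) /\
  forall j y, exists i, V j i y.
Proof.
have [U [_ hU]] := countable_base.
exists (fun j i => if `[< exists p, U i `<=` ball p (j.+1%:R^-1 : R) >] then U i else set0); split.
  by move=> j i; case: asboolP => // _; exists point.
move=> j y; have [|i [Uy Us]] := hU y (ball y (j.+1%:R^-1)).
  by apply: nbhsx_ballx; rewrite invr_gt0.
by exists i; case: asboolP => // -[]; exists y.
Qed.

Variable V : nat -> nat -> set P.
Hypothesis Vsmall : forall j i, exists p, V j i `<=` ball p (j.+1%:R^-1 : R).
Hypothesis Vcover : forall j y, exists i, V j i y.

Let s_ (p : seq nat) : nat -> nat := nth 0%N p.

Let determined n p := forall t, (forall k, (k < size p)%N -> t k = s_ p k) ->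
  A n t = A n (s_ p) /\ K n t = K n (s_ p).

(** The bound acts on the branch and on the cover index of [y] together: one more entry, taken
    large, loses little outer measure, while bounds at all entries leave a compactness argument for
    both. *)
Let proj_bounded (l : seq nat) : set X := [set x | exists y s,
  (forall j, (j < size l)%N -> (s j <= nth 0 l j)%N /\
     exists2 i, (i <= nth 0 l j)%N & V j i y)
  /\ forall n, A n s x /\ K n s y].

(** Only conditions decided by the finite sequence [p] are tested, and the witness [y] depends on
    [p] alone; the union is thus countable and the set measurable. *)
Let approx (N : nat -> nat) (k : nat) : set X :=
  \bigcup_(p in [set p : seq nat | size p = k /\ (forall j, (j < k)%N -> (nth 0 p j <= N j)%N)
     /\ exists y, (forall n, determined n p -> K n (s_ p) y) /\
         forall j, (j < k)%N -> exists2 i, (i <= N j)%N & V j i y])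
   \bigcap_(n in [set n | determined n p]) A n (s_ p).

Let measurable_approx N k : measurable (approx N k).
Proof.
have [mA _ _] := hAK.
rewrite /approx bigcup_mkcond; apply: countable_bigcupT_measurable => // p.
case: ifP => // _.
by apply: bigcap_measurableType => n _; exact: mA.
Qed.

Let sub_approx N k : proj_bounded (mkseq N k) `<=` approx N k.
Proof.
move=> x [y [s [hb hs]]].
have sE j : (j < k)%N -> nth 0%N (mkseq s k) j = s j by move=> jk; rewrite nth_mkseq.
have dE n : determined n (mkseq s k) -> A n s = A n (s_ (mkseq s k)) /\ K n s = K n (s_ (mkseq s k)).
  by move=> dn; apply: dn => j; rewrite size_mkseq => jk; rewrite /s_ sE.
rewrite size_mkseq in hb.
have hb' j : (j < k)%N -> (s j <= N j)%N /\ exists2 i, (i <= N j)%N & V j i y.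
  by move=> jk; have := hb _ jk; rewrite nth_mkseq.
exists (mkseq s k).
  split; first by rewrite size_mkseq.
  split; first by move=> j jk; rewrite sE//; have [] := hb' _ jk.
  exists y; split; last by move=> j jk; have [] := hb' _ jk.
  by move=> n /dE[_ <-]; have [] := hs n.
by move=> n /= /dE[<- _]; have [] := hs n.
Qed.

Let ultra_nat_le (T : Type) (G : set_system T) (UG : UltraFilter G) (f : T -> nat) (M : nat) (Q : nat -> T -> Prop) :
  G [set t | exists2 i, (i <= M)%N & Q i t] -> exists2 i, (i <= M)%N & G [set t | Q i t].
Proof.
elim: M => [|M IH] hG.
  exists 0%N => //; apply: filterS hG => t [i]; rewrite leqn0 => /eqP ->//.
have [h|h] := in_ultra_setVsetC [set t | Q M.+1 t] UG; first by exists M.+1.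
have [|i iM Qi] := IH; last by exists i => //; exact: leqW.
apply: filterS (filterI hG h) => t [[i iM Qi] nQ]; exists i => //.
by move: iM; rewrite leq_eqVlt => /predU1P[iE|//]; rewrite iE in Qi.
Qed.

(* Compactness of the set of branches bounded by [N], via an ultrafilter. *)
Let approx_sub N x : (forall k, approx N k x) -> exists y s, forall n, A n s x /\ K n s y.
Proof.
have [_ cK dep] := hAK.
move=> h; have /choice[p hp] : forall k, exists p : seq nat,
    ((size p = k /\ (forall j, (j < k)%N -> (nth 0 p j <= N j)%N)
     /\ exists y, (forall n, determined n p -> K n (s_ p) y) /\
         forall j, (j < k)%N -> exists2 i, (i <= N j)%N & V j i y))
   /\ forall n, determined n p -> A n (s_ p) x.
  by move=> k; have [p hp1 hp2] := h k; exists p; split.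
have /choice[y hy] : forall k, exists y, (forall n, determined n (p k) -> K n (s_ (p k)) y) /\
         forall j, (j < k)%N -> exists2 i, (i <= N j)%N & V j i y.
  by move=> k; have [[_ [_ [y hy]]] _] := hp k; exists y.
have [G [UG sG]] := ultraFilterLemma eventually_filter.
have FG : Filter G by exact: filter_filter.
have Glt j : G [set k | (j < k)%N] by apply: sG; exists j.+1.
have /choice[s hs] : forall j, exists v, G [set k | nth 0%N (p k) j = v].
  move=> j; have [|v _ Gv] := @ultra_nat_le _ G UG (fun=> 0%N) (N j) (fun i k => nth 0%N (p k) j = i).
    apply: filterS (Glt j) => k /= jk; exists (nth 0%N (p k) j) => //.
    by have [[_ [+ _]] _] := hp k; exact.
  by exists v.
have Gagree m : G [set k | forall j, (j < m)%N -> nth 0%N (p k) j = s j].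
  elim: m => [|m IH]; first by apply: filterS filterT.
  apply: filterS (filterI IH (hs m)) => k [h1 h2] j.
  by rewrite ltnS leq_eqVlt => /predU1P[->//|]; exact: h1.
have Gdet n : G [set k | determined n (p k) /\ A n (s_ (p k)) = A n s /\ K n (s_ (p k)) = K n s].
  have [m hm] := dep n s.
  apply: filterS (filterI (Gagree m) (Glt m)) => k [h1 mk].
  have [[sp _] _] := hp k.
  have [e1 e2] := hm _ h1; split; last by [].
  move=> t ht; have [|e1' e2'] := hm t.
    by move=> j jm; rewrite ht; [exact: h1|rewrite sp; exact: ltn_trans jm mk].
  by rewrite e1' e2'.
(* For each [j] the ultrafilter selects a single set [V j i], of radius [1/(j+1)], in which the
   points [y k] eventually lie; so their image is a Cauchy filter. *)
have cy : cvg (y @ G).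
  apply: cauchy_cvg; apply: cauchy_exP => e e0.
  have [j hj] := ex_invS_lt e0.
  have [|i iN Gi] := @ultra_nat_le _ G UG (fun=> 0%N) (N j) (fun i k => V j i (y k)).
    by apply: filterS (Glt j) => k jk; have [_ ] := hy k; exact.
  have [q hq] := Vsmall j i; exists q; apply: filterS Gi => k /= /hq.
  exact: le_ball (ltW hj) _.
exists (lim (y @ G)), s => n; split.
  have /filter_ex[k [dn [eA _]]] := Gdet n.
  by rewrite -eA; have [_ +] := hp k; exact.
apply: (closed_cvg (K n s) (cK n s) _ _ cy).
apply: filterS (Gdet n) => k /= [dn [_ <-]]; have [+ _] := hy k; exact.
Qed.

(** Capacitability. The bounds [N j] are chosen one after the other, each losing at most
    [e / 2 ^+ j.+1] of the outer measure by [outer_bigcup]. The measurable sets [L k] contain the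
    bounded projections, and their decreasing intersection lies in [E] by [approx_sub]. *)
Lemma suslin_proj_inner (e : R) : 0 < e ->
  let E := [set x | exists y s, forall n, A n s x /\ K n s y] in
  exists L, [/\ measurable L, L `<=` E & outer mu E - e <= fine (mu L)].
Proof.
move=> e0 E.
have pb0 : proj_bounded [::] = E.
  apply/seteqP; split=> x [y [s]]; first by move=> [_ h]; exists y, s.
  by move=> h; exists y, s; split.
have step l (e' : R) : 0 < e' -> exists b, outer mu (proj_bounded l) - e' < outer mu (proj_bounded (rcons l b)).
  move=> e'0.
  have hm : {homo (fun b => proj_bounded (rcons l b)) : n m / (n <= m)%N >-> n `<=` m}.
    move=> n m nm x [y [s [h1 h2]]]; exists y, s; split => // j; rewrite size_rcons => jl.
    have := h1 j; rewrite size_rcons => /(_ jl)[]; rewrite !nth_rcons.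
    case: ifP => // _; case: ifP => //= _ h3 [i h4 Vi]; split; first exact: leq_trans nm.
    by exists i => //; exact: leq_trans nm.
  have [b hb] := @outer_bigcup _ _ _ mu _ _ hm e'0.
  exists b; apply: le_lt_trans hb; rewrite lerD2r; apply: le_outer => x [y [s [h1 h2]]].
  have [i Vi] := Vcover (size l) y.
  exists (maxn i (s (size l))) => //; exists y, s; split => // j.
  rewrite size_rcons ltnS leq_eqVlt nth_rcons => /predU1P[->|jl].
    rewrite ltnn eqxx leq_maxr; split=> //; exists i => //; exact: leq_maxl.
  by rewrite jl; exact: h1.
have /choice[b hb] : forall l, exists b, outer mu (proj_bounded l) - e / 2 ^+ (size l).+1 < outer mu (proj_bounded (rcons l b)).
  by move=> l; apply: step; rewrite divr_gt0// exprn_gt0.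
pose l := fix l k := if k is k'.+1 then rcons (l k') (b (l k')) else [::].
have szl k : size (l k) = k by elim: k => //= k IH; rewrite size_rcons IH.
pose N j := b (l j).
have lE k : l k = mkseq N k.
  by elim: k => // k IH; rewrite mkseqS -IH.
have ol k : outer mu E - e * (1 - 2^-1 ^+ k) <= outer mu (proj_bounded (l k)).
  elim: k => [|k IH]; first by rewrite expr0 subrr mulr0 subr0 /= pb0.
  have := hb (l k); rewrite szl [l k.+1]/= => /ltW; apply: le_trans.
  move: IH; rewrite -exprVn exprS; set u := _ ^+ k; lra.
pose L k := \bigcap_(j in [set j | (j <= k)%N]) approx N j.
have mL k : measurable (L k) by apply: bigcap_measurableType => j _; exact: measurable_approx.
have mI : measurable (\bigcap_k L k) by exact: bigcapT_measurable.
have pbL k : proj_bounded (l k) `<=` L k.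
  move=> x [y [s [h1 h2]]] j /= jk; apply: sub_approx; exists y, s; split => // i.
  rewrite size_mkseq => ij; have := h1 i; rewrite szl => /(_ (leq_trans ij jk)).
  by rewrite lE !nth_mkseq// (leq_trans ij).
exists (\bigcap_k L k); split => //.
  move=> x hx; apply: (@approx_sub N) => k; apply: (hx k) => //=.
apply: ler_eps => e' e'0.
have hcv : mu (L n) @[n --> \oo] --> (fine (mu (\bigcap_n L n)))%:E.
  rewrite fineK ?fin_probability//; apply: nonincreasing_cvg_mu => //.
    by rewrite ltey_eq fin_probability.
  by move=> n m nm; apply/subsetPset => x Lx j /= jn; apply: Lx; exact: leq_trans jn nm.
move: hcv => /fine_cvgP[_].
move=> /cvgr_dist_lt/(_ e' e'0)[k _ /(_ k)] /= /(_ (leqnn _)).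
rewrite ltr_norml => /andP[+ _].
have h1 : outer mu (proj_bounded (l k)) <= fine (mu (L k)).
  by rewrite -lee_fin [leRHS]fineK ?fin_probability//; exact: outer_le.
have h2 := ol k; have h3 : 0 <= e * 2^-1 ^+ k by rewrite mulr_ge0 ?(ltW e0)// exprn_ge0// invr_ge0.
move: h1 h2 h3; set u := _ ^+ k; lra.
Qed.

End Capacity.

Lemma suslin_proj (mu : probability X R) (B : set (X * P)) : suslin B ->
  exists L, [/\ measurable L, L `<=` [set x | exists y, B (x, y)]
    & mu.-negligible ([set x | exists y, B (x, y)] `\` L)].
Proof.
move=> [A [K [hAK hB]]].
have [V [Vs Vc]] := small_cover.
have EE : [set x | exists y, B (x, y)] = [set x | exists y s, forall n, A n s x /\ K n s y].
  by apply/seteqP; split=> x [y] /hB; exists y => //; apply/hB.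
rewrite EE.
have /choice[L hL] : forall n : nat, exists L, [/\ measurable L,
    L `<=` [set x | exists y s, forall n, A n s x /\ K n s y] &
    outer mu [set x | exists y s, forall n, A n s x /\ K n s y] - n.+1%:R^-1 <= fine (mu L)].
  by move=> n; apply: (suslin_proj_inner mu hAK Vs Vc); rewrite invr_gt0.
exact: negligible_outer hL.
Qed.

End Suslin.

(** * Projections and measurability in standard Borel spaces *)

Section Projection.
Context (R : realType) (d d' : measure_display).
Context (X : measurableType d) (Y : measurableType d').

(* Borel sets are Suslin: the sets [B] such that [B] and its complement are
   Suslin (in [X * P]) form a sigma-algebra containing the generators. *)
Lemma measurable_suslin (P : completePseudoMetricType R) (f : Y -> P) (g : P -> Y)
    (B : set (X * Y)) :
  @second_countable P -> cancel f g -> cancel g f ->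
  (forall A : set P, <<s @open P >> A <-> measurable (f @^-1` A)) ->
  measurable B -> suslin [set p : X * P | B (p.1, g p.2)].
Proof.
move=> scP fK gK hf mB.
pose h (p : X * P) := (p.1, g p.2).
pose bi (B : set (X * P)) := suslin B /\ suslin (~` B).
suff: bi (h @^-1` B) by case.
have bi0 : bi set0.
  split; last first.
    rewrite setC0; have -> : setT = setT `*` setT :> set (X * P) by rewrite setXTT.
    apply: suslin_rect => //; exact: closedT.
  have -> : set0 = setT `*` set0 :> set (X * P) by rewrite setX0.
  apply: suslin_rect => //; exact: closed0.
have biC A : bi A -> bi (~` A) by move=> [? ?]; split => //; rewrite setCK.
have biU (F : nat -> set (X * P)) : (forall i, bi (F i)) -> bi (\bigcup_i F i).
  move=> hF; split; first by apply: suslin_bigcup => i; have [] := hF i.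
  by rewrite setC_bigcup; apply: suslin_bigcap => i; have [] := hF i.
have biX A : measurable A -> bi (A `*` setT).
  move=> mA; split; first by apply: suslin_rect => //; exact: closedT.
  have -> : ~` (A `*` [set: P]) = ~` A `*` setT.
    by apply/seteqP; split=> -[x y] /=; [move=> nA; split => // Ax; apply: nA|move=> [nA _] []].
  by apply: suslin_rect; [exact: measurableC|exact: closedT].
have biO O : open O -> bi (setT `*` O).
  move=> oO; split; last first.
    have -> : ~` ([set: X] `*` O) = setT `*` ~` O.
      by apply/seteqP; split=> -[x y] /=; [move=> nA; split => // Ax; apply: nA|move=> [_ nA] []].
    by apply: suslin_rect => //; exact: open_closedC.
  (* [suslin_rect] needs closed sets; by regularity [O] is a union of closures of basic sets. *)
  have [U [_ hU]] := countable_base scP.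
  have -> : [set: X] `*` O = \bigcup_i (setT `*` (if `[< closure (U i) `<=` O >] then closure (U i) else set0)).
    apply/seteqP; split=> -[x y]; last first.
      by move=> [i _] [_ /=]; case: asboolP => // h1 /h1.
    move=> [_ /= Oy].
    have [V nV VO] := @uniform_regular P y O (open_nbhs_nbhs (conj oO Oy)).
    have [i [Uy UV]] := hU y V nV.
    exists i => //; split => //=; case: asboolP => [_|[]]; first exact: subset_closure.
    by apply: subset_trans VO; exact: closure_subset.
  apply: suslin_bigcup => i; apply: suslin_rect => //; case: ifP => _; last exact: closed0.
  exact: closed_closure.
pose G := [set A : set (X * Y) | bi (h @^-1` A)].
have sG : sigma_algebra setT G.
  split=> [|A|F hF]; rewrite /G/=; first by rewrite preimage_set0.
    by rewrite setTD preimage_setC; exact: biC.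
  by rewrite preimage_bigcup; exact: biU.
pose GP := [set A : set P | bi (setT `*` A)].
have sGP : sigma_algebra setT GP.
  split=> [|A|F hF]; rewrite /GP/=; first by rewrite setX0.
    have -> : [set: X] `*` ([set: P] `\` A) = ~` (setT `*` A); last exact: biC.
    by apply/seteqP; split=> -[x y] /=; [move=> [_ [_ nA]] []|move=> nA; split=> //; split=> // Ay; exact: nA].
  have -> : [set: X] `*` \bigcup_k F k = \bigcup_k (setT `*` F k); last exact: biU.
  by apply/seteqP; split=> -[x y] /=; [move=> [_ [k _ ?]]; exists k|move=> [k _ [_ ?]]; split => //; exists k].
have mG : measurable `<=` G.
  apply: smallest_sub => //; rewrite subUset; split.
    move=> _ [A mA <-]; rewrite /G /= setTI.
    have -> : h @^-1` (fst @^-1` A) = A `*` setT by apply/seteqP; split=> -[x y] //= [].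
    exact: biX.
  move=> _ [A mA <-]; rewrite /G /= setTI.
  have -> : h @^-1` (snd @^-1` A) = setT `*` (g @^-1` A) by apply/seteqP; split=> -[x y] //= [].
  have : (<<s @open P >>) (g @^-1` A).
    apply/hf; suff -> : f @^-1` (g @^-1` A) = A by [].
    by apply/seteqP; split=> y /=; rewrite fK.
  by move: (g @^-1` A); apply: smallest_sub => // O; exact: biO.
exact: mG.
Qed.

Lemma measurable_projection (mu : probability X R) (B : set (X * Y)) :
  standard_borel R Y -> measurable B ->
  exists L, [/\ measurable L, L `<=` [set x | exists y, B (x, y)]
    & mu.-negligible ([set x | exists y, B (x, y)] `\` L)].
Proof.
move=> [P [f [hP scP [g fK gK] hf]]] mB.
have := suslin_proj scP mu (measurable_suslin scP fK gK hf mB).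
suff -> : [set x | exists y, B (x, y)] = [set x | exists y, [set p | B (p.1, g p.2)] (x, y)] by [].
apply/seteqP; split=> x [y] /= hB; last by exists (g y).
by exists (f y) => /=; rewrite fK.
Qed.

(** Measurability of maps into [Y], and of the set where two of them agree, reduces to countably
    many sets. *)
Lemma standard_borel_base : standard_borel R Y -> exists U : nat -> set Y,
  [/\ forall i, measurable (U i), forall y z, y <> z -> exists i, U i y /\ ~ U i z
    & forall (d0 : measure_display) (Z : measurableType d0) (phi : Z -> Y),
      (forall i, measurable (phi @^-1` (U i))) -> measurable_fun setT phi].
Proof.
move=> [P [f [hP scP [g fK gK] hf]]].
have [U [oU hU]] := countable_base scP.
exists (fun i => f @^-1` U i); split.
- by move=> i; apply/hf; exact: sub_sigma_algebra.
- move=> y z yz.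
  have fyz : f y <> f z by move=> /(can_inj fK).
  move: hP; rewrite open_hausdorff => /(_ (f y) (f z)).
  move=> /(_ (introN eqP fyz)) [[A B] /= [Ay Bz] [oA oB /eqP AB]].
  rewrite !inE in Ay Bz.
  have [i [Uy UA]] := hU (f y) A (open_nbhs_nbhs (conj oA Ay)).
  exists i; split => //= Uz.
  have : (A `&` B) (f z) by split=> //; exact: UA.
  by rewrite AB.
- move=> d0 Z phi mphi _ A mA; rewrite setTI.
  have -> : phi @^-1` A = (f \o phi) @^-1` (g @^-1` A).
    by apply/seteqP; split=> z /=; rewrite fK.
  have : (<<s @open P >>) (g @^-1` A).
    apply/hf; suff -> : f @^-1` (g @^-1` A) = A by [].
    by apply/seteqP; split=> y /=; rewrite fK.
  move: (g @^-1` A).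
  apply: (@smallest_sub _ _ _ [set B : set P | measurable ((f \o phi) @^-1` B)]).
    split=> [|B|F hF] /=; first by rewrite preimage_set0.
      by move=> mB; rewrite setTD -[X in measurable X]/(~` _); exact: measurableC.
    by rewrite preimage_bigcup; apply: bigcup_measurable => k _; exact: hF.
  move=> O oO /=.
  have -> : O = \bigcup_(i in [set i | U i `<=` O]) U i.
    apply/seteqP; split=> [y Oy|y [i /= UO Uy]]; last exact: UO.
    by have [i [? ?]] := hU y O (open_nbhs_nbhs (conj oO Oy)); exists i.
  by rewrite preimage_bigcup; apply: bigcup_measurable => i _; exact: mphi.
Qed.

Lemma measurable_eq_fun (d0 : measure_display) (Z : measurableType d0) (phi psi : Z -> Y) :
  standard_borel R Y -> measurable_fun setT phi -> measurable_fun setT psi ->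
  measurable [set z | phi z = psi z].
Proof.
move=> /standard_borel_base[U [mU sep _]] mphi mpsi.
have -> : [set z | phi z = psi z] = \bigcap_i ~` ((phi @^-1` U i) `\` (psi @^-1` U i)).
  apply/seteqP; split=> z /=; first by move=> e i _ /= []; rewrite e.
  move=> h; apply: contrapT => /sep[i [h1 h2]]; exact: (h i).
apply: bigcapT_measurable => i; apply: measurableC.
by apply: measurableD; rewrite -[X in measurable X]setTI; [exact: mphi|exact: mpsi].
Qed.

End Projection.

(** This allows projecting along the index of the family, a real number. *)
Lemma standard_borel_real (R : realType) : standard_borel R (measurableTypeR R).
Proof.
exists R, id; split; [exact: Rhausdorff| |by exists id|].
  exists (range (fun q : rat * rat => `]ratr q.1, ratr q.2[%classic)).
    exact: card_le_trans (card_image_le _ _) (countableP _).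
  split=> [_ [q _ <-]|x V]; first exact: interval_open.
  move=> /nbhs_ballP[e /= e0 xe].
  have [q1] := @rat_in_itvoo R (x - e) x ltac:(by rewrite ltrBlDr ltrDl).
  have [q2] := @rat_in_itvoo R x (x + e) ltac:(by rewrite ltrDl).
  rewrite !in_itv /= => /andP[b1 b2] /andP[a1 a2].
  exists `]ratr q1, ratr q2[%classic.
    by split; [exists (q1, q2)|rewrite /= in_itv /= a2 b1].
  move=> y /=; rewrite in_itv /= => /andP[y1 y2]; apply: xe; rewrite /ball /= ltr_norml; apply/andP; split; lra.
rewrite /=.
move=> A; rewrite preimage_id; split.
  by move: A; apply: smallest_sub; [exact: sigma_algebra_measurable|exact: open_measurable].
move=> mA; have : (@RGenOpens.G R).-sigma.-measurable A.
  by rewrite -RGenOpens.measurableE.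
move: A {mA}; apply: smallest_sub; first exact: smallest_sigma_algebra.
by move=> _ [x [y ->]]; apply: sub_sigma_algebra; exact: interval_open.
Qed.

(** * Greedy selection in a finite set *)

Section Greedy.
Context (R : realType) (X : choiceType).

(** Each term is at most [C / size T]. When [T] lists points whose sets share a point, this turns an
    overlap bound into a bound on the sum of inverse cardinalities. *)
Lemma sum_inv_le (T : seq X) (n : X -> R) (C : R) : 0 <= C ->
  (forall z, z \in T -> 0 < n z /\ (size T)%:R <= C * n z) -> \sum_(z <- T) (n z)^-1 <= C.
Proof.
move=> C0 h; have [->|T0] := eqVneq T [::]; first by rewrite big_nil.
have s0 : 0 < (size T)%:R :> R by rewrite ltr0n lt0n size_eq0.
rewrite [leRHS](_ : _ = \sum_(z <- T) C / (size T)%:R); last first.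
  by rewrite big_const_seq count_predT iter_addr_0 -[RHS]mulr_natr divfK// gt_eqF.
rewrite !big_seq; apply: ler_sum => z /h[n0 hz].
by rewrite -[leLHS]mul1r ler_pdivrMr// mulrAC ler_pdivlMr// mul1r.
Qed.

Variables (W : seq X) (G : X -> pred X) (s f : X -> R) (lam C : R).
Hypotheses (lam0 : 0 < lam) (C0 : 0 <= C) (f0 : forall y, 0 <= f y).

Let n x : R := (count (G x) W)%:R.
Let S (Q : pred X) := \sum_(y <- W | Q y) f y.
Let cov (A : seq X) y := has (fun x => G x y) A.

Let le_S (P Q : pred X) : (forall y, P y -> Q y) -> S P <= S Q.
Proof.
move=> PQ; rewrite /S [leRHS](bigID P)/= [X in _ <= X + _](eq_bigl P).
  by rewrite lerDl sumr_ge0.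
by move=> y; rewrite andbC; case: (boolP (P y)) => //= /PQ ->.
Qed.

Let S_split (P Q : pred X) : S P = S (fun y => P y && Q y) + S (fun y => P y && ~~ Q y).
Proof. by rewrite /S (bigID Q). Qed.

(* Sets are considered by decreasing [s], and one is selected when at least half of its
   mass is still uncovered. *)
Let select (l : seq X) : sorted (fun x y => s x <= s y) l ->
  (forall z, z \in l -> lam * n z < S (G z)) ->
  exists A, [/\ {subset A <= l}, lam / 2 * \sum_(x <- A) n x <= S (cov A)
    & forall z, z \in l -> lam / 2 * n z <=
        S (fun y => G z y && has (fun x => (s z <= s x) && G x y) A)].
Proof.
elim: l => [|z l IH] sl hl.
  by exists [::]; split => //; rewrite big_nil mulr0 sumr_ge0.
(* The induction treats the tail first, so everything selected so far has index at least [s z]. *)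
have minz x : x \in l -> s z <= s x.
  move: sl; rewrite /= path_sortedE; last by move=> ? ? ?; exact: le_trans.
  by move=> /andP[/allP + _] => /[apply].
have [|A [Al hA hlA]] := IH (path_sorted sl).
  by move=> x xl; apply: hl; rewrite inE xl orbT.
have n0 x : 0 <= n x by exact: ler0n.
have [h|h] := leP (lam / 2 * n z) (S (fun y => G z y && cov A y)).
  exists A; split => //; first by move=> x /Al; rewrite inE orbC => ->.
  move=> x; rewrite inE => /predU1P[->|]; last exact: hlA.
  apply: le_trans h _; apply: le_S => y /andP[-> /hasP[x' x'A Gx]] /=.
  by apply/hasP; exists x' => //; rewrite Gx minz// Al.
exists (z :: A); split.
- by move=> x; rewrite !inE => /predU1P[->|/Al ->]; rewrite ?eqxx ?orbT.
- rewrite big_cons mulrDr.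
  have hz := hl z (mem_head _ _).
  have e1 := S_split (G z) (cov A).
  have e2 := S_split (cov (z :: A)) (cov A).
  have e3 : S (cov A) <= S (fun y => cov (z :: A) y && cov A y).
    by apply: le_S => y h1; rewrite h1 /cov /= -/(cov A y) h1 orbT.
  have e4 : S (fun y => G z y && ~~ cov A y) <= S (fun y => cov (z :: A) y && ~~ cov A y).
    by apply: le_S => y /andP[h1 ->]; rewrite /cov /= h1.
  lra.
- move=> x; rewrite inE => /predU1P[->|xl].
    have h1 : S (G z) <= S (fun y => G z y && has (fun x => (s z <= s x) && G x y) (z :: A)).
      by apply: le_S => y Gy; rewrite /= Gy lexx.
    have := hl z (mem_head _ _); have : 0 <= lam * n z by rewrite mulr_ge0// ltW.
    lra.
  apply: le_trans (hlA x xl) _; apply: le_S => y /andP[-> h1] /=.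
  by rewrite h1 orbT.
Qed.

(** The points satisfying [l1] meet a selected set of larger index; they number at most [C] times
    the total size of the selected sets, itself at most [2 / lam] times the mass. For any other [z],
    a mass at least [lam / 2 * n z] of its set is covered by selected sets of index at least [s z],
    and [z] is charged to the covered points [y] with weight [f y / n z]. Each kind contributes
    [2 * C]. *)
Lemma greedy_covering (l : seq X) :
  (forall z, z \in l -> lam * n z < S (G z)) ->
  (forall x, x \in l -> (count (fun z => (s z < s x) && has (fun y => G z y && G x y) W) l)%:R
      <= C * n x) ->
  (forall x y, x \in l -> G x y -> (count (fun z => (s z == s x) && G z y) l)%:R <= C * n x) ->
  lam * (size l)%:R <= 4 * C * \sum_(y <- W) f y.
Proof.
wlog sl : l / sorted (fun x y => s x <= s y) l.
  move=> hw h1 h2 h3; have p : perm_eq (sort (fun x y => s x <= s y) l) l by rewrite perm_sort.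
  rewrite -(perm_size p); apply: hw.
  - by apply: sort_sorted => x y; exact: le_total.
  - by move=> z; rewrite (perm_mem p); exact: h1.
  - by move=> x; rewrite (perm_mem p) (permP p); exact: h2.
  - by move=> x y; rewrite (perm_mem p) (permP p); exact: h3.
move=> hl K1 K2; have [A [Al hA hlA]] := select sl hl.
have n_gt0 z : z \in l -> 0 < n z.
  move=> zl; rewrite lt_neqAle ler0n andbT; apply/eqP => nz; have := hl z zl.
  rewrite -nz mulr0 /S big1_seq ?ltxx// => y /andP[Gy yW].
  move: nz => /esym/eqP; rewrite pnatr_eq0 -leqn0 leqNgt -has_count => /hasPn/(_ y yW).
  by rewrite Gy.
set F := \sum_(y <- W) f y.
have SF Q : S Q <= F.
  by rewrite /F /S [leRHS](bigID Q)/= lerDl sumr_ge0.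
pose l1 z := has (fun x => (s z < s x) && has (fun y => G z y && G x y) W) A.
have c1 : lam * (count l1 l)%:R <= 2 * C * F.
  have c1' : (count l1 l)%:R <= \sum_(x <- A) (C * n x).
    apply: (@le_trans _ _ (\sum_(x <- A) (count (fun z => (s z < s x) && has (fun y => G z y && G x y) W) l)%:R)).
      rewrite -natr_sum ler_nat /l1; elim: (A) => [|x A' IH] /=.
        by rewrite big_nil leqn0; apply/eqP/count_pred0.
      rewrite big_cons; apply: leq_trans (leq_add (leqnn _) IH).
      by rewrite -count_predUI leq_addr.
    by rewrite big_seq [leRHS]big_seq; apply: ler_sum => x /Al; exact: K1.
  move: c1'; rewrite -mulr_sumr => c1'.
  have c2 := le_trans hA (SF _).
  have c3 := ler_wpM2l (ltW lam0) c1'.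
  have c4 := ler_wpM2l C0 c2.
  move: c3 c4; set u := \sum_(x <- A) n x; nra.
have c2 : lam / 2 * (count (predC l1) l)%:R <= C * F.
  pose B z y := G z y && has (fun x => (s z <= s x) && G x y) A.
  have c3 : lam / 2 * (count (predC l1) l)%:R <=
      \sum_(z <- l | predC l1 z) \sum_(y <- W | B z y) (n z)^-1 * f y.
    rewrite -sum1_count natr_sum mulr_sumr big_seq_cond [leRHS]big_seq_cond.
    apply: ler_sum => z /andP[zl _]; rewrite mulr1 -mulr_sumr.
    by rewrite ler_pdivlMl ?n_gt0// mulrC; exact: hlA.
  apply: le_trans c3 _.
  have -> : \sum_(z <- l | predC l1 z) \sum_(y <- W | B z y) (n z)^-1 * f y =
      \sum_(y <- W) \sum_(z <- l | predC l1 z && B z y) (n z)^-1 * f y.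
    by rewrite (exchange_big_dep xpredT)//=; apply: eq_bigr => y _; apply: eq_bigl => z.
  rewrite /F mulr_sumr big_seq [leRHS]big_seq; apply: ler_sum => y yW.
  rewrite -mulr_suml ler_wpM2r// -big_filter; apply: sum_inv_le => // z.
  rewrite mem_filter => /andP[/andP[nz /andP[Gz hz]] zl]; split; first exact: n_gt0.
  apply: le_trans (K2 z y zl Gz); rewrite ler_nat size_filter.
  (* Points charged to the same [y] have equal index: otherwise the set of smaller index would meet
     at [y] a selected set of larger index. *)
  have sle z1 z2 : ~~ l1 z1 -> G z1 y -> has (fun x => (s z2 <= s x) && G x y) A -> s z2 <= s z1.
    move=> n1 G1 /hasP[x xA /andP[sx Gx]]; rewrite leNgt; apply/negP => s12.
    move/hasPn: n1 => /(_ x xA); rewrite (lt_le_trans s12 sx)/= => /hasPn/(_ y yW).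
    by rewrite G1 Gx.
  apply: sub_count => z' /andP[nz' /andP[Gz' hz']]; rewrite Gz' andbT eq_le.
  by rewrite !sle.
rewrite -(count_predC l1 l) natrD; lra.
Qed.

End Greedy.

(** * Integrable functions *)

Section Mean.
Context (R : realType) (d : measure_display) (X : measurableType d).
Variable mu : probability X R.
Implicit Types f g : X -> R.

Definition L1 f := mu.-integrable setT (EFin \o f).
Definition mean f : R := Rintegral mu setT f.
Definition bounded_by (B : R) f := forall x, `|f x| <= B.

Lemma L1_measurable f : L1 f -> measurable_fun setT f.
Proof. by move=> /measurable_int /measurable_EFinP. Qed.

Lemma L1_le f g : measurable_fun setT f -> (forall x, `|f x| <= `|g x|) -> L1 g -> L1 f.
Proof.
move=> mf fg; apply: le_integrable => //; first exact/measurable_EFinP.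
by move=> x _ /=; rewrite lee_fin.
Qed.

Lemma L1_cst (k : R) : L1 (fun=> k).
Proof. exact: finite_measure_integrable_cst. Qed.

Lemma L1_bounded B f : measurable_fun setT f -> bounded_by B f -> L1 f.
Proof.
by move=> mf fB; apply: (L1_le mf _ (L1_cst B)) => x; exact: le_trans (fB x) (ler_norm _).
Qed.

Lemma L1D f g : L1 f -> L1 g -> L1 (fun x => f x + g x).
Proof. by move=> If Ig; exact: (integrableD measurableT If Ig). Qed.

Lemma L1Z k f : L1 f -> L1 (fun x => k * f x).
Proof. by move=> If; exact: (integrableZl measurableT k If). Qed.

Lemma L1B f g : L1 f -> L1 g -> L1 (fun x => f x - g x).
Proof. by move=> If Ig; exact: (integrableB measurableT If Ig). Qed.

Lemma L1_abs f : L1 f -> L1 (fun x => `|f x|).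
Proof. exact: integrable_norm. Qed.

Lemma L1_ind (A : set X) : measurable A -> L1 (\1_A).
Proof. by move=> mA; exact: integrable_indic. Qed.

Lemma L1M_bounded B f g : L1 f -> measurable_fun setT g -> bounded_by B g ->
  L1 (fun x => g x * f x).
Proof.
move=> If mg gB; have := L1Z B If; apply: L1_le => [|x].
  by apply: measurable_funM => //; exact: L1_measurable.
by rewrite !normrM ler_wpM2r// (le_trans (gB x))// ler_norm.
Qed.

Lemma meanD f g : L1 f -> L1 g -> mean (fun x => f x + g x) = mean f + mean g.
Proof. by move=> If Ig; rewrite /mean RintegralD. Qed.

Lemma meanB f g : L1 f -> L1 g -> mean (fun x => f x - g x) = mean f - mean g.
Proof. by move=> If Ig; rewrite /mean RintegralB. Qed.

Lemma meanZ k f : L1 f -> mean (fun x => k * f x) = k * mean f.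
Proof. by move=> If; rewrite /mean RintegralZl. Qed.

Lemma mean_cst k : mean (fun=> k) = k.
Proof.
transitivity (k * fine (mu setT)); first exact: Rintegral_cst.
by rewrite probability_setT mulr1.
Qed.

Lemma mean_le f g : L1 f -> L1 g -> (forall x, f x <= g x) -> mean f <= mean g.
Proof. by move=> If Ig fg; exact: le_Rintegral. Qed.

Lemma mean_ge0 f : (forall x, 0 <= f x) -> 0 <= mean f.
Proof. by move=> f0; exact: Rintegral_ge0. Qed.

Lemma mean_abs f : L1 f -> `|mean f| <= mean (fun x => `|f x|).
Proof. by move=> If; exact: le_normr_Rintegral. Qed.

Lemma EFin_mean f : L1 f -> (mean f)%:E = (\int[mu]_x (f x)%:E)%E.
Proof. by move=> If; rewrite /mean /Rintegral fineK//; exact: integrable_fin_num. Qed.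

Lemma mean_ind (A : set X) : measurable A -> (mean (\1_A))%:E = mu A.
Proof. by move=> mA; rewrite EFin_mean ?integral_indic ?setIT//; exact: L1_ind. Qed.

Lemma mean_ae f g : L1 f -> L1 g -> {ae mu, forall x, f x = g x} -> mean f = mean g.
Proof.
move=> If Ig fg; apply: EFin_inj; rewrite !EFin_mean//.
apply: ae_eq_integral => //; [exact: measurable_int If|exact: measurable_int Ig|].
by apply: filterS fg => x /= -> _.
Qed.

Lemma mean_abs_eq0 f : L1 f -> mean (fun x => `|f x|) <= 0 -> {ae mu, forall x, f x = 0}.
Proof.
move=> If h; have : (\int[mu]_x `|(EFin \o f) x| = 0)%E.
  have -> : (\int[mu]_x `|(EFin \o f) x| = (mean (fun x => `|f x|))%:E)%E.
    by rewrite EFin_mean//; exact: L1_abs.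
  by congr EFin; apply/eqP; rewrite eq_le h/=; exact: mean_ge0.
move=> /(ae_eq_integral_abs mu measurableT (measurable_int mu If)) ae0.
by apply: filterS ae0 => x /(_ I) [].
Qed.

Lemma mean_abs_eps f : L1 f -> (forall e, 0 < e -> mean (fun x => `|f x|) <= e) ->
  {ae mu, forall x, f x = 0}.
Proof.
move=> If h; apply: mean_abs_eq0 => //; apply: ler_eps => e e0.
by rewrite add0r; exact: h.
Qed.

Lemma mean_abs_triangle f g h : L1 f -> L1 g -> L1 h ->
  mean (fun x => `|f x - h x|) <= mean (fun x => `|f x - g x|) + mean (fun x => `|g x - h x|).
Proof.
move=> If Ig Ih; rewrite -meanD; try by apply: L1_abs; exact: L1B.
apply: mean_le.
- by apply: L1_abs; exact: L1B.
- by apply: L1D; apply: L1_abs; exact: L1B.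
by move=> x; exact: ler_distD.
Qed.

Lemma mean_dominated (u : nat -> X -> R) f g : (forall n, measurable_fun setT (u n)) ->
  measurable_fun setT f -> L1 g ->
  {ae mu, forall x, forall n, `|u n x| <= g x} ->
  {ae mu, forall x, u n x @[n --> \oo] --> f x} ->
  L1 f /\ mean (fun x => `|u n x - f x|) @[n --> \oo] --> 0.
Proof.
move=> mun mf Ig ug uf.
have h1 : {ae mu, forall x, setT x -> (EFin \o u n) x @[n --> \oo] --> (EFin \o f) x}.
  by apply: filterS uf => x h _; apply/fine_cvgP; split => //; exact: nearW.
have h2 : {ae mu, forall x, forall n, setT x -> (`|(EFin \o u n) x| <= (EFin \o g) x)%E}.
  by apply: filterS ug => x h n _; rewrite /= lee_fin.
have [If h _] := dominated_convergence measurableT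
  (fun n => (measurable_EFinP _ _).2 (mun n)) ((measurable_EFinP _ _).2 mf) h1 Ig h2.
split => //; move: h => /fine_cvgP[_].
by [].
Qed.

End Mean.

(** * Completeness of the space of integrable functions *)

Section FastCauchy.
Context (R : realType) (d : measure_display) (X : measurableType d).
Variable mu : probability X R.

Let sum_geo_le2 n : \sum_(0 <= k < n) (2^-1 ^+ k : R) <= 2.
Proof.
have -> : \sum_(0 <= k < n) (2^-1 ^+ k : R) = 2 - 2 * 2^-1 ^+ n.
  elim: n => [|n IH]; first by rewrite big_geq// expr0; lra.
  by rewrite big_nat_recr//= IH exprS; set u := _ ^+ n; lra.
by rewrite gerBl mulr_ge0// exprn_ge0// invr_ge0.
Qed.

(** The sum [g] of the increments is integrable, hence almost everywhere finite, and together with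
    [u 0] it dominates the sequence. *)
Lemma L1_fast_cauchy (u : nat -> X -> R) : (forall k, L1 mu (u k)) ->
  (forall k, mean mu (fun x => `|u k.+1 x - u k x|) <= 2^-1 ^+ k) ->
  exists h, L1 mu h /\ mean mu (fun x => `|u k x - h x|) @[k --> \oo] --> 0.
Proof.
move=> Iu hu.
pose v k x : R := `|u k.+1 x - u k x|.
have Iv k : L1 mu (v k) by apply: L1_abs; exact: L1B.
have mv k : measurable_fun setT (EFin \o v k) by apply/measurable_EFinP; exact: L1_measurable (Iv k).
pose g x := (\sum_(0 <= k <oo) (v k x)%:E)%E.
have v0 k x : (0 <= (v k x)%:E)%E by rewrite lee_fin /v.
have g0 x : (0 <= g x)%E by apply: nneseries_ge0 => *; exact: v0.
have mg : measurable_fun setT g.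
  apply: (@ge0_emeasurable_sum _ _ _ setT (fun k => EFin \o v k) xpredT) => //.
  by move=> k x _ _; exact: v0.
have ig : mu.-integrable setT g.
  apply/integrableP; split => //.
  under eq_integral do rewrite gee0_abs//.
  rewrite integral_nneseries//; apply: (@le_lt_trans _ _ 2%:E); last exact: ltry.
  apply: lime_le; first by apply: is_cvg_nneseries => n _ _; exact: integral_ge0.
  apply: nearW => n; apply: le_trans (_ : (\sum_(0 <= k < n) (2^-1 ^+ k))%:E <= _)%E; last by rewrite lee_fin.
  rewrite -sumEFin; apply: lee_sum => k _.
  by rewrite -(EFin_mean (Iv k)) lee_fin; exact: hu.
have gfin := integrable_ae measurableT ig.
have Ig : L1 mu (fun x => `|u 0%N x| + fine (g x)).
  apply: L1D; first exact: L1_abs.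
  apply: (le_integrable measurableT _ _ ig).
    by apply/measurable_EFinP; exact: measurableT_comp.
  move=> x _ /=; rewrite gee0_abs// ger0_norm ?fine_ge0//.
  by have := g0 x; case: (g x) => //= r; rewrite ?lee_fin// => _; rewrite leey.
have uE n x : u n x = u 0%N x + \sum_(0 <= k < n) (u k.+1 x - u k x).
  by rewrite telescope_sumr// addrC subrK.
have sumv n x : g x \is a fin_num -> \sum_(0 <= k < n) v k x <= fine (g x).
  move=> gx; rewrite -lee_fin fineK// -sumEFin.
  exact: nneseries_lim_ge.
(* The upper limit is measurable even where the sequence diverges. *)
pose h x := fine (limn_esup (fun n => (u n x)%:E)).
have mh : measurable_fun setT h.
  apply: measurableT_comp => //; apply: measurable_fun_limn_esup => n.
  by apply/measurable_EFinP; exact: L1_measurable.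
exists h; apply: (@mean_dominated _ _ _ mu u h _ (fun n => L1_measurable (Iu n)) mh Ig).
  apply: filterS gfin => x /(_ I) gx n; rewrite uE.
  apply: le_trans (ler_normD _ _) _; rewrite lerD2l.
  by apply: le_trans (sumv n x gx); exact: ler_norm_sum.
apply: filterS gfin => x /(_ I) gx.
have cu : cvgn (u ^~ x).
  have -> : u ^~ x = (fun n => u 0%N x + series (fun k => u k.+1 x - u k x) n).
    by apply/funext => n; rewrite uE.
  apply: is_cvgD; first exact: is_cvg_cst.
  apply: normed_cvg; apply: nondecreasing_is_cvgn.
    by apply: nondecreasing_series => n _ _; exact: normr_ge0.
  by exists (fine (g x)) => _ [n _ <-]; exact: sumv.
have : (fun n => (u n x)%:E) @ \oo --> (limn (u ^~ x))%:E.
  by apply: cvg_EFin => //; exact: nearW.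
by move=> /cvg_limn_einf_sup[_ e]; rewrite /h e.
Qed.

End FastCauchy.

(** * Invariant functions and coboundaries *)

Section Density.
Context (R : realType) (d : measure_display) (X : measurableType d).
Variables (mu : probability X R) (phi : nat -> X -> X).
Hypothesis mphi : forall n, measurable_fun setT (phi n).
Hypothesis pphi : forall n A, measurable A -> mu (phi n @^-1` A) = mu A.

Let ge0_integral_comp n (g : X -> \bar R) : measurable_fun setT g -> (forall x, 0 <= g x)%E ->
  (\int[mu]_x g (phi n x) = \int[mu]_x g x)%E.
Proof.
move=> mg g0; transitivity (\int[pushforward mu (phi n)]_x g x)%E.
  by rewrite ge0_integral_pushforward// => y _; exact: g0.
by apply: eq_measure_integral => A mA _; exact: pphi.
Qed.

Lemma L1_comp n f : L1 mu f -> L1 mu (f \o phi n).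
Proof.
move=> /integrableP[mf fi]; apply/integrableP; split.
  exact: (measurableT_comp mf (mphi n)).
by rewrite (@ge0_integral_comp n (fun x => `|(f x)%:E|)%E)//; apply: measurableT_comp.
Qed.

Lemma mean_comp n f : L1 mu f -> mean mu (f \o phi n) = mean mu f.
Proof.
move=> If; apply: EFin_inj; rewrite !EFin_mean//; last exact: L1_comp.
have mf := measurable_int mu If.
transitivity (\int[pushforward mu (phi n)]_x (f x)%:E)%E.
  by symmetry; apply: (integral_pushforward (mphi n) mf (L1_comp n If) measurableT).
by apply: eq_measure_integral => A mA _; exact: pphi.
Qed.

Definition bounded_mfun (f : X -> R) := measurable_fun setT f /\ exists B, bounded_by B f.

Definition ae_invariant (f : X -> R) := forall n, {ae mu, forall x, f (phi n x) = f x}.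

(** Boundedness of [g] makes the averages small at every point; linear combinations are built in so
    that the energy is minimised over a vector space. *)
Inductive coboundary : (X -> R) -> Prop :=
| coboundary_base g n : bounded_mfun g -> coboundary (fun x => g x - g (phi n x))
| coboundaryD a b : coboundary a -> coboundary b -> coboundary (fun x => a x + b x)
| coboundaryZ k a : coboundary a -> coboundary (fun x => k * a x).

Lemma bounded_mfun_L1 f : bounded_mfun f -> L1 mu f.
Proof. by move=> [mf [B fB]]; exact: L1_bounded fB. Qed.

Lemma bounded_mfunD f g : bounded_mfun f -> bounded_mfun g -> bounded_mfun (fun x => f x + g x).
Proof.
move=> [mf [B fB]] [mg [C gC]]; split; first exact: measurable_funD.
by exists (B + C) => x; apply: le_trans (ler_normD _ _) _; exact: lerD.
Qed.

Lemma bounded_mfunM f g : bounded_mfun f -> bounded_mfun g -> bounded_mfun (fun x => f x * g x).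
Proof.
move=> [mf [B fB]] [mg [C gC]]; split; first exact: measurable_funM.
by exists (B * C) => x; rewrite normrM ler_pM.
Qed.

Lemma bounded_mfun_cst k : bounded_mfun (fun=> k).
Proof. by split => //; exists `|k| => x. Qed.

Lemma bounded_mfunZ k f : bounded_mfun f -> bounded_mfun (fun x => k * f x).
Proof. by apply: bounded_mfunM; exact: bounded_mfun_cst. Qed.

Lemma bounded_mfunB f g : bounded_mfun f -> bounded_mfun g -> bounded_mfun (fun x => f x - g x).
Proof.
move=> bf /(bounded_mfunZ (-1)) /(bounded_mfunD bf).
by under eq_fun do rewrite mulN1r.
Qed.

Lemma bounded_mfun_comp n f : bounded_mfun f -> bounded_mfun (fun x => f (phi n x)).
Proof.
move=> [mf [B fB]]; split; first exact: (measurableT_comp mf (mphi n)).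
by exists B => x; exact: fB.
Qed.

Lemma bounded_mfun_ind (A : set X) : measurable A -> bounded_mfun (\1_A).
Proof.
move=> mA; split; first exact: measurable_indic.
by exists 1 => x; rewrite indicE; case: (_ \in _); rewrite ?normr1 ?normr0.
Qed.

Lemma coboundary_bounded c : coboundary c -> bounded_mfun c.
Proof.
elim=> [g n bg|a b _ ba _ bb|k a _ ba].
- by apply: bounded_mfunB => //; exact: bounded_mfun_comp.
- exact: bounded_mfunD.
- exact: bounded_mfunZ.
Qed.

Lemma coboundary0 : coboundary (fun=> 0).
Proof.
have := coboundary_base 0 (bounded_mfun_cst 0).
by under eq_fun do rewrite subrr.
Qed.

Lemma coboundaryB a b : coboundary a -> coboundary b -> coboundary (fun x => a x - b x).
Proof.
move=> ca /(coboundaryZ (-1)) /(coboundaryD ca).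
by under eq_fun do rewrite mulN1r.
Qed.

(** As [s] is invariant, multiplying by [s] commutes almost everywhere with composition by [phi n],
    which preserves the mean. *)
Lemma mean_coboundary s c : bounded_mfun s -> ae_invariant s -> coboundary c ->
  mean mu (fun x => s x * c x) = 0.
Proof.
move=> bs si; elim=> [g n bg|a b ca ha cb hb|k a ca ha].
- have bsg := bounded_mfunM bs bg.
  have bsn : bounded_mfun (fun x => s x * g (phi n x)).
    by apply: bounded_mfunM => //; exact: bounded_mfun_comp.
  under [fun x => _]eq_fun do rewrite mulrBr.
  rewrite meanB; try exact: bounded_mfun_L1.
  rewrite -(mean_comp n (bounded_mfun_L1 bsg)); apply/eqP; rewrite subr_eq0; apply/eqP.
  apply: mean_ae; try exact: bounded_mfun_L1.
    exact: L1_comp (bounded_mfun_L1 bsg).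
  by apply: filterS (si n) => x /= ->.
- under [fun x => _]eq_fun do rewrite mulrDr.
  by rewrite meanD ?ha ?hb ?addr0//; apply: bounded_mfun_L1; apply: bounded_mfunM => //; exact: coboundary_bounded.
- under [fun x => _]eq_fun do rewrite mulrCA.
  by rewrite meanZ ?ha ?mulr0//; apply: bounded_mfun_L1; apply: bounded_mfunM => //; exact: coboundary_bounded.
Qed.

(** The pointwise bound [t <= t ^+ 2 / (2 * e) + e / 2] stands in for the Cauchy-Schwarz
    inequality. *)
Lemma mean_sq_le (u : X -> R) e : 0 < e -> bounded_mfun u ->
  mean mu (fun x => u x ^+ 2) <= e ^+ 2 -> mean mu (fun x => `|u x|) <= e.
Proof.
move=> e0 bu h; have Iu2 : L1 mu (fun x => u x ^+ 2).
  by apply: bounded_mfun_L1; under eq_fun do rewrite expr2; exact: bounded_mfunM.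
have Iu := bounded_mfun_L1 bu.
apply: (@le_trans _ _ (mean mu (fun x => (2 * e)^-1 * u x ^+ 2 + e / 2))).
  apply: mean_le; [exact: L1_abs|by apply: L1D; [exact: L1Z|exact: L1_cst]|].
  move=> x; rewrite -(real_normK (num_real (u x))); set t := `|u x|.
  rewrite -(@ler_pM2l _ (2 * e)) ?mulr_gt0// mulrDr mulrA divff ?mul1r ?gt_eqF ?mulr_gt0//.
  by have := sqr_ge0 (t - e); rewrite sqrrB; nra.
rewrite meanD; [|exact: L1Z|exact: L1_cst].
rewrite meanZ// mean_cst.
have : (2 * e)^-1 * mean mu (fun x => u x ^+ 2) <= (2 * e)^-1 * e ^+ 2.
  by rewrite ler_wpM2l// invr_ge0 mulr_ge0// ltW.
have -> : (2 * e)^-1 * e ^+ 2 = e / 2.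
  by rewrite invfM expr2 mulrA -(mulrA 2^-1) mulVf ?gt_eqF// mulr1 mulrC.
by set v := (2 * e)^-1 * _; lra.
Qed.

(* [h] is the limit of a sequence [f - c_k] with [c_k] a coboundary and energy tending to the
   infimum. As [(f - c_k) \o phi n] is of the same form and has the same energy, the
   parallelogram identity shows that it is close to [f - c_k]; hence [h] is invariant. *)
Lemma density_bounded (f : X -> R) : bounded_mfun f ->
  exists h, [/\ L1 mu h, ae_invariant h & forall e, 0 < e -> exists2 c, coboundary c &
    mean mu (fun x => `|f x - c x - h x|) <= e].
Proof.
move=> bf.
pose en (a : X -> R) := mean mu (fun x => a x ^+ 2).
pose S := [set en (fun x => f x - c x) | c in coboundary].
have hS : has_inf S.
  split; first by exists (en (fun x => f x - 0)); exists (fun=> 0) => //; exact: coboundary0.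
  by exists 0 => _ [c _ <-]; apply: mean_ge0 => x; exact: sqr_ge0.
have bc c : coboundary c -> bounded_mfun (fun x => f x - c x).
  by move=> /coboundary_bounded; exact: bounded_mfunB.
have bsq a : bounded_mfun a -> L1 mu (fun x => a x ^+ 2).
  by move=> ba; apply: bounded_mfun_L1; under eq_fun do rewrite expr2; exact: bounded_mfunM.
have close a b e : coboundary a -> coboundary b -> 0 < e ->
    en (fun x => f x - a x) <= inf S + e ^+ 2 / 4 ->
    en (fun x => f x - b x) <= inf S + e ^+ 2 / 4 ->
    mean mu (fun x => `|f x - a x - (f x - b x)|) <= e.
  move=> ca cb e0 ha hb; apply: mean_sq_le => //.
    by apply: bounded_mfunB; exact: bc.
  (* The midpoint is again [f] minus a coboundary, so its energy is at least [inf S], and the square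
     of the difference has mean at most [4 * (inf S + e ^+ 2 / 4) - 4 * inf S], that is [e ^+ 2]. *)
  pose m x := f x - 2^-1 * (a x + b x).
  have cm : coboundary (fun x => 2^-1 * (a x + b x)) by apply: coboundaryZ; exact: coboundaryD.
  have hm : inf S <= en m by apply: ge_inf; [exact: hS.2|exists (fun x => 2^-1 * (a x + b x))].
  have : mean mu (fun x => (f x - a x - (f x - b x)) ^+ 2) + 4 * en m =
      2 * en (fun x => f x - a x) + 2 * en (fun x => f x - b x).
    rewrite /en -!meanZ; try by apply: bsq; exact: bc.
    rewrite -!meanD; try by [apply: bsq; apply: bounded_mfunB; exact: bc|apply: L1Z; apply: bsq; exact: bc].
    by congr mean; apply/funext => x; rewrite /m !expr2; lra.
  lra.
have /choice[c hc] : forall k, exists c, coboundary c /\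
    en (fun x => f x - c x) <= inf S + (2^-1 ^+ k) ^+ 2 / 4.
  move=> k; have e0 : 0 < (2^-1 ^+ k) ^+ 2 / 4 :> R by rewrite divr_gt0// !exprn_gt0.
  by have [_ [c cc <-] /ltW] := inf_adherent e0 hS; exists c.
pose fk k x := f x - c k x.
have e0 k : 0 < 2^-1 ^+ k :> R by rewrite exprn_gt0.
have bfk k : bounded_mfun (fk k) by apply: bc; have [] := hc k.
have Ifk k : L1 mu (fk k) by exact: bounded_mfun_L1.
have [k|k|h [Ih hcv]] := @L1_fast_cauchy _ _ _ mu fk.
- exact: Ifk.
- have [c1 h1] := hc k; have [c2 h2] := hc k.+1; apply: close => //.
  apply: le_trans h2 _; rewrite lerD2l ler_wpM2r ?invr_ge0// (exprS _ k) exprMn.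
  by have := sqr_ge0 (2^-1 ^+ k : R); set t := _ ^+ 2; lra.
have near0 (e : R) : 0 < e -> exists k, mean mu (fun x => `|fk k x - h x|) <= e /\ 2^-1 ^+ k <= e.
  move=> ep.
  have c2 : (2^-1 ^+ k : R) @[k --> \oo] --> (0 : R).
    by apply: cvg_expr; rewrite ger0_norm ?invr_ge0// invf_lt1// ltr1n.
  move: hcv c2 => /cvgr0Pnorm_le/(_ e ep) h1 /cvgr0Pnorm_le/(_ e ep) h2.
  have [k [h3 h4]] := filter_ex (filterI h1 h2).
  by exists k; split; apply: le_trans (ler_norm _) _.
exists h; split => //; last first.
  by move=> e ep; have [k [hk _]] := near0 e ep; exists (c k) => //; have [] := hc k.
move=> n; have Ihn := L1_comp n Ih.
have : {ae mu, forall x, h (phi n x) - h x = 0}.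
  apply: mean_abs_eps; first exact: L1B.
  move=> e ep; have e3 : 0 < e / 3 by rewrite divr_gt0.
  have [k [hk1 hk2]] := near0 _ e3.
  have Ifn := L1_comp n (Ifk k).
  have t1 := mean_abs_triangle Ihn Ifn Ih.
  have t2 := mean_abs_triangle Ifn (Ifk k) Ih.
  have e1 : mean mu (fun x => `|(h \o phi n) x - (fk k \o phi n) x|) = mean mu (fun x => `|fk k x - h x|).
    rewrite -[RHS](mean_comp n); first by congr mean; apply/funext => x /=; rewrite distrC.
    by apply: L1_abs; exact: L1B.
  have e2 : mean mu (fun x => `|(fk k \o phi n) x - fk k x|) <= 2^-1 ^+ k.
    have [ck hk] := hc k.
    have fE : fk k \o phi n = (fun x => f x - (c k x + (fk k x - fk k (phi n x)))).
      by apply/funext => x; rewrite /fk/=; lra.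
    have cn : coboundary (fun x => c k x + (fk k x - fk k (phi n x))).
      by apply: coboundaryD => //; exact: coboundary_base.
    rewrite fE; apply: close => //.
    rewrite -fE /en -/(((fun y => fk k y ^+ 2) \o phi n)) mean_comp//.
    exact: bsq.
  lra.
by apply: filterS => x /eqP; rewrite subr_eq0 => /eqP.
Qed.

(** The sign of [u] is bounded and invariant; integrating against it gives the norm of [u] and
    annihilates [c]. *)
Lemma mean_le_coboundary u c : L1 mu u -> ae_invariant u -> coboundary c ->
  mean mu (fun x => `|u x|) <= mean mu (fun x => `|u x + c x|).
Proof.
move=> Iu iu cc; pose s x : R := if 0 <= u x then 1 else -1.
have Ic := bounded_mfun_L1 (coboundary_bounded cc).
have sN x : `|s x| = 1 by rewrite /s; case: ifP => _; rewrite ?normrN normr1.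
have bs : bounded_mfun s.
  split; last by exists 1 => x; rewrite sN.
  apply: measurable_fun_ifT => //; apply: measurable_fun_ler => //.
  exact: L1_measurable Iu.
have si : ae_invariant s by move=> n; apply: filterS (iu n) => x; rewrite /s => ->.
have [ms [B sB]] := bs.
have -> : (fun x => `|u x|) = (fun x => s x * (u x + c x) - s x * c x).
  apply/funext => x; rewrite -mulrBr addrK /s; case: (leP 0 (u x)) => h; first by rewrite ger0_norm ?mul1r.
  by rewrite ltr0_norm// mulN1r.
have I1 : L1 mu (fun x => s x * (u x + c x)) by apply: L1M_bounded sB => //; exact: L1D.
have I2 : L1 mu (fun x => s x * c x) by apply: L1M_bounded sB.
rewrite meanB// (mean_coboundary bs si cc) subr0.
apply: mean_le => //; first by apply: L1_abs; exact: L1D.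
by move=> x; rewrite -[leRHS]mul1r -(sN x) -normrM ler_norm.
Qed.

Lemma L1_truncate f e : L1 mu f -> 0 < e -> exists2 b, bounded_mfun b & mean mu (fun x => `|b x - f x|) <= e.
Proof.
move=> If e0; have mf := L1_measurable If.
pose b j x : R := if `|f x| <= j%:R then f x else 0.
have mb j : measurable_fun setT (b j).
  apply: measurable_fun_ifT => //; apply: measurable_fun_ler => //.
  exact: measurableT_comp.
have [| |_] := @mean_dominated _ _ _ mu b f (fun x => `|f x|) mb mf (L1_abs If).
- by apply: aeW => x j; rewrite /b; case: ifP => // _; rewrite normr0.
- apply: aeW => x; apply: cvg_near_cst; near=> j; rewrite /b ifT//.
  near: j; exact: nbhs_infty_ger.
move=> /cvgr0Pnorm_le/(_ e e0) h1; have [j hj] := filter_ex h1.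
exists (b j); last exact: le_trans (ler_norm _) hj.
by split => //; exists j%:R => x; rewrite /b; case: ifP => //; rewrite normr0.
Unshelve. all: by end_near. Qed.

(** Truncation supplies approximate decompositions of [f]. The difference of two of their invariant
    parts is, up to a coboundary, a difference of two small errors, hence small by
    [mean_le_coboundary]; so the invariant parts converge. *)
Lemma density (f : X -> R) : L1 mu f ->
  exists h, [/\ L1 mu h, ae_invariant h & forall e, 0 < e -> exists2 c, coboundary c &
    mean mu (fun x => `|f x - c x - h x|) <= e].
Proof.
move=> If.
have approx e : 0 < e -> exists hc : (X -> R) * (X -> R), [/\ L1 mu hc.1, ae_invariant hc.1,
    coboundary hc.2 & mean mu (fun x => `|f x - hc.2 x - hc.1 x|) <= e].
  move=> e0; have e2 : 0 < e / 2 by rewrite divr_gt0.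
  have [b bb hb] := L1_truncate If e2; have Ib := bounded_mfun_L1 bb.
  have [h [Ih ih hh]] := density_bounded bb.
  have [c cc hc] := hh _ e2; exists (h, c); split => //=.
  have Ic := bounded_mfun_L1 (coboundary_bounded cc).
  have Ich : L1 mu (fun x => c x + h x) by exact: L1D.
  have := mean_abs_triangle If Ib Ich.
  have -> : (fun x => `|f x - b x|) = (fun x => `|b x - f x|) by apply/funext => x; rewrite distrC.
  have E g : (fun x => `|g x - (c x + h x)|) = (fun x => `|g x - c x - h x|).
    by apply/funext => x; rewrite opprD addrA.
  rewrite !E; lra.
have p k : 0 < 2^-1 ^+ k / 2 :> R by rewrite divr_gt0// exprn_gt0.
have /choice[hc hhc] := fun k => approx _ (p k).
pose h k := (hc k).1; pose c k := (hc k).2.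
have Ih k : L1 mu (h k) by have [] := hhc k.
have Ic k : L1 mu (c k) by have [_ _ /coboundary_bounded/bounded_mfun_L1] := hhc k.
have [k|k|g [Ig hg]] := @L1_fast_cauchy _ _ _ mu h; first exact: Ih.
  have [_ i1 c1 m1] := hhc k; have [_ i2 c2 m2] := hhc k.+1.
  have iu : ae_invariant (fun x => h k.+1 x - h k x).
    by move=> n; apply: filterS2 (i1 n) (i2 n) => x; rewrite /h => -> ->.
  apply: le_trans (mean_le_coboundary (L1B (Ih _) (Ih _)) iu (coboundaryB c2 c1)) _.
  have -> : (fun x => `|h k.+1 x - h k x + ((hc k.+1).2 x - (hc k).2 x)|) =
      (fun x => `|(f x - c k x - h k x) - (f x - c k.+1 x - h k.+1 x)|).
    by apply/funext => x; congr `|_|; rewrite /h /c; lra.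
  apply: (@le_trans _ _ (mean mu (fun x => `|f x - c k x - h k x| + `|f x - c k.+1 x - h k.+1 x|))).
    apply: mean_le.
    + by apply: L1_abs; do ?apply: L1B.
    + by apply: L1D; apply: L1_abs; do ?apply: L1B.
    + by move=> x; exact: ler_normB.
  rewrite meanD; try by apply: L1_abs; do ?apply: L1B.
  by move: m1 m2; rewrite exprS -/(c k) -/(h k) -/(c k.+1) -/(h k.+1); set t := _ ^+ k; set u := mean _ _; set v := mean _ _; have := p k; rewrite -/t; lra.
have near0 (e : R) : 0 < e -> exists k, mean mu (fun x => `|h k x - g x|) <= e /\ 2^-1 ^+ k <= e.
  move=> ep.
  have c2 : (2^-1 ^+ k : R) @[k --> \oo] --> (0 : R).
    by apply: cvg_expr; rewrite ger0_norm ?invr_ge0// invf_lt1// ltr1n.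
  move: hg c2 => /cvgr0Pnorm_le/(_ e ep) h1 /cvgr0Pnorm_le/(_ e ep) h2.
  have [k [h3 h4]] := filter_ex (filterI h1 h2).
  by exists k; split; apply: le_trans (ler_norm _) _.
exists g; split => //.
  move=> n; have Ign := L1_comp n Ig.
  have : {ae mu, forall x, g (phi n x) - g x = 0}.
    apply: mean_abs_eps; first exact: L1B.
    move=> e ep; have e3 : 0 < e / 2 by rewrite divr_gt0.
    have [k [hk1 _]] := near0 _ e3.
    have Ihn := L1_comp n (Ih k).
    have t1 := mean_abs_triangle Ign Ihn Ig.
    have e1 : mean mu (fun x => `|(g \o phi n) x - (h k \o phi n) x|) = mean mu (fun x => `|h k x - g x|).
      rewrite -[RHS](mean_comp n); first by congr mean; apply/funext => x /=; rewrite distrC.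
      by apply: L1_abs; exact: L1B.
    have e2 : mean mu (fun x => `|(h k \o phi n) x - g x|) = mean mu (fun x => `|h k x - g x|).
      apply: mean_ae; try by apply: L1_abs; exact: L1B.
      by have [_ i1 _ _] := hhc k; apply: filterS (i1 n) => x /=; rewrite /h => ->.
    by move: t1; rewrite e1 e2 /=; lra.
  by apply: filterS => x /eqP; rewrite subr_eq0 => /eqP.
move=> e ep; have e2 : 0 < e / 2 by rewrite divr_gt0.
have [k [hk1 hk2]] := near0 _ e2.
have [_ _ ck m1] := hhc k; exists (c k) => //.
have Ifc : L1 mu (fun x => f x - c k x) by exact: L1B.
have := mean_abs_triangle Ifc (Ih k) Ig.
by move: m1; rewrite -/(c k) -/(h k); have := p k; lra.
Qed.

(** The indicator of an invariant set annihilates coboundaries, so only the error remains. This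
    identifies [h] as a conditional expectation. *)
Lemma mean_set_density f h (A : set X) : L1 mu f -> L1 mu h -> measurable A ->
  ae_invariant (\1_A) -> (forall e, 0 < e -> exists2 c, coboundary c &
    mean mu (fun x => `|f x - c x - h x|) <= e) ->
  mean mu (fun x => \1_A x * h x) = mean mu (fun x => \1_A x * f x).
Proof.
move=> If Ih mA iA hd; have bA := bounded_mfun_ind mA; have [mi [B hB]] := bA.
apply/eqP; rewrite -subr_eq0 -normr_le0; apply: ler_eps => e e0; rewrite add0r.
have [c cc hc] := hd e e0; have Ic := bounded_mfun_L1 (coboundary_bounded cc).
apply: le_trans hc.
have IM g : L1 mu g -> L1 mu (fun x => \1_A x * g x) by move=> Ig; apply: L1M_bounded hB.
have -> : mean mu (fun x => \1_A x * h x) - mean mu (fun x => \1_A x * f x) =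
   - mean mu (fun x => \1_A x * (f x - c x - h x)).
  have -> : (fun x => \1_A x * (f x - c x - h x)) = (fun x => \1_A x * f x - \1_A x * c x - \1_A x * h x).
    by apply/funext => x; rewrite !mulrBr.
  rewrite !meanB; try by do ?apply: L1B; exact: IM.
  by rewrite (mean_coboundary bA iA cc) subr0 opprB.
rewrite normrN; apply: le_trans (mean_abs _) _.
  by apply: IM; do ?apply: L1B.
apply: mean_le.
- by apply: L1_abs; apply: IM; do ?apply: L1B.
- by apply: L1_abs; do ?apply: L1B.
by move=> x; rewrite normrM ler_piMl// indicE; case: (_ \in _); rewrite ?normr1 ?normr0.
Qed.

End Density.

(** * Averages over finite sets *)

Section PointwiseAverage.
Context (R : realType) (d : measure_display) (X : measurableType d).
Variables (F : R -> X -> set X) (r : R) (x : X).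
Hypothesis finF : finite_set (F r x).
Implicit Types f g : X -> R.

Lemma averageE f : average F f r x = (cardR R (F r x))^-1 * \sum_(y <- fset_set (F r x)) f y.
Proof. by rewrite /average fsbig_finite. Qed.

Lemma averageD f g : average F (fun y => f y + g y) r x = average F f r x + average F g r x.
Proof. by rewrite !averageE big_split mulrDr. Qed.

Lemma averageZ k f : average F (fun y => k * f y) r x = k * average F f r x.
Proof. by rewrite !averageE -mulr_sumr mulrCA. Qed.

Lemma averageB f g : average F (fun y => f y - g y) r x = average F f r x - average F g r x.
Proof. by rewrite !averageE sumrB mulrBr. Qed.

Lemma average_le f g : (forall y, F r x y -> f y <= g y) -> average F f r x <= average F g r x.
Proof.
move=> fg; rewrite !averageE ler_wpM2l ?invr_ge0//.
rewrite big_seq [leRHS]big_seq; apply: ler_sum => y.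
by rewrite in_fset_set// inE; exact: fg.
Qed.

Lemma average_ge0 f : (forall y, 0 <= f y) -> 0 <= average F f r x.
Proof. by move=> f0; rewrite averageE mulr_ge0 ?invr_ge0// sumr_ge0. Qed.

Lemma average_abs f : `|average F f r x| <= average F (fun y => `|f y|) r x.
Proof.
rewrite !averageE normrM ger0_norm ?invr_ge0// ler_wpM2l ?invr_ge0//.
exact: ler_norm_sum.
Qed.

Lemma eq_average f g : (forall y, F r x y -> f y = g y) -> average F f r x = average F g r x.
Proof.
by move=> fg; apply/eqP; rewrite eq_le !average_le// => y /fg ->.
Qed.

Hypothesis F0 : F r x !=set0.

Lemma cardR_gt0 : 0 < cardR R (F r x).
Proof.
rewrite /cardR ltr0n cardfs_gt0; apply/fset0Pn; have [y Fy] := F0; exists y.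
by rewrite in_fset_set// inE.
Qed.

Lemma average_cst k : average F (fun=> k) r x = k.
Proof.
rewrite averageE big_const_seq count_predT iter_addr_0 -[k *+ _]mulr_natl mulKf//.
by rewrite gt_eqF// cardR_gt0.
Qed.

Lemma average_bounded B f : bounded_by B f -> `|average F f r x| <= B.
Proof.
move=> fB; apply: le_trans (average_abs f) _.
by rewrite -[leRHS]average_cst; apply: average_le => y _; exact: fB.
Qed.

End PointwiseAverage.

Section Averages.
Context (R : realType) (d : measure_display) (X : measurableType d).
Variables (mu : probability X R) (phi phi' : nat -> X -> X).
Hypothesis mphi : forall n, measurable_fun setT (phi n).
Hypothesis mphi' : forall n, measurable_fun setT (phi' n).
Hypothesis phiK : forall n, cancel (phi n) (phi' n).
Hypothesis phi'K : forall n, cancel (phi' n) (phi n).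
Hypothesis pphi : forall n A, measurable A -> mu (phi n @^-1` A) = mu A.
Hypothesis meq : forall n m, measurable [set x | phi n x = phi m x].
Variables (F : R -> X -> set X) (r : R).
Hypothesis finF : forall x, finite_set (F r x).
Hypothesis F0 : forall x, F r x !=set0.
Hypothesis Fsub : forall x y, F r x y -> exists n, phi n x = y.
Hypothesis mF : forall g, measurable_fun setT g -> measurable [set x | F r x (g x)].

Let card x := cardR R (F r x).

(* Each point of [F r x] is counted once, at its smallest index. *)
Let idx n : set X := [set x | (forall m, (m < n)%N -> phi m x <> phi n x) /\ F r x (phi n x)].

Let measurable_idx n : measurable (idx n).
Proof.
have -> : idx n = (\bigcap_(m in [set m | (m < n)%N]) ~` [set x | phi m x = phi n x]) `&`
    [set x | F r x (phi n x)] by [].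
apply: measurableI; last exact: mF.
by apply: bigcap_measurableType => m _; apply: measurableC.
Qed.

Let idxs N x := [seq n <- iota 0 N | x \in idx n].

Let uniq_idxs N x : uniq [seq phi n x | n <- idxs N x].
Proof.
rewrite map_inj_in_uniq ?filter_uniq ?iota_uniq// => n m.
rewrite !mem_filter => /andP[/set_mem[hn _] _] /andP[/set_mem[hm _] _] e.
case: (ltngtP n m) => // nm; first by have := hm n nm.
by have := hn m nm; case.
Qed.

Let idxs_fset x : exists N0, forall N, (N0 <= N)%N ->
  perm_eq [seq phi n x | n <- idxs N x] (fset_set (F r x)).
Proof.
have /choice[k hk] : forall y, exists n, F r x y -> phi n x = y /\ x \in idx n.
  move=> y; have [Fy|nFy] := pselect (F r x y); last by exists 0%N.
  have ex : exists n, `[< phi n x = y >] by have [n /asboolP ?] := Fsub Fy; exists n.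
  case: (ex_minnP ex) => n /asboolP e hmin; exists n => _; split => //.
  rewrite inE; split; last by rewrite e.
  move=> m mn; rewrite e => /asboolP /hmin; by rewrite leqNgt mn.
(* As a sum of successors it exceeds every index [k y] in use. *)
exists (\sum_(y <- fset_set (F r x)) (k y).+1)%N => N hN.
apply: uniq_perm; [exact: uniq_idxs|exact: fset_uniq|] => y.
rewrite in_fset_set//; apply/mapP/idP => [[n]|/set_mem Fy].
  by rewrite mem_filter => /andP[/set_mem[_ Fn] _] ->; rewrite inE.
have [e hy] := hk y Fy; exists (k y) => //; rewrite mem_filter hy mem_iota /= add0n.
apply: leq_trans hN; rewrite (big_rem y)/=; first exact: leq_addr.
by rewrite in_fset_set// inE.
Qed.

Let sum_idxs N x (h : X -> R) :
  \sum_(0 <= n < N) \1_(idx n) x * h (phi n x) = \sum_(y <- [seq phi n x | n <- idxs N x]) h y.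
Proof.
rewrite big_map big_filter [RHS]big_mkcond /index_iota subn0; apply: eq_bigr => n _.
by rewrite indicE; case: ifP => _; rewrite ?mul1r ?mul0r.
Qed.

Let cvg_sum_idxs x (h : X -> R) :
  \sum_(0 <= n < N) \1_(idx n) x * h (phi n x) @[N --> \oo] --> \sum_(y <- fset_set (F r x)) h y.
Proof.
have [N0 hN] := idxs_fset x; apply: cvg_near_cst; exists N0 => // N /= /hN p.
by rewrite sum_idxs (perm_big _ p).
Qed.

Lemma measurable_cardR : measurable_fun setT card.
Proof.
apply: (@measurable_fun_cvg _ _ _ setT (fun N x => \sum_(0 <= n < N) \1_(idx n) x * 1)).
  move=> N; apply: measurable_sum => n; apply: measurable_funM => //; exact: measurable_indic.
move=> x _; have := @cvg_sum_idxs x (fun=> 1).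
by rewrite big_const_seq count_predT iter_addr_0.
Qed.

Let measurable_cardR_inv : measurable_fun setT (fun x => (card x)^-1).
Proof.
have mV : measurable_fun (~` [set (0 : R)] : set R) (fun z : R => z^-1).
  apply: subspace_continuous_measurable_fun; first by apply: measurableC; exact: measurable_set1.
  by apply: continuous_in_subspaceT => z /set_mem /= /eqP z0; exact: inv_continuous.
apply: (measurable_comp _ _ mV measurable_cardR).
  by apply: measurableC; exact: measurable_set1.
by move=> _ [x _ <-] /=; apply/eqP; rewrite gt_eqF// cardR_gt0.
Qed.

(** The averaged function may depend on the base point, as [boundary] does below. *)
Lemma measurable_average_dep (h : X -> X -> R) :
  (forall n, measurable_fun setT (fun x => h x (phi n x))) ->
  measurable_fun setT (fun x => average F (h x) r x).
Proof.
move=> mh; under eq_fun do rewrite averageE//.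
apply: measurable_funM; first exact: measurable_cardR_inv.
apply: (@measurable_fun_cvg _ _ _ setT (fun N x => \sum_(0 <= n < N) \1_(idx n) x * h x (phi n x))).
  move=> N; apply: measurable_sum => n; apply: measurable_funM => //; exact: measurable_indic.
by move=> x _; exact: cvg_sum_idxs.
Qed.

Lemma measurable_average f : measurable_fun setT f -> measurable_fun setT (average F f r).
Proof.
move=> mf; apply: (@measurable_average_dep (fun=> f)) => n.
exact: (measurableT_comp mf (mphi n)).
Qed.

Variable C : R.
Hypothesis C0 : 0 <= C.
Hypothesis overlap : forall y (T : seq X), uniq T -> (forall x, x \in T -> F r x y) ->
  forall x, x \in T -> (size T)%:R <= C * card x.

Let wt n x := \1_(idx n) x * (card x)^-1.

Let wt_ge0 n x : 0 <= wt n x.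
Proof. by rewrite mulr_ge0// invr_ge0. Qed.

(** The nonzero terms are the inverse sizes of sets [F r x] at distinct points [x], all containing
    [y]. *)
Let sum_wt_le N y : \sum_(0 <= n < N) wt n (phi' n y) <= C.
Proof.
pose ns := [seq n <- iota 0 N | phi' n y \in idx n].
have -> : \sum_(0 <= n < N) wt n (phi' n y) = \sum_(z <- [seq phi' n y | n <- ns]) (card z)^-1.
  rewrite big_map big_filter [RHS]big_mkcond /index_iota subn0; apply: eq_bigr => n _.
  by rewrite /wt indicE; case: ifP => _; rewrite ?mul1r ?mul0r.
have us : uniq [seq phi' n y | n <- ns].
  rewrite map_inj_in_uniq ?filter_uniq ?iota_uniq// => n m.
  rewrite !mem_filter => /andP[/set_mem[hn _] _] /andP[/set_mem[hm _] _] e.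
  case: (ltngtP n m) => // nm; first by have := hm n nm; rewrite -{1}e !phi'K.
  by have := hn m nm; rewrite {1}e !phi'K.
apply: sum_inv_le => // z zs; split; first exact: cardR_gt0.
apply: (@overlap y _ us) zs => {}z /mapP[n]; rewrite mem_filter => /andP[/set_mem[_ +] _] ->.
by rewrite phi'K.
Qed.

Let measurable_wt n : measurable_fun setT (wt n).
Proof. by apply: measurable_funM => //; exact: measurable_indic. Qed.

Let wt_le1 n : bounded_by 1 (wt n).
Proof.
move=> x; rewrite ger0_norm// /wt; apply: mulr_ile1; rewrite ?invr_ge0//.
have c0 := cardR_gt0 (finF x) (F0 x).
by rewrite invf_le1//; move: c0; rewrite /card /cardR ltr0n ler1n.
Qed.

(** Mass transport: [x] sends the weight [wt n x] to [phi n x]. As [phi n] preserves the measure,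
    the mean of the averages of [|g|] is the integral of [|g y|] times the weight received at [y],
    which is at most [C]. *)
Lemma mean_average (g : X -> R) : L1 mu g ->
  L1 mu (average F g r) /\ mean mu (fun x => `|average F g r x|) <= C * mean mu (fun x => `|g x|).
Proof.
move=> Ig; pose q := average F (fun y => `|g y|) r.
have mg := L1_measurable Ig.
have mq : measurable_fun setT q by apply: measurable_average; exact: measurableT_comp.
have q0 x : 0 <= q x by exact: average_ge0.
pose p N x := \sum_(0 <= n < N) wt n x * `|g (phi n x)|.
have Igp n : L1 mu ((fun x => `|g x|) \o phi n) by apply: L1_comp => //; exact: L1_abs.
have Iwt n : L1 mu (fun x => wt n x * `|g (phi n x)|) by exact: L1M_bounded (Igp n) (measurable_wt n) (@wt_le1 n).
have Isum (v : nat -> X -> R) N : (forall n, L1 mu (v n)) ->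
    L1 mu (fun x => \sum_(0 <= n < N) v n x) /\
    mean mu (fun x => \sum_(0 <= n < N) v n x) = \sum_(0 <= n < N) mean mu (v n).
  move=> Iv; elim: N => [|N [IH1 IH2]].
    under eq_fun do rewrite big_geq//; rewrite big_geq//; split; first exact: L1_cst.
    exact: mean_cst.
  under eq_fun do rewrite big_nat_recr//=; rewrite big_nat_recr//= -IH2; split; first exact: L1D.
  exact: meanD.
have Ip N : L1 mu (p N) by have [] := Isum _ N Iwt.
have hp N : mean mu (p N) <= C * mean mu (fun x => `|g x|).
  have [_ ->] := Isum _ N Iwt.
  have mw n : measurable_fun setT (fun y => wt n (phi' n y)) by exact: measurableT_comp.
  have bw n : bounded_by 1 (fun y => wt n (phi' n y)) by move=> y; exact: wt_le1.
  have Iw' n : L1 mu (fun y => wt n (phi' n y) * `|g y|) by exact: L1M_bounded (L1_abs Ig) (mw n) (bw n).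
  have -> : \sum_(0 <= n < N) mean mu (fun x => wt n x * `|g (phi n x)|) =
      \sum_(0 <= n < N) mean mu (fun y => wt n (phi' n y) * `|g y|).
    apply: eq_bigr => n _; rewrite -(mean_comp mphi pphi n (Iw' n)).
    by congr mean; apply/funext => x /=; rewrite phiK.
  have [I' <-] := Isum _ N Iw'.
  rewrite -meanZ; last exact: L1_abs.
  apply: mean_le => //; first by apply: L1Z; exact: L1_abs.
  by move=> y; rewrite -mulr_suml ler_wpM2r// sum_wt_le.
have pq x : p N x @[N --> \oo] --> q x.
  rewrite /q averageE//.
  have -> : p ^~ x = (fun N => (card x)^-1 * \sum_(0 <= n < N) \1_(idx n) x * `|g (phi n x)|).
    by apply/funext => N; rewrite /p mulr_sumr; apply: eq_bigr => n _; rewrite /wt mulrAC mulrC.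
  by apply: cvgM; [exact: cvg_cst|exact: cvg_sum_idxs].
have p0 N x : 0 <= p N x by apply: sumr_ge0 => n _; exact: mulr_ge0.
have mp N : measurable_fun setT (fun x => (p N x)%:E).
  by apply/measurable_EFinP; exact: L1_measurable.
have pmono n m x : (n <= m)%N -> p n x <= p m x.
  move=> nm; rewrite /p [leRHS](big_cat_nat (leq0n n) nm)//= lerDl.
  by apply: sumr_ge0 => k _; exact: mulr_ge0.
have int_q : (\int[mu]_x (q x)%:E <= (C * mean mu (fun x => `|g x|))%:E)%E.
  have /cvg_lim : (fun N => \int[mu]_x (p N x)%:E)%E @ \oo --> (\int[mu]_x (q x)%:E)%E.
    have -> : (\int[mu]_x (q x)%:E = \int[mu]_x limn (fun N => (p N x)%:E))%E.
      apply: eq_integral => x _; apply/esym/cvg_lim => //.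
      by apply: cvg_EFin; [exact: nearW|exact: pq].
    apply: cvg_monotone_convergence => //.
    - by move=> N x _; rewrite lee_fin.
    - by move=> x _ n m nm; rewrite lee_fin pmono.
  move=> <- //; apply: lime_le.
    apply: ereal_nondecreasing_is_cvgn => n m nm; apply: ge0_le_integral => //.
    - by move=> x _; rewrite lee_fin.
    - by move=> x _; rewrite lee_fin pmono.
  by apply: nearW => N; rewrite -EFin_mean// lee_fin.
have Iq : L1 mu q.
  apply/integrableP; split; first exact/measurable_EFinP.
  under eq_integral => x _ do rewrite /= ger0_norm//.
  exact: le_lt_trans int_q (ltry _).
have qg x : `|average F g r x| <= q x by exact: average_abs.
have Ia : L1 mu (average F g r).
  by apply: L1_le Iq; [exact: measurable_average|move=> x; rewrite (ger0_norm (q0 x))].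
split => //; apply: (@le_trans _ _ (mean mu q)).
  by apply: mean_le => //; exact: L1_abs.
by rewrite -lee_fin EFin_mean.
Qed.

End Averages.

(** * The maximal inequality and pointwise convergence *)

(** Both sums contain the points of [W] that are images of points of [W]. There remain the points of
    [W] not reached and the images outside [W], equally many as [phi] is injective. *)
Lemma sum_injective_shift (R : realType) (X : choiceType) (W : seq X) (phi : X -> X) (g : X -> R) B :
  uniq W -> injective phi -> (forall x, `|g x| <= B) ->
  `|\sum_(z <- W) g z - \sum_(z <- W) g (phi z)| <= 2 * B * (count (fun z => phi z \notin W) W)%:R.
Proof.
move=> uW ip gB; pose P := [seq phi z | z <- W & phi z \in W].
have uP : uniq P by rewrite map_inj_uniq ?filter_uniq.
have PW w : w \in P -> w \in W by case/mapP => z; rewrite mem_filter => /andP[h _] ->.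
have e1 : \sum_(z <- W) g z = \sum_(w <- P) g w + \sum_(w <- W | w \notin P) g w.
  rewrite (bigID (mem P))/=; congr (_ + _); rewrite -big_filter; apply: perm_big.
  apply: uniq_perm => // [|w]; first exact: filter_uniq.
  by rewrite mem_filter; case: (boolP (w \in P)) => //= /PW ->.
have e2 : \sum_(z <- W) g (phi z) = \sum_(w <- P) g w + \sum_(z <- W | phi z \notin W) g (phi z).
  by rewrite (bigID (fun z => phi z \in W))/= big_map big_filter.
have e3 : count (fun w => w \notin P) W = count (fun z => phi z \notin W) W.
  apply/eqP; rewrite -(eqn_add2l (count (fun w => w \in P) W)) (count_predC (mem P)).
  have -> : count (fun w => w \in P) W = count (fun z => phi z \in W) W.
    rewrite -!size_filter -(size_map phi [seq z <- W | phi z \in W]); apply/perm_size.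
    apply: uniq_perm => // [|w]; first exact: filter_uniq.
    by rewrite mem_filter; case: (boolP (w \in P)) => //= /PW ->.
  by rewrite (count_predC (fun z => phi z \in W)).
have bnd (Q : pred X) (h : X -> R) : (forall x, `|h x| <= B) ->
    `|\sum_(w <- W | Q w) h w| <= B * (count Q W)%:R.
  move=> hB; apply: le_trans (ler_norm_sum _ _ _) _.
  by rewrite -sum1_count natr_sum mulr_sumr; apply: ler_sum => w _; rewrite mulr1.
rewrite e1 e2 opprD addrACA subrr add0r; apply: le_trans (ler_normB _ _) _.
have := bnd (fun w => w \notin P) g gB; rewrite e3.
have := bnd (fun z => phi z \notin W) (fun z => g (phi z)) (fun x => gB _).
lra.
Qed.

Section Ergodic.
Context (R : realType) (d : measure_display) (X : measurableType d).
Variables (mu : probability X R) (phi phi' : nat -> X -> X).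
Hypothesis mphi : forall n, measurable_fun setT (phi n).
Hypothesis mphi' : forall n, measurable_fun setT (phi' n).
Hypothesis phiK : forall n, cancel (phi n) (phi' n).
Hypothesis phi'K : forall n, cancel (phi' n) (phi n).
Hypothesis pphi : forall n A, measurable A -> mu (phi n @^-1` A) = mu A.
Hypothesis meq : forall n m, measurable [set x | phi n x = phi m x].
Variables (I : set R) (F : R -> X -> set X).
Hypothesis natI : forall n : nat, I n.+1%:R.
Hypothesis finF : forall r x, I r -> finite_set (F r x).
Hypothesis F0 : forall r x, I r -> F r x !=set0.
Hypothesis Fsub : forall r x y, I r -> F r x y -> exists n, phi n x = y.
Hypothesis mF : forall g, measurable_fun setT g ->
  measurable [set p : X * measurableTypeR R | I p.2 /\ F p.2 p.1 (g p.1)].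
Variable C : R.
Hypothesis C0 : 0 <= C.
Hypothesis lower_overlap : forall r x (T : seq X), I r -> uniq T ->
  (forall z, z \in T -> exists s, [/\ I s, s < r & exists y, F s z y /\ F r x y]) ->
  (size T)%:R <= C * cardR R (F r x).
Hypothesis overlap : forall r y (T : seq X), I r -> uniq T ->
  (forall x, x \in T -> F r x y) -> forall x, x \in T -> (size T)%:R <= C * cardR R (F r x).

Let boundary n r x (z : X) : R := (`[< ~ F r x (phi n z) >])%:R.

Hypothesis boundary_cvg0 : forall n x,
  average F (boundary n r x) r x @[r --> within I (pinfty_nbhs R)] --> (0 : R).

Let mF_at r g : I r -> measurable_fun setT g -> measurable [set x | F r x (g x)].
Proof.
move=> Ir mg.
have -> : [set x | F r x (g x)] =
    (fun x => (x, r : measurableTypeR R)) @^-1` [set p : X * measurableTypeR R | I p.2 /\ F p.2 p.1 (g p.1)].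
  by apply/seteqP; split=> x /=; [split|case].
rewrite -[X in measurable X]setTI; apply: pair2_measurable => //; exact: mF.
Qed.

Let mavg r f : I r -> measurable_fun setT f -> measurable_fun setT (average F f r).
Proof.
move=> Ir; apply: (@measurable_average _ _ _ phi mphi meq F r) => *;
  [exact: finF|exact: F0|exact: (Fsub Ir)|exact: mF_at].
Qed.

Let mean_avg r g : I r -> L1 mu g ->
  L1 mu (average F g r) /\ mean mu (fun x => `|average F g r x|) <= C * mean mu (fun x => `|g x|).
Proof.
move=> Ir; apply: (@mean_average _ _ _ mu phi phi') => //.
- by move=> x; exact: finF.
- by move=> x; exact: F0.
- by move=> x y; exact: (Fsub Ir).
- by move=> h; exact: mF_at.
- by move=> y T; exact: (overlap Ir).
Qed.

(** Along the integers, dominated convergence for sequences applies. *)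
Let cvg_seq (f : R -> R) (l : R) :
  f r @[r --> within I (pinfty_nbhs R)] --> l -> f n.+1%:R @[n --> \oo] --> l.
Proof.
move=> fl; apply: (@cvg_comp _ _ _ (fun n : nat => n.+1%:R : R) f \oo (within I (pinfty_nbhs R)) (nbhs l)) fl.
move=> A; rewrite /within /= => -[M [Mreal hM]].
near=> n; apply: hM; last exact: natI.
apply: (@lt_le_trans _ _ n%:R); last by rewrite ler_nat.
near: n; exact: nbhs_infty_gtr.
Unshelve. all: by end_near. Qed.

Let boundary_ge0 n r x z : 0 <= boundary n r x z. Proof. exact: ler0n. Qed.

Let boundary_le1 n r x : bounded_by 1 (boundary n r x).
Proof. by move=> z; rewrite ger0_norm// lern1; case: asboolP. Qed.

(** For a generator with [g] bounded by [B], the average is at most [2 * B] times the fraction of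
    points that [phi n] moves out of [F r x]. *)
Lemma average_coboundary_cvg0 c x : coboundary phi c ->
  average F c r x @[r --> within I (pinfty_nbhs R)] --> (0 : R).
Proof.
elim=> [g n [mg [B gB]]|a b _ ha _ hb|k a _ ha].
- have h0 := boundary_cvg0 n x.
  have : 2 * B * average F (boundary n r x) r x @[r --> within I (pinfty_nbhs R)] --> (0 : R).
    by rewrite -[X in _ --> X](mulr0 (2 * B)); apply: cvgM => //; exact: cvg_cst.
  move=> h1; apply/cvgr0Pnorm_le => e e0.
  move/cvgr0Pnorm_le/(_ e e0) : h1; apply: filterS2 (withinT _ _) => r Ir h1.
  apply: le_trans (le_trans (ler_norm _) h1).
  rewrite !averageE; try exact: finF.
  rewrite normrM ger0_norm ?invr_ge0// mulrCA ler_wpM2l ?invr_ge0// sumrB.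
  have -> : \sum_(z <- fset_set (F r x)) boundary n r x z = (count (fun z => phi n z \notin fset_set (F r x)) (fset_set (F r x)))%:R.
    rewrite -sum1_count natr_sum [RHS]big_mkcond; apply: eq_bigr => z _.
    rewrite /boundary in_fset_set; last exact: finF.
    case: asboolP => h; first by rewrite memNset.
    by rewrite mem_set//; exact: contrapT.
  apply: sum_injective_shift => //; exact: can_inj (phiK n).
- rewrite -[X in _ --> X](addr0 0).
  apply: cvg_trans (cvgD ha hb); apply: near_eq_cvg; apply: filterS (withinT _ _) => r Ir.
  by rewrite averageD//; exact: finF.
- rewrite -[X in _ --> X](mulr0 k).
  apply: cvg_trans (cvgM (cvg_cst k) ha); apply: near_eq_cvg; apply: filterS (withinT _ _) => r Ir.
  by rewrite averageZ//; exact: finF.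
Qed.

Let I_r n : I n.+1%:R := natI n.

Let cvg0_eps (u : nat -> R) : u n @[n --> \oo] --> (0 : R) ->
  forall e : R, 0 < e -> \forall n \near \oo, u n <= e.
Proof.
move=> /cvgr0Pnorm_le h e e0; apply: filterS (h e e0) => n; exact: le_trans (ler_norm _).
Qed.

Let mean_abs_cvg0 (u : nat -> X -> R) B : (forall n, measurable_fun setT (u n)) ->
  (forall n, bounded_by B (u n)) -> (forall x, u n x @[n --> \oo] --> (0 : R)) ->
  mean mu (fun x => `|u n x|) @[n --> \oo] --> 0.
Proof.
move=> mu_ ub u0.
have [| |_] := @mean_dominated _ _ _ mu u (fun=> 0) (fun=> B) mu_ (measurable_cst _) (L1_cst mu B).
  by apply: aeW => x n; exact: ub.
  by apply: aeW => x; exact: u0.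
by under eq_fun do under eq_fun do rewrite subr0.
Qed.

Lemma mean_average_coboundary c : coboundary phi c ->
  mean mu (fun x => `|average F c n.+1%:R x|) @[n --> \oo] --> 0.
Proof.
move=> cc; have [mc [B cB]] := coboundary_bounded mphi cc.
apply: (@mean_abs_cvg0 (fun n x => average F c n.+1%:R x) B).
- by move=> n; exact: mavg.
- by move=> n x; apply: average_bounded => //; [exact: finF|exact: F0].
- by move=> x; exact: (@cvg_seq (fun r => average F c r x) 0 (average_coboundary_cvg0 x cc)).
Qed.

Let measurable_boundary i r : I r ->
  measurable_fun setT (fun x => average F (boundary i r x) r x).
Proof.
move=> Ir; apply: (@measurable_average_dep _ _ _ phi mphi meq F r (fun x => finF x Ir)
  (fun x => F0 x Ir) (fun x y => Fsub Ir) (fun g => mF_at Ir) (boundary i r)) => m.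
have mg : measurable_fun setT (fun x => phi i (phi m x)).
  exact: (measurableT_comp (mphi i) (mphi m)).
have -> : (fun x => boundary i r x (phi m x)) = \1_(~` [set x | F r x (phi i (phi m x))]).
  by apply/funext => x; rewrite indicE /boundary; congr (nat_of_bool _)%:R.
by apply: measurable_indic; apply: measurableC; exact: mF_at.
Qed.

Lemma mean_boundary i :
  mean mu (fun x => `|average F (boundary i n.+1%:R x) n.+1%:R x|) @[n --> \oo] --> 0.
Proof.
apply: (@mean_abs_cvg0 (fun n x => average F (boundary i n.+1%:R x) n.+1%:R x) 1).
- by move=> n; exact: measurable_boundary.
- by move=> n x; apply: average_bounded; [exact: finF|exact: F0|exact: boundary_le1].
- by move=> x; exact: (@cvg_seq (fun r => average F (boundary i r x) r x) 0 (boundary_cvg0 i x)).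
Qed.

Lemma average_invariant h : ae_invariant mu phi h ->
  {ae mu, forall x, forall r, I r -> average F h r x = h x}.
Proof.
move=> ih; apply: filterS (ae_foralln ih) => x hx r Ir.
rewrite -(average_cst (finF x Ir) (F0 x Ir) (h x)); apply: eq_average => [|y Fy]; first exact: finF.
by have [n <-] := Fsub Ir Fy; exact: hx.
Qed.

(** Decompose the indicator into [c + h + g]: the coboundary has mean zero and its averages tend to
    zero in mean, the averages of [h] are [h], and [g] is small in norm. *)
Lemma mean_average_ind (D : set X) (e : R) : measurable D -> 0 < e ->
  \forall n \near \oo, mean mu (\1_D) - e <= mean mu (average F (\1_D) n.+1%:R).
Proof.
move=> mD e0; have bD := bounded_mfun_ind R mD.
have I1 := bounded_mfun_L1 mu bD.
have [h [Ih ih hh]] := density mphi pphi I1.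
(* The error [g] is paid once in the mean and at most [C] times in the mean of its averages; the
   coboundary takes the other [e / 2]. *)
have e1 : 0 < e / (2 * (1 + C)) by rewrite divr_gt0// mulr_gt0// ltr_pwDl.
have [c cc hc] := hh _ e1.
have Ic := bounded_mfun_L1 mu (coboundary_bounded mphi cc).
pose g x := \1_D x - c x - h x.
have Ig : L1 mu g by apply: L1B => //; exact: L1B.
have mc0 : mean mu c = 0.
  have := mean_coboundary mphi pphi (bounded_mfun_cst X 1) (fun n => aeW mu (fun x => erefl)) cc.
  by under [fun x => 1 * _]eq_fun do rewrite mul1r.
have m1 : mean mu (\1_D) = mean mu h + mean mu g.
  have <- : mean mu (fun x => c x + (h x + g x)) = mean mu (\1_D).
    by congr mean; apply/funext => x; rewrite /g; lra.
  rewrite meanD//; last exact: L1D.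
  by rewrite mc0 add0r meanD.
have e2 : 0 < e / 2 by rewrite divr_gt0.
apply: filterS (cvg0_eps (mean_average_coboundary cc) e2) => n hn.
have [Ia1 _] := mean_avg (I_r n) I1.
have [Iac _] := mean_avg (I_r n) Ic.
have [Iah _] := mean_avg (I_r n) Ih.
have [Iag hg] := mean_avg (I_r n) Ig.
have -> : mean mu (average F (\1_D) n.+1%:R) = mean mu (average F c n.+1%:R) + (mean mu h + mean mu (average F g n.+1%:R)).
  have <- : mean mu (average F h n.+1%:R) = mean mu h.
    by apply: mean_ae => //; apply: filterS (average_invariant ih) => x; exact.
  rewrite -!meanD//; last exact: L1D.
  congr mean; apply/funext => x; rewrite -!averageD; try exact: finF.
  by congr average; apply/funext => y; rewrite /g; lra.
have := mean_abs Iac; rewrite ler_norml => /andP[+ _].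
have := mean_abs Iag; rewrite ler_norml => /andP[+ _].
have := mean_abs Ig; rewrite ler_norml => /andP[_ +].
have hC : (1 + C) * mean mu (fun x => `|g x|) <= e / 2.
  apply: (@le_trans _ _ ((1 + C) * (e / (2 * (1 + C))))).
    by rewrite ler_wpM2l ?addr_ge0.
  have a0 : 1 + C != 0 by rewrite gt_eqF// ltr_pwDl.
  by rewrite invfM [e * _]mulrA mulrC divfK.
move: hC hn hg m1; rewrite mulrDl mul1r.
set u := mean mu (fun x => `|g x|); set v := mean mu (fun x => `|average F c n.+1%:R x|).
set w := mean mu (fun x => `|average F g n.+1%:R x|).
lra.
Qed.

(** The maps indexed by [P] reach every point of the sets attached to [D]. If none of them takes [z]
    out of [F r x], the set of [z] lies in [F r x] and the greedy selection accounts for [z];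
    otherwise a boundary term does. *)
Lemma average_maximal (k : X -> R) (lam : R) (D : set X) (P : seq nat) r x :
  (forall y, 0 <= k y) -> 0 < lam -> I r ->
  (forall z, D z -> exists s, [/\ I s, forall y, F s z y -> exists2 i, i \in P & phi i z = y
      & lam < average F k s z]) ->
  average F (\1_D) r x <= 4 * C / lam * average F k r x + \sum_(i <- P) average F (boundary i r x) r x.
Proof.
move=> k0 lam0 Ir hD.
have /choice[s hs] : forall z, exists s, D z -> [/\ I s,
    forall y, F s z y -> exists2 i, i \in P & phi i z = y & lam < average F k s z].
  move=> z; have [/hD[s hs]|nD] := pselect (D z); first by exists s.
  by exists 0.
have fx := finF x Ir.
pose W : seq X := fset_set (F r x).
have WE y : (y \in W) = (y \in F r x) by rewrite in_fset_set.
have uW : uniq W by exact: fset_uniq.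
pose G z : pred X := [pred y | y \in F (s z) z].
pose good z := (z \in D) && all (fun i => phi i z \in W) P.
pose l := [seq z <- W | good z].
have lD z : z \in l -> D z by rewrite mem_filter => /andP[/andP[/set_mem]].
have GW z : z \in l -> perm_eq [seq y <- W | G z y] (fset_set (F (s z) z)).
  move=> zl; have Dz := lD z zl; have [Is hP _] := hs z Dz.
  apply: uniq_perm; [exact: filter_uniq|exact: fset_uniq|] => y.
  rewrite mem_filter [RHS]in_fset_set; last exact: finF.
  rewrite /G /=; case: (boolP (y \in F (s z) z)) => //= yF.
  have [i iP <-] := hP y (set_mem yF).
  by move: zl; rewrite mem_filter => /andP[/andP[_ /allP h] _]; exact: (h i iP).
have nE z : z \in l -> (count (G z) W)%:R = cardR R (F (s z) z).
  by move=> zl; rewrite /cardR -size_filter (perm_size (GW z zl)).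
have key : lam * (size l)%:R <= 4 * C * \sum_(y <- W) k y.
  apply: (@greedy_covering R X W G s k lam C) => //.
  - move=> z zl; rewrite nE//; have [Is _] := hs z (lD z zl).
    rewrite -big_filter (perm_big _ (GW z zl))/= averageE; last exact: finF.
    by rewrite mulrC ltr_pdivlMr// cardR_gt0//; [exact: finF|exact: F0].
  - move=> z zl; rewrite nE// -size_filter; have [Is _ _] := hs z (lD z zl).
    apply: lower_overlap => //; first by rewrite !filter_uniq.
    move=> z'; rewrite mem_filter => /andP[/andP[ss /hasP[y yW /andP[/set_mem G1 /set_mem G2]]] z'l].
    by have [Is' _ _] := hs z' (lD z' z'l); exists (s z'); split => //; exists y.
  - move=> z y zl /set_mem Gzy; rewrite nE// -size_filter; have [Is _ _] := hs z (lD z zl).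
    apply: (@overlap (s z) y) => //; first by rewrite !filter_uniq.
      by move=> z'; rewrite mem_filter => /andP[/andP[/eqP <- /set_mem]].
    by rewrite mem_filter eqxx zl andbT; exact/mem_set.
have c0 := cardR_gt0 fx (F0 x Ir).
rewrite -(@ler_pM2l _ (cardR R (F r x)))// mulrDr mulr_sumr.
have avE f : cardR R (F r x) * average F f r x = \sum_(y <- W) f y.
  by rewrite averageE// mulVKf// gt_eqF.
rewrite avE mulrCA avE.
have -> : \sum_(i <- P) cardR R (F r x) * average F (boundary i r x) r x = \sum_(i <- P) \sum_(y <- W) boundary i r x y.
  by apply: eq_bigr => i _; rewrite avE.
apply: (@le_trans _ _ ((size l)%:R + \sum_(i <- P) \sum_(y <- W) boundary i r x y)); last first.
  by rewrite lerD2r mulrAC ler_pdivlMr// mulrC.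
have -> : (size l)%:R = \sum_(z <- W) (good z)%:R :> R.
  by rewrite size_filter -sum1_count natr_sum big_mkcond; apply: eq_bigr => z _; case: (good z).
rewrite exchange_big -big_split/=.
apply: ler_sum => z _; rewrite indicE.
case: (boolP (good z)) => [_|].
  have : 0 <= \sum_(i <- P) boundary i r x z by apply: sumr_ge0.
  by case: (_ \in _) => /=; lra.
rewrite negb_and add0r => /orP[/negPf ->|/allPn[i iP nW]]; first by apply: sumr_ge0.
have h1 : boundary i r x z = 1.
  by rewrite /boundary; case: asboolP => // /contrapT/mem_set; rewrite -WE (negPf nW).
rewrite (big_rem i)//= h1; have : 0 <= \sum_(j <- rem i P) boundary j r x z by apply: sumr_ge0.
by case: (_ \in _) => /=; lra.
Qed.

(** [average_maximal] is integrated at an integer index: [mean_average_ind] bounds the left side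
    from below, the boundary terms vanish in the limit because [P] is finite, and [mean_average]
    gives the second factor [C]. *)
Lemma measure_maximal_le (k : X -> R) (lam : R) (D : set X) (P : seq nat) :
  L1 mu k -> (forall y, 0 <= k y) -> 0 < lam -> measurable D ->
  (forall z, D z -> exists s, [/\ I s, forall y, F s z y -> exists2 i, i \in P & phi i z = y
      & lam < average F k s z]) ->
  mean mu (\1_D) <= 4 * C ^+ 2 / lam * mean mu k.
Proof.
move=> Ik k0 lam0 mD hD; have ID := L1_ind mu mD.
apply: ler_eps => e e0; have e2 : 0 < e / 2 by rewrite divr_gt0.
pose b n := \sum_(i <- P) mean mu (fun x => `|average F (boundary i n.+1%:R x) n.+1%:R x|).
have b0 : b n @[n --> \oo] --> (0 : R).
  rewrite /b; move: (P) => Q; elim: Q => [|i Q IH].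
    by under eq_fun do rewrite big_nil; exact: cvg_cst.
  under eq_fun do rewrite big_cons.
  by have := cvgD (mean_boundary i) IH; rewrite addr0; exact.
have [n [h1 h2]] := filter_ex (filterI (mean_average_ind mD e2) (cvg0_eps b0 e2)).
have [IaD _] := mean_avg (I_r n) ID.
have [Iak hk] := mean_avg (I_r n) Ik.
have Ib i : L1 mu (fun x => `|average F (boundary i n.+1%:R x) n.+1%:R x|).
  apply: L1_abs; apply: (@L1_bounded _ _ _ mu 1) => [|x]; first exact: measurable_boundary.
  by apply: average_bounded; [exact: finF|exact: F0|exact: boundary_le1].
have [Isum hsum] : L1 mu (fun x => \sum_(i <- P) `|average F (boundary i n.+1%:R x) n.+1%:R x|) /\
    mean mu (fun x => \sum_(i <- P) `|average F (boundary i n.+1%:R x) n.+1%:R x|) = b n.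
  rewrite /b; move: (P) => Q; elim: Q => [|i Q [IH1 IH2]].
    under eq_fun do rewrite big_nil; rewrite big_nil; split; first exact: L1_cst.
    exact: mean_cst.
  by under eq_fun do rewrite big_cons; rewrite big_cons -IH2; split; [exact: L1D|exact: meanD].
have Ik' := L1_abs Iak.
have h3 : mean mu (average F (\1_D) n.+1%:R) <=
    4 * C / lam * mean mu (fun x => `|average F k n.+1%:R x|) + b n.
  rewrite -hsum -meanZ// -meanD//; last exact: L1Z.
  apply: mean_le => //; first by apply: L1D => //; exact: L1Z.
  move=> x; apply: le_trans (average_maximal x k0 lam0 (I_r n) hD) _.
  apply: lerD; last by apply: ler_sum => i _; exact: ler_norm.
  by rewrite ler_wpM2l ?ler_norm// divr_ge0 ?mulr_ge0// ltW.
have h4 : 4 * C / lam * mean mu (fun x => `|average F k n.+1%:R x|) <= 4 * C / lam * (C * mean mu k).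
  rewrite ler_wpM2l ?divr_ge0 ?mulr_ge0 ?(ltW lam0)//; apply: le_trans hk _.
  by under [fun x => `|k x|]eq_fun do rewrite ger0_norm//.
have -> : 4 * C ^+ 2 / lam * mean mu k = 4 * C / lam * (C * mean mu k).
  by rewrite expr2 !mulrA; congr (_ * _); rewrite mulrAC.
lra.
Qed.

Let pts (p : seq nat) x : seq X := [seq phi i x | i <- p].

Let measurable_mem_pts p n : measurable [set x | phi n x \in pts p x].
Proof.
elim: p => [|i p IH].
  have -> : [set x | phi n x \in pts [::] x] = set0 by apply/seteqP; split.
  exact: measurable0.
have -> : [set x | phi n x \in pts (i :: p) x] = [set x | phi n x = phi i x] `|` [set x | phi n x \in pts p x].
  apply/seteqP; split=> x /=; first by rewrite inE => /predU1P.
  by rewrite inE => -[->|->]; rewrite ?eqxx ?orbT.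
exact: measurableU.
Qed.

Let measurable_uniq_pts p : measurable [set x | uniq (pts p x)].
Proof.
elim: p => [|i p IH].
  have -> : [set x | uniq (pts [::] x)] = setT by apply/seteqP; split.
  exact: measurableT.
have -> : [set x | uniq (pts (i :: p) x)] = [set x | uniq (pts p x)] `\` [set x | phi i x \in pts p x].
  by apply/seteqP; split=> x /=; [move=> /andP[/negP]|move=> [-> /negP ->]].
exact: measurableD.
Qed.

Let mI : measurable [set q : X * measurableTypeR R | I q.2].
Proof.
have -> : [set q : X * measurableTypeR R | I q.2] =
    \bigcup_n [set q : X * measurableTypeR R | I q.2 /\ F q.2 q.1 (phi n q.1)].
  apply/seteqP; split=> -[x s] /=; last by move=> [n _ []].
  move=> Is; have [y Fy] := F0 x Is; have [n e] := Fsub Is Fy.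
  by exists n => //; split => //=; rewrite e.
by apply: bigcup_measurable => n _; exact: mF.
Qed.

(* [exceed k lam p] asks for an index [s] at which [F s x] is exactly the set of the points
   [phi i x], [i \in p]; these countably many conditions exhaust the maximal function. *)
Let exceed (k : X -> R) lam (p : seq nat) : set (X * measurableTypeR R) :=
  [set q | [/\ I q.2, forall n, F q.2 q.1 (phi n q.1) <-> phi n q.1 \in pts p q.1,
    uniq (pts p q.1) & lam * (size p)%:R < \sum_(i <- p) k (phi i q.1)]].

Let measurable_exceed k lam p : measurable_fun setT k -> measurable (exceed k lam p).
Proof.
move=> mk.
pose E n : set (X * measurableTypeR R) := [set x | phi n x \in pts p x] `*` setT.
pose FF n := [set q : X * measurableTypeR R | I q.2 /\ F q.2 q.1 (phi n q.1)].
pose Q := [set x | uniq (pts p x)] `&` [set x | lam * (size p)%:R < \sum_(i <- p) k (phi i x)].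
have -> : exceed k lam p = [set q | I q.2] `&` (Q `*` setT) `&`
    \bigcap_n ((FF n `&` E n) `|` (~` FF n `&` ~` E n)).
  apply/seteqP; split=> -[x s] /=.
    move=> [Is h1 h2 h3]; split; first by split.
    move=> n _; case: (pselect (F s x (phi n x))) => Fn; [left|right].
      by split => //; split => //; exact/h1.
    by split => -[]// h4; move/h1: h4 => //.
  move=> [[Is [[h1 h2] _]] h3]; split => // n; have [[[_ a] [b _]]|[a b]] := h3 n Logic.I.
    by [].
  by split=> h; exfalso; [apply: a|apply: b].
have mE n : measurable (E n) by apply: measurableX => //; exact: measurable_mem_pts.
have mFF n : measurable (FF n) by exact: mF.
apply: measurableI.
  apply: measurableI => //; apply: measurableX => //; apply: measurableI => //.
  have ms : measurable_fun setT (fun x => \sum_(i <- p) k (phi i x)).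
    by apply: measurable_sum => i; exact: (measurableT_comp mk (mphi i)).
  have := ms measurableT _ (measurable_itv `]lam * (size p)%:R, +oo[).
  rewrite setTI; congr measurable; apply/seteqP.
  by split=> x /=; rewrite in_itv /= andbT.
apply: bigcapT_measurable => n; apply: measurableU; apply: measurableI => //; exact: measurableC.
Qed.

Let exceedP k lam p x s : exceed k lam p (x, s) ->
  [/\ I s, forall y, F s x y -> exists2 i, i \in p & phi i x = y & lam < average F k s x].
Proof.
move=> [/= Is h1 h2 h3].
have h4 y : F s x y -> exists2 i, i \in p & phi i x = y.
  by move=> Fy; have [n e] := Fsub Is Fy; move: Fy; rewrite -e => /h1/mapP[i ip ->]; exists i.
split => //.
have pe : perm_eq (pts p x) (fset_set (F s x)).
  apply: uniq_perm => //; first exact: fset_uniq.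
  move=> y; rewrite in_fset_set; last exact: finF.
  apply/mapP/idP => [[i ip ->]|/set_mem/h4[i ip e]]; last by exists i.
  by apply/mem_set/h1; exact: map_f.
rewrite averageE; last exact: finF.
rewrite mulrC ltr_pdivlMr ?cardR_gt0//; [|exact: finF|exact: F0].
by rewrite /cardR -(perm_size pe) size_map -(perm_big _ pe)/= big_map.
Qed.

Let exceed_ex k lam x s : I s -> lam < average F k s x -> exists p, exceed k lam p (x, s).
Proof.
move=> Is hl; have /choice[n hn] : forall y, exists n, F s x y -> phi n x = y.
  by move=> y; have [/(Fsub Is)[n e]|nF] := pselect (F s x y); [exists n|exists 0%N].
pose p := [seq n y | y <- fset_set (F s x)].
have pE : pts p x = fset_set (F s x).
  rewrite /pts -map_comp -[RHS]map_id; apply/eq_in_map => y.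
  by rewrite in_fset_set; [move=> /set_mem/hn|exact: finF].
exists p; split => //=.
- by move=> m; rewrite pE in_fset_set; [split=> [/mem_set|/set_mem]|exact: finF].
- by rewrite pE fset_uniq.
move: hl; rewrite averageE; last exact: finF.
rewrite mulrC ltr_pdivlMr ?cardR_gt0//; [|exact: finF|exact: F0].
by rewrite /cardR -pE /pts size_map big_map.
Qed.

(** Measurable inner parts [L i] exhaust the projections [D i] of [exceed] up to null sets. Finitely
    many of them fit [measure_maximal_le], whose bound depends neither on the lists nor on their
    number. *)
Lemma maximal_inequality (k : X -> R) (lam : R) : L1 mu k -> (forall y, 0 <= k y) -> 0 < lam ->
  exists H, [/\ measurable H, [set x | exists s, I s /\ lam < average F k s x] `<=` H &
    fine (mu H) <= 4 * C ^+ 2 / lam * mean mu k].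
Proof.
move=> Ik k0 lam0; have mk := L1_measurable Ik.
pose p i : seq nat := odflt [::] (choice.unpickle i).
pose D i := [set x | exists s, exceed k lam (p i) (x, s)].
have /choice[L hL] : forall i, exists L, [/\ measurable L, L `<=` D i & mu.-negligible (D i `\` L)].
  move=> i; apply: measurable_projection; first exact: standard_borel_real.
  exact: measurable_exceed.
have [N [mN N0 hN]] : mu.-negligible (\bigcup_i (D i `\` L i)).
  by apply: negligible_bigcup => i; have [] := hL i.
pose U j := \bigcup_(i in [set i | (i < j)%N]) L i.
have mL i : measurable (L i) by have [] := hL i.
have mU j : measurable (U j) by apply: bigcup_measurable => i _.
have mLL : measurable (\bigcup_j U j) by exact: bigcup_measurable.
pose b := 4 * C ^+ 2 / lam * mean mu k.
have hU j : (mu (U j) <= b%:E)%E.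
  rewrite -mean_ind// lee_fin.
  (* Concatenating the first [j] lists gives one finite list that serves all points of [U j]. *)
  apply: (@measure_maximal_le k lam (U j) (flatten [seq p i | i <- iota 0 j])) => //.
  move=> z [i /= ij Lz]; have [_ /(_ z Lz)[s /exceedP[Is h1 h2]] _] := hL i.
  exists s; split => // y /h1[m mp e]; exists m => //; apply/flatten_mapP; exists i => //.
  by rewrite mem_iota.
have hLL : (mu (\bigcup_j U j) <= b%:E)%E.
  have /cvg_lim : mu (U j) @[j --> \oo] --> mu (\bigcup_j U j).
    apply: nondecreasing_cvg_mu => // i j ij; apply/subsetPset => x [m /= mi Lx].
    by exists m => //=; exact: leq_trans ij.
  move=> <- //; apply: lime_le; last by apply: nearW.
  apply: ereal_nondecreasing_is_cvgn => i j ij; rewrite le_measure ?inE// => x [m /= mi Lx].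
  by exists m => //=; exact: leq_trans ij.
exists ((\bigcup_j U j) `|` N); split; first exact: measurableU.
- move=> x [s [Is /(exceed_ex Is)[q hq]]].
  have Dx : D (choice.pickle q) x by exists s; rewrite /p choice.pickleK.
  have [Lx|nL] := pselect (L (choice.pickle q) x).
    by left; exists (choice.pickle q).+1 => //; exists (choice.pickle q) => /=.
  by right; apply: hN; exists (choice.pickle q).
rewrite -lee_fin fineK ?fin_probability//; last exact: measurableU.
by rewrite measureU0.
Qed.

(** As averages reproduce [h] almost everywhere, the deviation from [h] comes from averages of [c]
    and of [f - c - h]. The former tend to zero everywhere; the latter exceed [e / 2] at some index
    only on a set of small measure. *)
Theorem pointwise_ergodic (f : X -> R) : L1 mu f -> exists h, [/\ L1 mu h, ae_invariant mu phi h,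
  forall A, measurable A -> ae_invariant mu phi (\1_A) ->
    mean mu (fun x => \1_A x * h x) = mean mu (fun x => \1_A x * f x) &
  {ae mu, forall x, average F f r x @[r --> within I (pinfty_nbhs R)] --> h x}].
Proof.
move=> If; have [h [Ih ih hh]] := density mphi pphi If.
exists h; split => //; first by move=> A mA iA; exact: (mean_set_density mphi pphi).
have bad (e : R) : 0 < e -> mu.-negligible
    (~` [set x | \forall r \near within I (pinfty_nbhs R), `|h x - average F f r x| <= e]).
  move=> e0; have e2 : 0 < e / 2 by rewrite divr_gt0.
  pose K := 4 * C ^+ 2 / (e / 2).
  have K0 : 0 <= K by rewrite divr_ge0 ?mulr_ge0 ?exprn_ge0// ltW.
  have /choice[H hH] : forall n : nat, exists H, [/\ measurable H, fine (mu H) <= n.+1%:R^-1 &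
      forall x, ~ H x -> (forall r, I r -> average F h r x = h x) ->
      \forall r \near within I (pinfty_nbhs R), `|h x - average F f r x| <= e].
    (* [K] is the constant of the maximal inequality at level [e / 2], so this error makes the
       exceptional set of measure at most [n.+1%:R^-1]. *)
    move=> n; have d0 : 0 < n.+1%:R^-1 / (1 + K) :> R.
      by rewrite divr_gt0 ?invr_gt0// ltr_pwDl.
    have [c cc hc] := hh _ d0.
    have Ic := bounded_mfun_L1 mu (coboundary_bounded mphi cc).
    pose g x := `|f x - c x - h x|.
    have Ig : L1 mu g by apply: L1_abs; apply: L1B => //; exact: L1B.
    have [H [mH sH hH]] := maximal_inequality Ig (fun y => normr_ge0 _) e2.
    exists H; split => //.
      apply: le_trans hH _; rewrite -/K; apply: (@le_trans _ _ (K * (n.+1%:R^-1 / (1 + K)))).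
        by rewrite ler_wpM2l.
      rewrite mulrCA ler_piMr ?invr_ge0// ler_pdivrMr ?mul1r ?ltr_pwDl//; lra.
    move=> x nH hx; have := average_coboundary_cvg0 x cc => /cvgr0Pnorm_le/(_ _ e2).
    apply: filterS2 (withinT _ _) => r Ir hcr.
    have hg : average F g r x <= e / 2.
      by rewrite leNgt; apply/negP => hg; apply: nH; apply: sH; exists r.
    have fx := finF x Ir.
    have -> : h x - average F f r x = - average F c r x - average F (fun x => f x - c x - h x) r x.
      by rewrite !averageB// hx//; lra.
    apply: le_trans (ler_normB _ _) _; rewrite normrN.
    have := average_abs fx (fun x => f x - c x - h x); rewrite -/g; lra.
  have [N [mN N0 hN]] := average_invariant ih.
  exists (N `|` \bigcap_n H n); have mH n : measurable (H n) by have [] := hH n.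
  have mI' : measurable (\bigcap_n H n) by exact: bigcapT_measurable.
  have I0 : mu (\bigcap_n H n) = 0%E.
    apply/eqP; rewrite eq_le measure_ge0 andbT.
    rewrite -(fineK (fin_probability mu mI')) lee_fin; apply: ler_eps => e' e'0; rewrite add0r.
    have [n hn] := ex_invS_lt e'0; have [_ hle _] := hH n.
    apply: le_trans (le_trans hle (ltW hn)).
    rewrite fine_le ?fin_probability// le_measure ?inE//; exact: bigcap_inf.
  split; [exact: measurableU|by rewrite measureU0|].
  move=> x /= nx; have [Nx|nN] := pselect (N x); [by left|right] => n _.
  apply: contrapT => nHx; apply: nx; have [_ _] := hH n; apply => //.
  by apply: contrapT => nn; apply: nN; exact: hN.
have : {ae mu, forall x, forall n : nat,
    \forall r \near within I (pinfty_nbhs R), `|h x - average F f r x| <= n.+1%:R^-1}.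
  by apply: ae_foralln => n; apply: bad; rewrite invr_gt0.
apply: filterS => x hx; apply/cvgrPdist_le => e e0.
have [n hn] := ex_invS_lt e0; apply: filterS (hx n) => r hr.
exact: le_trans hr (ltW hn).
Qed.

End Ergodic.

(** * Measure preserving equivalence relations *)

Section InvariantMeasure.
Context (R : realType) (d : measure_display) (X : measurableType d).
Variable mu : probability X R.

(* No measurability is required, as the integral is a supremum over simple functions. *)
Lemma ge0_le_integral_nomeas (f g : X -> \bar R) : (forall x, 0 <= f x)%E ->
  (forall x, f x <= g x)%E -> (\int[mu]_x f x <= \int[mu]_x g x)%E.
Proof.
move=> f0 fg; have g0 x : (0 <= g x)%E by exact: le_trans (fg x).
rewrite !ge0_integralTE//; apply: ub_ereal_sup => _ [h hf <-]; apply: ereal_sup_ubound.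
by exists h => // x; exact: le_trans (fg x).
Qed.

Lemma counting_ge0 (A : set X) : (0 <= counting A :> \bar R)%E.
Proof. by rewrite /counting; case: ifP => _; rewrite ?lee_fin// leey. Qed.

Lemma counting_ge1 (A : set X) : A !=set0 <-> (1 <= counting A :> \bar R)%E.
Proof.
rewrite /counting; split=> [[x Ax]|].
  case: asboolP => [fA|_]; last exact: leey.
  rewrite lee_fin ler1n cardfs_gt0; apply/fset0Pn; exists x.
  by rewrite in_fset_set// inE.
case: asboolP => [fA|nfA _].
  rewrite lee_fin ler1n cardfs_gt0 => /fset0Pn[x]; rewrite in_fset_set// inE => Ax.
  by exists x.
by apply/set0P/negP => /eqP A0; apply: nfA; rewrite A0.
Qed.

Lemma counting1 (x : X) : (counting [set x] = 1 :> \bar R)%E.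
Proof.
by rewrite /counting asboolT// fset_set1 cardfs1.
Qed.

Lemma counting0 : (counting (@set0 X) = 0 :> \bar R)%E.
Proof. by rewrite /counting asboolT// fset_set0. Qed.

Hypothesis sX : standard_borel R X.

(** Over a measurable inner part [L] of the projection all sections of [N] are nonempty, so [mu L]
    is at most the left count. *)
Lemma left_count_negligible (N : set (X * X)) : measurable N -> left_count mu N = 0%E ->
  mu.-negligible [set x | exists y, N (x, y)].
Proof.
move=> mN N0; have [L [mL LN hL]] := measurable_projection mu sX mN.
have L0 : mu L = 0%E.
  apply/eqP; rewrite eq_le measure_ge0 andbT -N0.
  have -> : (mu L = \int[mu]_x (\1_L x)%:E)%E by rewrite integral_indic// setIT.
  rewrite /left_count; apply: ge0_le_integral_nomeas => x; first by rewrite lee_fin.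
  rewrite indicE; case: (boolP (x \in L)) => [/set_mem/LN[y Ny]|_]; last exact: counting_ge0.
  by apply/counting_ge1; exists y; apply/mem_set.
have : mu.-negligible (L `|` ([set x | exists y, N (x, y)] `\` L)).
  by apply: negligibleU => //; exact/negligibleP.
apply: negligibleS => x Px; have [Lx|nL] := pselect (L x); [by left|by right].
Qed.

Variable E : set (X * X).
Hypothesis HE : discrete_pmp mu E.

(** The pairs of [E] that end in a null set have right count zero, whatever the size of the
    sections; by invariance their left count is zero as well. *)
Lemma pmp_saturate (Z : set X) : mu.-negligible Z ->
  mu.-negligible [set x | exists y, E (x, y) /\ Z y].
Proof.
move=> [N [mN N0 ZN]]; pose A := E `&` (setT `*` N).
have mA : measurable A.
  by apply: measurableI; [exact: pmp_measurable HE|exact: measurableX].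
have A0 : left_count mu A = 0%E.
  rewrite (pmp_invariant HE mA); last by move=> [x y] [].
  apply/eqP; rewrite eq_le; apply/andP; split; last by apply: integral_ge0 => y _; exact: counting_ge0.
  have <- : (\int[mu]_y ((cst +oo) \_ N) y = 0)%E.
    by rewrite -integral_mkcond; apply: null_set_integral.
  apply: ge0_le_integral_nomeas => y; first exact: counting_ge0.
  rewrite patchE; case: (boolP (y \in N)) => [_|/negP nNy]; first exact: leey.
  have -> : ysection A y = set0; last by rewrite counting0.
  by apply/seteqP; split=> x // /set_mem [_ [_ /= Ny]]; apply: nNy; exact/mem_set.
have := left_count_negligible mA A0; apply: negligibleS => x [y [Exy Zy]].
by exists y; split => //; split => //; exact: ZN.
Qed.

Lemma ae_saturate (P : X -> Prop) : {ae mu, forall x, P x} ->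
  {ae mu, forall x, forall y, E (x, y) -> P y}.
Proof.
move=> /pmp_saturate; apply: negligibleS => x /= /existsNP[y /not_implyP[Exy nP]].
by exists y.
Qed.

End InvariantMeasure.

(** * Asymptotic invariance along the generated group *)

Lemma count_escape_comp (X : choiceType) (W : seq X) (f g : X -> X) : uniq W -> injective g ->
  (count (fun z => f (g z) \notin W) W <=
   count (fun z => f z \notin W) W + count (fun z => g z \notin W) W)%N.
Proof.
(* If [f (g z)] is outside [W], either [g z] is outside already, or the injective [g] sends [z] to a
   point of [W] that escapes under [f]. *)
move=> uW gI; pose Q z := (g z \in W) && (f (g z) \notin W).
have h1 : (count Q W <= count (fun z => f z \notin W) W)%N.
  rewrite -!size_filter -(size_map g); apply: uniq_leq_size.
    by rewrite map_inj_uniq ?filter_uniq.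
  by move=> y /mapP[z]; rewrite mem_filter => /andP[/andP[h2 h3] _] ->; rewrite mem_filter h2 h3.
apply: leq_trans (leq_add h1 (leqnn _)); rewrite -count_predUI.
apply: leq_trans (leq_addr _ _); apply: sub_count => z /= h2.
by rewrite /Q h2 andbT; case: (_ \in _).
Qed.

(** [f] injects the points it keeps in [W] into those that [g] keeps in [W]; pass to complements. *)
Lemma count_escape_inv (X : choiceType) (W : seq X) (f g : X -> X) : uniq W -> cancel f g ->
  (count (fun z => g z \notin W) W <= count (fun z => f z \notin W) W)%N.
Proof.
move=> uW fK.
have h1 : (count (fun z => f z \in W) W <= count (fun z => g z \in W) W)%N.
  rewrite -!size_filter -(size_map f); apply: uniq_leq_size.
    by rewrite map_inj_uniq ?filter_uniq ?fset_uniq//; exact: can_inj fK.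
  by move=> y /mapP[z]; rewrite mem_filter => /andP[h2 h3] ->; rewrite mem_filter h2 fK h3.
have e1 := count_predC (fun z => f z \in W) W.
have e2 := count_predC (fun z => g z \in W) W.
rewrite -(leq_add2l (count (fun z => f z \in W) W)) e1 -e2.
exact: leq_add.
Qed.

Section GeneratedGroup.
Context (R : realType) (d : measure_display) (X : measurableType d).
Variables (mu : probability X R) (E : set (X * X)) (Psi : set (X -> X)).

(** Group elements are values of terms, coded by trees with generators at the leaves and the
    operation as the tag of a node. *)
Lemma countable_generated_group : countable Psi -> countable (generated_group Psi).
Proof.
move=> cPsi.
have [a aPsi] : exists a : nat -> X -> X, forall f, Psi f -> exists n, a n = f.
  have [[f Pf]|nP] := pselect (exists f, Psi f).
    by have [a [_ ha]] := countable_enum cPsi Pf; exists a.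
  by exists (fun=> id) => f Pf; exfalso; apply: nP; exists f.
pose inv (f : X -> X) : X -> X :=
  if pselect (exists g, cancel f g /\ cancel g f) is left h then sval (cid h) else id.
pose fix w (t : GenTree.tree nat) : X -> X :=
  match t with
  | GenTree.Leaf n => a n
  | GenTree.Node 0 [:: t1; t2] => w t1 \o w t2
  | GenTree.Node 1 [:: t1] => inv (w t1)
  | _ => id
  end.
have sub : generated_group Psi `<=` range w.
  move=> f; elim=> {f} [f /aPsi[n <-]||f g _ [t1 _ <-] _ [t2 _ <-]|f g _ [t1 _ <-] fK gK].
  - by exists (GenTree.Leaf n).
  - by exists (GenTree.Node 2 [::]).
  - by exists (GenTree.Node 0 [:: t1; t2]).
  - exists (GenTree.Node 1 [:: t1]) => //=; rewrite /inv.
    case: pselect => [h|[]]; last by exists g.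
    case: (cid h) => g' [h1 h2] /=; apply/funext => x.
    by rewrite -{1}(gK x) h1.
apply: card_le_trans (subset_card_le sub) _.
exact: card_le_trans (card_image_le _ _) (countableP _).
Qed.

Hypothesis HE : discrete_pmp mu E.
Hypothesis PsiE : Psi `<=` Inn E.

Lemma generated_group_Inn : generated_group Psi `<=` Inn E.
Proof.
move=> f; elim=> {f} [f /PsiE//||f g _ [[f' [fK f'K mf mf']] Ef] _ [[g' [gK g'K mg mg']] Eg]|f g _ [[f' [fK f'K mf mf']] Ef] fgK gfK].
- split; last exact: pmp_refl HE.
  by exists id; split.
- split; last by move=> x; apply: (pmp_trans HE) (Eg x) (Ef _).
  exists (g' \o f'); split; [exact: can_comp|exact: can_comp| |]; exact: measurableT_comp.
- have e : g = f' by apply/funext => x; rewrite -{1}(f'K x) fgK.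
  split; first by rewrite e; exists f.
  by move=> x; apply: (pmp_sym HE); rewrite -{2}(gfK x).
Qed.

Variables (I : set R) (F : R -> X -> set X).
Hypothesis finF : forall r x, I r -> finite_set (F r x).

(** Subadditive under composition and not increased by inversion, this fraction lets convergence to
    zero pass from the generators to their group. *)
Definition escape (psi : X -> X) r x : R := average F (fun z => (`[< ~ F r x (psi z) >])%:R) r x.

Let escapeE psi r x : I r -> escape psi r x = (cardR R (F r x))^-1 *
  (count (fun z => psi z \notin fset_set (F r x)) (fset_set (F r x)))%:R.
Proof.
move=> Ir; rewrite /escape averageE; last exact: finF.
congr (_ * _); rewrite -sum1_count natr_sum [RHS]big_mkcond; apply: eq_bigr => z _.
rewrite in_fset_set; last exact: finF.
case: asboolP => h; first by rewrite memNset.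
by rewrite mem_set//; exact: contrapT.
Qed.

Let escape_ge0 psi r x : I r -> 0 <= escape psi r x.
Proof. by move=> Ir; rewrite escapeE// mulr_ge0 ?invr_ge0. Qed.

Let squeeze0 (u v : R -> R) : (forall r, I r -> 0 <= u r <= v r) ->
  v r @[r --> within I (pinfty_nbhs R)] --> (0 : R) -> u r @[r --> within I (pinfty_nbhs R)] --> (0 : R).
Proof.
move=> uv; apply: squeeze_cvgr; last exact: cvg_cst.
by apply: filterS (withinT _ _) => r; exact: uv.
Qed.

Lemma generated_group_escape :
  (forall psi, Psi psi -> {ae mu, forall x, cardR R (F r x `+` psi @` F r x) / cardR R (F r x)
     @[r --> within I (pinfty_nbhs R)] --> (0 : R)}) ->
  forall psi, generated_group Psi psi ->
    {ae mu, forall x, escape psi r x @[r --> within I (pinfty_nbhs R)] --> (0 : R)}.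
Proof.
move=> hPsi psi; elim=> {psi} [f Pf||f g Gf hf Gg hg|f g Gf hf fgK gfK].
(* The injective [f] sends the escaping points into the symmetric difference. *)
- apply: filterS (hPsi f Pf) => x; apply: squeeze0 => r Ir; rewrite escape_ge0//= escapeE// mulrC.
  rewrite ler_wpM2r ?invr_ge0// /cardR ler_nat.
  have [[f' [fK _ _ _]] _] := PsiE Pf.
  set W := fset_set (F r x); rewrite -size_filter -(size_map f).
  apply: uniq_leq_size; first by rewrite map_inj_uniq ?filter_uniq ?fset_uniq//; exact: can_inj fK.
  have fS : finite_set (F r x `+` f @` F r x).
    rewrite /setY finite_setU; split; apply: finite_setD.
      exact: finF.
    by apply: finite_image; exact: finF.
  move=> y /mapP[z]; rewrite mem_filter => /andP[nz zW] ->.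
  rewrite in_fset_set// inE; right; split.
    by exists z => //; move: zW; rewrite in_fset_set ?inE//; exact: finF.
  by move=> Fz; move: nz; rewrite in_fset_set ?mem_set//; exact: finF.
- apply: aeW => x.
  apply: (@squeeze0 _ (fun=> 0)); last exact: cvg_cst.
  move=> r Ir; rewrite escape_ge0//= escapeE//.
  rewrite (eq_in_count (a2 := pred0)) ?count_pred0 ?mulr0// => z.
  by move=> zW /=; rewrite zW.
- apply: filterS2 hf hg => x hf hg.
  apply: (@squeeze0 _ (fun r => escape f r x + escape g r x)); last first.
    by have := cvgD hf hg; rewrite addr0; exact.
  move=> r Ir; rewrite escape_ge0//= !escapeE// -mulrDr ler_wpM2l ?invr_ge0//.
  have [[g' [gK _ _ _]] _] := generated_group_Inn Gg.
  by rewrite -natrD ler_nat; apply: (@count_escape_comp _ _ f g); [exact: fset_uniq|exact: can_inj gK].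
- apply: filterS hf => x; apply: squeeze0 => r Ir; rewrite escape_ge0//= !escapeE//.
  by rewrite ler_wpM2l ?invr_ge0// ler_nat; apply: (@count_escape_inv _ _ f g) => //; exact: fset_uniq.
Qed.

End GeneratedGroup.

(** * Overlap bounds for regular and for uniform tempered families *)

Section CoveringConstants.
Context (R : realType) (d : measure_display) (X : measurableType d).
Variables (mu : probability X R) (E : set (X * X)) (I : set R) (F : R -> X -> set X).
Hypothesis HE : discrete_pmp mu E.
Hypothesis HF : borel_family I E F.

Lemma finite_family r x : I r -> finite_set (F r x).
Proof.
move=> Ir; apply: sub_finite_set (family_finite HF x Ir) => y Fy.
by exists r => //; split.
Qed.

Lemma countingE (A : set X) : finite_set A -> counting A = (cardR R A)%:E.
Proof. by move=> fA; rewrite /counting asboolT. Qed.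

Lemma size_le_counting (T : seq X) (A : set X) : uniq T -> (forall z, z \in T -> A z) ->
  ((size T)%:R%:E <= counting A :> \bar R)%E.
Proof.
move=> uT TA; rewrite /counting; case: asboolP => [fA|_]; last exact: leey.
rewrite lee_fin ler_nat; apply: uniq_leq_size => // z /TA Az.
by rewrite in_fset_set// inE.
Qed.

(** The bounds at smaller and at equal index used by the greedy selection. Duplicate-free lists
    avoid asking whether the sets of such points are finite. *)
Definition overlaps_le C r x :=
  (forall T : seq X, uniq T ->
    (forall z, z \in T -> exists s, [/\ I s, s < r & exists y, F s z y /\ F r x y]) ->
    (size T)%:R <= C * cardR R (F r x)) /\
  (forall y (T : seq X), uniq T -> (forall z, z \in T -> F r z y) -> F r x y ->
    (size T)%:R <= C * cardR R (F r x)).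

(** Points of both kinds lie in the union that regularity bounds. The constant is increased so that
    singletons satisfy the bounds too. *)
Lemma regular_overlaps_le : regular I mu F ->
  exists2 C, 1 <= C & {ae mu, forall x, forall r, I r -> overlaps_le C r x}.
Proof.
move=> [C C0 hC]; exists (1 + C); first by rewrite lerDl ltW.
apply: filterS hC => x hx r Ir; have := hx r Ir.
rewrite (countingE (finite_family x Ir)) -EFinM => hS.
have le1 : C * cardR R (F r x) <= (1 + C) * cardR R (F r x).
  by rewrite ler_wpM2r ?ler0n// lerDr.
split=> [T uT hT|y T uT hT Fxy]; apply: le_trans le1; rewrite -lee_fin; apply: le_trans hS;
  apply: size_le_counting => // z zT.
  by have [s [Is sr [y [h1 h2]]]] := hT z zT; exists s; [split=> //; exact: ltW|exists y].
by exists r; [split|exists y => //; exact: hT].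
Qed.

(** Temperedness handles smaller indices. At equal index the points whose set contains [y] number at
    most [b n], which is at most [Cu * a n], hence at most [Cu] times the size of the set at [x]. *)
Lemma tempered_overlaps_le : uniform I mu F -> tempered I mu F ->
  exists2 C, 1 <= C & {ae mu, forall x, forall r, I r -> overlaps_le C r x}.
Proof.
move=> [Cu [a [b [Cu0 hu]]]] [IE [Ct ht]].
have IP n : I n%:R by rewrite IE; exists n.
(* The sign of [Ct] is not known, hence the absolute value. *)
exists (1 + `|Ct| + Cu); first by rewrite -addrA lerDl addr_ge0// ltW.
have hu1 : {ae mu, forall x, forall n : nat,
     ((a n%:R)%:E <= counting (F n%:R x) <= (b n%:R)%:E)%E /\
     ((a n%:R)%:E <= counting (sf_inv (F n%:R) x) <= (b n%:R)%:E)%E}.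
  by apply: ae_foralln => n; have [] := hu _ (IP n).
(* The bound on [sf_inv] is needed at a point [y] of the class of [x], not at [x]. *)
have hu2 := ae_saturate (pmp_standard HE) HE hu1.
apply: filterS2 hu2 ht => x hx htx r Ir.
have cg : 0 <= cardR R (F r x) by exact: ler0n.
split=> [T uT hT|y T uT hT Fxy].
  have := htx r Ir; rewrite (countingE (finite_family x Ir)) -EFinM => hS.
  apply: (@le_trans _ _ (Ct * cardR R (F r x))); last first.
    by rewrite ler_wpM2r// (le_trans (ler_norm _))//; have := ltW Cu0; lra.
  rewrite -lee_fin; apply: le_trans hS; apply: size_le_counting => // z zT.
  have [s [Is sr [y [h1 h2]]]] := hT z zT; exists s; last by exists y.
  split=> //; move: Ir Is sr; rewrite IE => -[n _ <-] [m _ <-].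
  by rewrite ltr_nat lerBrDr natr1 ler_nat.
move: (Ir); rewrite {1}IE => -[n _ nr]; subst r.
have [_ _ hab _] := hu _ Ir.
have [/andP[h1 _] _] := hx x (pmp_refl HE x) n.
have [_ /andP[_ h2]] := hx y (family_sub HF Ir Fxy) n.
rewrite (countingE (finite_family x Ir)) lee_fin in h1.
apply: (@le_trans _ _ (Cu * cardR R (F n%:R x))); last first.
  by rewrite ler_wpM2r// lerDr addr_ge0.
apply: (@le_trans _ _ (b n%:R)).
  by rewrite -lee_fin; apply: le_trans h2; exact: size_le_counting.
by apply: le_trans hab _; rewrite ler_wpM2l// ltW.
Qed.

End CoveringConstants.

Section Lift.
Context (R : realType) (d : measure_display) (X : measurableType d).
Variable mu : probability X R.
Hypothesis sX : standard_borel R X.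

(** Where sections are single points, the preimage of a basic set [U i] is the projection of the
    part of [G] over [U i], measurable modulo a null set. On the null set removed the map is the
    identity, so measurability is exact. *)
Lemma measurable_selection (G : set (X * X)) : measurable G ->
  {ae mu, forall x, exists! y, G (x, y)} ->
  exists2 phi : X -> X, measurable_fun setT phi & {ae mu, forall x, G (x, phi x)}.
Proof.
move=> mG [N0 [mN0 N00 hN0]].
have [U [mU _ hU]] := standard_borel_base sX.
pose P i := [set x | exists y, (G `&` (setT `*` U i)) (x, y)].
have /choice[L hL] : forall i, exists L, [/\ measurable L, L `<=` P i & mu.-negligible (P i `\` L)].
  move=> i; apply: measurable_projection => //; apply: measurableI => //; exact: measurableX.
have [N1 [mN1 N10 hN1]] : mu.-negligible (\bigcup_i (P i `\` L i)).
  by apply: negligible_bigcup => i; have [] := hL i.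
pose N := N0 `|` N1; have mN : measurable N by exact: measurableU.
pose phi x := if x \in N then x else xget x [set y | G (x, y)].
have hphi x : ~ N x -> G (x, phi x) /\ forall y, G (x, y) -> y = phi x.
  move=> nN; have [y [Gy uy]] : exists! y, G (x, y).
    by apply: contrapT => h; apply: nN; left; exact: hN0.
  rewrite /phi memNset//; case: xgetP => [z _ Gz|/(_ y)//].
  by split => // y' /uy <-; exact: uy.
exists phi.
  apply: hU => i.
  have -> : phi @^-1` U i = (L i `\` N) `|` (N `&` U i).
    apply/seteqP; split=> x /=.
      have [Nx|nN] := pselect (N x); first by rewrite /phi mem_set//; right.
      move=> Ui; left; split => //; apply: contrapT => nL; apply: (nN); right; apply: hN1.
      exists i => //; split => //; exists (phi x); split => //; have [] := hphi x nN; exact.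
    move=> [[Lx nN]|[Nx Ux]]; last by rewrite /phi mem_set.
    have [_ /(_ x Lx)[y [Gy [_ /= Uy]]] _] := hL i.
    by have [_ /(_ y Gy) <-] := hphi x nN.
  have mL : measurable (L i) by have [] := hL i.
  by apply: measurableU; [exact: measurableD|exact: measurableI].
exists N; split => //; first by rewrite measureU0.
by move=> x /= nG; apply: contrapT => nN; apply: nG; have [] := hphi x nN.
Qed.

End Lift.

(** * Class-bijective extensions *)

Section Extension.
Context (R : realType) (d d' : measure_display).
Context (X : measurableType d) (X' : measurableType d').
Variables (mu : probability X R) (E : set (X * X)) (I : set R) (F : R -> X -> set X).
Variables (mu' : probability X' R) (E' : set (X' * X')) (pi : X' -> X).
Hypothesis HE : discrete_pmp mu E.
Hypothesis HF : borel_family I E F.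
Hypothesis Hpi : class_bijective_extension mu E mu' E' pi.
Hypothesis mI : measurable (I : set (measurableTypeR R)).
Hypothesis natI : forall n : nat, I n.+1%:R.
Variables (psi psi' : nat -> X -> X).
Hypothesis mpsi : forall n, measurable_fun setT (psi n).
Hypothesis mpsi' : forall n, measurable_fun setT (psi' n).
Hypothesis psiK : forall n, cancel (psi n) (psi' n).
Hypothesis psi'K : forall n, cancel (psi' n) (psi n).
Hypothesis Epsi : forall n x, E (x, psi n x).
Variable C : R.
Hypothesis C1 : 1 <= C.

(** The almost everywhere properties of the base are gathered so that they are pulled back along
    [pi] together. *)
Definition good_point x := [/\ forall y, E (x, y) -> exists n, psi n x = y,
  forall r, I r -> F r x !=set0,
  forall n, escape F (psi n) r x @[r --> within I (pinfty_nbhs R)] --> (0 : R)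
  & forall r, I r -> overlaps_le I F C r x].

Hypothesis ae_good : {ae mu, forall x, good_point x}.

Let HE' := ext_pmp Hpi.
Let sX' := pmp_standard HE'.
Let mpi := ext_measurable Hpi.

Let ae_pullback (Q : X -> Prop) : {ae mu, forall x, Q x} -> {ae mu', forall x, Q (pi x)}.
Proof.
move=> [N [mN N0 hN]]; exists (pi @^-1` N); split; last by move=> x nQ; exact: hN.
  by rewrite -[X in measurable X]setTI; exact: mpi.
by rewrite -N0 -(ext_pushforward Hpi mN).
Qed.

(** For almost every [x], bijectivity of [pi] on the class gives exactly one point of the class
    above [f (pi x)]. *)
Let lift_map (f : X -> X) : measurable_fun setT f -> (forall x, E (x, f x)) ->
  exists phi : X' -> X', measurable_fun setT phi /\
    {ae mu', forall x, E' (x, phi x) /\ pi (phi x) = f (pi x)}.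
Proof.
move=> mf Ef; pose G := E' `&` [set p | pi p.2 = f (pi p.1)].
have [||phi mphi hphi] := @measurable_selection _ _ _ mu' sX' G.
- apply: measurableI; first exact: pmp_measurable HE'.
  apply: (measurable_eq_fun (pmp_standard HE)).
    exact: (measurableT_comp mpi measurable_snd).
  exact: (measurableT_comp mf (measurableT_comp mpi measurable_fst)).
- apply: filterS (ext_bij Hpi) => x [_ inj surj].
  have [y Exy e] := surj (f (pi x)) (Ef _).
  exists y; split; first by split.
  move=> y' [Exy' e']; apply: inj; rewrite ?inE//.
  by rewrite e e'.
by exists phi; split => //; apply: filterS hphi => x [].
Qed.

Let good_lift (phi phi' : nat -> X' -> X') x := [/\ good_point (pi x),
  set_bij (eqclass E' x) (eqclass E (pi x)) pi,
  forall n, E' (x, phi n x) /\ pi (phi n x) = psi n (pi x) &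
  forall n, E' (x, phi' n x) /\ pi (phi' n x) = psi' n (pi x)].

Let class_orbit phi phi' x : good_lift phi phi' x ->
  forall y, E' (x, y) -> exists n, phi n x = y.
Proof.
move=> [[h _ _ _] [_ inj _] hphi _] y Exy.
have [n e] := h _ (ext_morph Hpi Exy); have [E1 e1] := hphi n.
by exists n; apply: inj; rewrite ?inE// e1.
Qed.

(** [pointwise_ergodic] asks its hypotheses at every point, which requires an invariant measurable
    set of full measure where all of them hold. *)
Let good_set : exists phi phi' Omega, [/\ forall n, measurable_fun setT (phi n),
  forall n, measurable_fun setT (phi' n), measurable Omega, {ae mu', forall x, Omega x} &
  (forall x y, Omega x -> E' (x, y) -> Omega y) /\ forall x, Omega x -> good_lift phi phi' x].
Proof.
have /choice[phi hphi] := fun n => lift_map (mpsi n) (Epsi n).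
have /choice[phi' hphi'] : forall n, exists phi' : X' -> X', measurable_fun setT phi' /\
    {ae mu', forall x, E' (x, phi' x) /\ pi (phi' x) = psi' n (pi x)}.
  move=> n; apply: lift_map => // x; apply: (pmp_sym HE); rewrite -{2}(psi'K n x); exact: Epsi.
have mphi n : measurable_fun setT (phi n) by have [] := hphi n.
exists phi, phi'.
have aeE : {ae mu', forall x, forall n, E' (x, phi n x) /\ pi (phi n x) = psi n (pi x)}.
  by apply: ae_foralln => n; have [] := hphi n.
have aeE' : {ae mu', forall x, forall n, E' (x, phi' n x) /\ pi (phi' n x) = psi' n (pi x)}.
  by apply: ae_foralln => n; have [] := hphi' n.
have : {ae mu', forall x, good_lift phi phi' x}.
  apply: filterS (filterI (filterI (ae_pullback ae_good) (ext_bij Hpi)) (filterI aeE aeE')).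
  by move=> x [[h1 h2] [h3 h4]]; split.
move=> /(ae_saturate sX' HE')[Z [mZ Z0 hZ]].
have aeZ : {ae mu', forall x, ~ Z x}.
  by exists Z; split => // x /= /contrapT.
(* Off [Z] the maps [phi n] sweep the whole class, so removing also the preimages of [Z] leaves an
   invariant set that is still measurable. *)
pose W := Z `|` \bigcup_n (phi n @^-1` Z).
have mW : measurable W.
  apply: measurableU => //; apply: bigcup_measurable => n _.
  by rewrite -[X in measurable X]setTI; exact: mphi.
have goodZ x : ~ Z x -> forall y, E' (x, y) -> good_lift phi phi' y.
  by move=> nZ y Exy; apply: contrapT => h; apply: nZ; apply: hZ => h'; apply: h; exact: h'.
have orb x y : ~ Z x -> E' (x, y) -> exists n, phi n x = y.
  by move=> nZ; apply: (@class_orbit _ phi'); exact: (goodZ x nZ x (pmp_refl HE' x)).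
exists (~` W); split => //.
- by move=> n; have [] := hphi' n.
- exact: measurableC.
- apply: filterS2 (ae_saturate sX' HE' aeZ) aeE => x h1 h2 [/h1|[n _ /= Zn]].
    by apply; exact: pmp_refl HE' x.
  by have [Exn _] := h2 n; exact: h1 Exn Zn.
split=> [x y nW Exy|x nW]; last first.
  by apply: (goodZ x) (pmp_refl HE' x) => Zx; apply: nW; left.
have nZ : ~ Z x by move=> Zx; apply: nW; left.
have inZ w : E' (x, w) -> ~ Z w.
  by move=> Exw Zw; have [n e] := orb x w nZ Exw; apply: nW; right; exists n => //=; rewrite e.
move=> [/(inZ y Exy)//|[n _ /= Zn]].
have [_ _ /(_ n)[Eyn _] _] := goodZ x nZ y Exy.
exact: inZ (pmp_trans HE' Exy Eyn) Zn.
Qed.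

Lemma lifted_average_cvg (f : X' -> R) : L1 mu' f -> exists2 g, is_cond_exp mu' (invariant_sets mu' E') f g &
  {ae mu', forall x, average (lift_family E' pi F) f r x @[r --> within I (pinfty_nbhs R)] --> g x}.
Proof.
move=> If; have [phi [phi' [Om [mphi mphi' mOm aeOm [OmE hOm]]]]] := good_set.
(* Outside [Om] the maps become the identity and the sets singletons; the averages change on a null
   set only. *)
pose ph n x := if x \in Om then phi n x else x.
pose ph' n x := if x \in Om then phi' n x else x.
pose Fh r x := if x \in Om then lift_family E' pi F r x else [set x].
have phO n x : Om x -> ph n x = phi n x by move=> Ox; rewrite /ph mem_set.
have ph'O n x : Om x -> ph' n x = phi' n x by move=> Ox; rewrite /ph' mem_set.
have FhO r x : Om x -> Fh r x = lift_family E' pi F r x by move=> Ox; rewrite /Fh mem_set.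
have phN n x : ~ Om x -> ph n x = x by move=> Ox; rewrite /ph memNset.
have ph'N n x : ~ Om x -> ph' n x = x by move=> Ox; rewrite /ph' memNset.
have FhN r x : ~ Om x -> Fh r x = [set x] by move=> Ox; rewrite /Fh memNset.
have Ophi n x : Om x -> Om (phi n x).
  by move=> Ox; have [_ _ /(_ n)[Exn _] _] := hOm x Ox; exact: OmE Exn.
have Ophi' n x : Om x -> Om (phi' n x).
  by move=> Ox; have [_ _ _ /(_ n)[Exn _]] := hOm x Ox; exact: OmE Exn.
have inj x y z : Om x -> E' (x, y) -> E' (x, z) -> pi y = pi z -> y = z.
  by move=> Ox Exy Exz e; have [_ [_ i _] _ _] := hOm x Ox; apply: i; rewrite ?inE.
have phK n : cancel (ph n) (ph' n).
  move=> x; have [Ox|nO] := pselect (Om x); last by rewrite phN// ph'N.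
  rewrite phO// ph'O//; last exact: Ophi.
  have [_ _ /(_ n)[E1 e1] _] := hOm x Ox.
  have [_ _ _ /(_ n)[E2 e2]] := hOm _ (Ophi n x Ox).
  apply: (inj x) => //; [exact: (pmp_trans HE' E1 E2)|exact: pmp_refl HE' x|].
  by rewrite e2 e1 psiK.
have ph'K n : cancel (ph' n) (ph n).
  move=> x; have [Ox|nO] := pselect (Om x); last by rewrite ph'N// phN.
  rewrite ph'O// phO//; last exact: Ophi'.
  have [_ _ _ /(_ n)[E1 e1]] := hOm x Ox.
  have [_ _ /(_ n)[E2 e2] _] := hOm _ (Ophi' n x Ox).
  apply: (inj x) => //; [exact: (pmp_trans HE' E1 E2)|exact: pmp_refl HE' x|].
  by rewrite e2 e1 psi'K.
have mem_Om : measurable_fun setT (fun x => x \in Om).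
  apply: (measurable_fun_bool true); rewrite setTI.
  suff -> : (fun x => x \in Om) @^-1` [set true] = Om by [].
  by apply/seteqP; split=> x /=; [move/set_mem|move/mem_set].
have mph n : measurable_fun setT (ph n) by exact: measurable_fun_ifT.
have mph' n : measurable_fun setT (ph' n) by exact: measurable_fun_ifT.
have Eph n x : E' (x, ph n x).
  have [Ox|nO] := pselect (Om x); last by rewrite phN//; exact: pmp_refl HE' x.
  by rewrite phO//; have [_ _ /(_ n)[]] := hOm x Ox.
have meq n m : measurable [set x | ph n x = ph m x] by exact: (measurable_eq_fun sX').
(* Invariance of the measure is applied to the part of the graph of [ph n] with values in [A]: its
   left sections are single points over the preimage of [A], its right sections single points over
   [A]. *)
have pph n A : measurable A -> mu' (ph n @^-1` A) = mu' A.
  move=> mA; pose B := [set p : X' * X' | ph n p.1 = p.2] `&` (setT `*` A).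
  have mB : measurable B.
    apply: measurableI; last exact: measurableX.
    apply: (measurable_eq_fun sX'); last exact: measurable_snd.
    exact: (measurableT_comp (mph n) measurable_fst).
  have BE : B `<=` E' by move=> [x y] [/= <- _].
  have mpA : measurable (ph n @^-1` A) by rewrite -[X in measurable X]setTI; exact: mph.
  have indI D : measurable D -> (mu' D = \int[mu']_x (\1_D x)%:E)%E.
    by move=> mD; rewrite integral_indic// setIT.
  have := pmp_invariant HE' mB BE.
  have -> : left_count mu' B = mu' (ph n @^-1` A).
    rewrite /left_count indI//.
    apply: eq_integral => x _; rewrite indicE.
    case: (boolP (x \in ph n @^-1` A)) => [/set_mem/= Ax|/negP nA].
      have -> : xsection B x = [set ph n x]; last by rewrite counting1.
      apply/seteqP; split=> y /=; first by move=> /set_mem[/= <-].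
      by move=> ->; apply/mem_set; split.
    have -> : xsection B x = set0; last by rewrite counting0.
    apply/seteqP; split=> y //= /set_mem[/= e [_ /= Ay]].
    by apply: nA; apply/mem_set => /=; rewrite e.
  have -> : right_count mu' B = mu' A; last by [].
  rewrite /right_count indI//.
  apply: eq_integral => y _; rewrite indicE.
  case: (boolP (y \in A)) => [/set_mem Ay|/negP nA].
    have -> : ysection B y = [set ph' n y]; last by rewrite counting1.
    apply/seteqP; split=> x /=; first by move=> /set_mem[/= <-]; rewrite phK.
    by move=> ->; apply/mem_set; split => //=; rewrite ph'K.
  have -> : ysection B y = set0; last by rewrite counting0.
  by apply/seteqP; split=> x //= /set_mem[/= e [_ /= Ay]]; apply: nA; apply/mem_set.
have liftE r x y : Om x -> Fh r x y <-> E' (x, y) /\ F r (pi x) (pi y).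
  by move=> Ox; rewrite FhO// /lift_family; split=> [[? ?]|[? ?]].
have bij x : Om x -> forall y, E (pi x, y) -> exists2 z, E' (x, z) & pi z = y.
  by move=> Ox y Ey; have [_ [_ _ /(_ y Ey)[z Ez e]] _ _] := hOm x Ox; exists z.
have finh r x : I r -> finite_set (Fh r x).
  move=> Ir; have [Ox|nO] := pselect (Om x); last by rewrite FhN.
  have /choice[g hg] : forall y, exists z, E (pi x, y) -> E' (x, z) /\ pi z = y.
    move=> y; have [Ey|nE] := pselect (E (pi x, y)); last by exists x.
    by have [z ? ?] := bij x Ox y Ey; exists z.
  apply: sub_finite_set (finite_image g (finite_family HF (pi x) Ir)).
  move=> z /(liftE _ _ _ Ox)[Exz Fz]; exists (pi z) => //.
  have [h1 h2] := hg _ (family_sub HF Ir Fz); exact: (inj x).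
(* [pi] maps [Fh r x] bijectively onto [F r (pi x)]; cardinalities and escaping fractions are
   thereby computed on the base. *)
have permh r x : I r -> Om x ->
    perm_eq [seq pi y | y <- fset_set (Fh r x)] (fset_set (F r (pi x))).
  move=> Ir Ox; have fh := finh r x Ir; have ff := finite_family HF (pi x) Ir.
  apply: uniq_perm; [|exact: fset_uniq|].
    rewrite map_inj_in_uniq ?fset_uniq// => y z.
    rewrite !in_fset_set// => /set_mem/(liftE _ _ _ Ox)[Ey _] /set_mem/(liftE _ _ _ Ox)[Ez _].
    exact: (inj x).
  move=> y; rewrite in_fset_set//; apply/mapP/idP => [[z]|/set_mem Fy].
    by rewrite in_fset_set// => /set_mem/(liftE _ _ _ Ox)[_ Fz] ->; apply/mem_set.
  have [z Ez e] := bij x Ox y (family_sub HF Ir Fy).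
  by exists z => //; rewrite in_fset_set//; apply/mem_set/liftE => //; rewrite e.
have cardh r x : I r -> Om x -> cardR R (Fh r x) = cardR R (F r (pi x)).
  by move=> Ir Ox; rewrite /cardR -(perm_size (permh r x Ir Ox)) size_map.
have F0h r x : I r -> Fh r x !=set0.
  move=> Ir; have [Ox|nO] := pselect (Om x); last by rewrite FhN//; exists x.
  have [[_ h _ _] _ _ _] := hOm x Ox; have [y Fy] := h r Ir.
  have [z Ez e] := bij x Ox y (family_sub HF Ir Fy).
  by exists z; apply/liftE => //; rewrite e.
have Fsubh r x y : I r -> Fh r x y -> exists n, ph n x = y.
  move=> Ir; have [Ox|nO] := pselect (Om x); last first.
    by rewrite FhN// => ->; exists 0%N; rewrite phN.
  move=> /(liftE _ _ _ Ox)[Exy _]; have [n e] := class_orbit (hOm x Ox) Exy.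
  by exists n; rewrite phO.
have mFh g : measurable_fun setT g ->
    measurable [set p : X' * measurableTypeR R | I p.2 /\ Fh p.2 p.1 (g p.1)].
  move=> mg; pose q (p : X' * measurableTypeR R) : X * X * measurableTypeR R :=
    (pi p.1, pi (g p.1), p.2).
  have mq : measurable_fun setT q.
    apply: measurable_fun_pair; last exact: measurable_snd.
    apply: measurable_fun_pair; first exact: (measurableT_comp mpi measurable_fst).
    exact: (measurableT_comp mpi (measurableT_comp mg measurable_fst)).
  have -> : [set p : X' * measurableTypeR R | I p.2 /\ Fh p.2 p.1 (g p.1)] =
     ((Om `&` [set x | E' (x, g x)]) `*` setT) `&`
       (q @^-1` [set p | I p.2 /\ F p.2 p.1.1 p.1.2]) `|`
     ((~` Om `&` [set x | g x = x]) `*` I).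
    apply/seteqP; split=> -[x s] /=.
      move=> [Is]; have [Ox|nO] := pselect (Om x).
        by move=> /(liftE _ _ _ Ox)[h1 h2]; left; do !split.
      by rewrite FhN//= => e; right; do !split.
    move=> [[[[Ox Ex] _] [Is Fx]]|[[nO e] Is]]; split => //; first exact/liftE.
    by rewrite FhN.
  apply: measurableU.
    apply: measurableI; last by rewrite -[X in measurable X]setTI; apply: mq => //; exact: family_measurable HF.
    apply: measurableX => //; apply: measurableI => //.
    have mpg : measurable_fun setT (fun x => (x, g x)) by exact: measurable_fun_pair.
    have := mpg measurableT _ (pmp_measurable HE'); rewrite setTI; exact.
  apply: measurableX => //; apply: measurableI; first exact: measurableC.
  exact: (measurable_eq_fun sX').
have C0 : 0 <= C by exact: le_trans C1.
(* Outside [Om] an overlap list has at most one entry, and [1 <= C] suffices. *)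
have small r x (T : seq X') : ~ Om x -> uniq T -> (forall z, z \in T -> z = x) ->
    (size T)%:R <= C * cardR R (Fh r x).
  move=> nO uT hT; rewrite FhN// /cardR fset_set1 cardfs1 mulr1; apply: le_trans C1.
  rewrite lern1; apply: (@uniq_leq_size _ T [:: x]) => // z /hT ->.
  exact: mem_head.
have samecl r s x y z : I r -> I s -> Om x -> Fh r x y -> Fh s z y -> Om z /\ E' (x, z).
  move=> Ir Is Ox /(liftE _ _ _ Ox)[Exy _] Fzy; have Oy := OmE _ _ Ox Exy.
  have Oz : Om z by apply: contrapT => nO; move: Fzy; rewrite FhN//= => e; apply: nO; rewrite -e.
  split => //; move: Fzy => /(liftE _ _ _ Oz)[Ezy _].
  exact: (pmp_trans HE' Exy (pmp_sym HE' Ezy)).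
have uniq_pi x (T : seq X') : Om x -> uniq T -> (forall z, z \in T -> E' (x, z)) ->
    uniq [seq pi z | z <- T].
  by move=> Ox uT hT; rewrite map_inj_in_uniq// => z w zT wT; apply: (inj x) => //; exact: hT.
have lowh r x (T : seq X') : I r -> uniq T ->
    (forall z, z \in T -> exists s, [/\ I s, s < r & exists y, Fh s z y /\ Fh r x y]) ->
    (size T)%:R <= C * cardR R (Fh r x).
  move=> Ir uT hT; have [Ox|nO] := pselect (Om x); last first.
    apply: small => // z /hT[s [Is _ [y [Fz]]]]; rewrite FhN//= => e; subst y.
    apply: contrapT => zx; have Oz : Om z by apply: contrapT => nz; move: Fz; rewrite FhN//= => e; apply: zx.
    by apply: nO; move: Fz => /(liftE _ _ _ Oz)[Ezx _]; exact: OmE Ezx.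
  have hT' z : z \in T -> Om z /\ E' (x, z).
    by move=> /hT[s [Is _ [y [Fz Fx]]]]; exact: (samecl r s x y z).
  have [[_ _ _ /(_ r Ir)[h _]] _ _ _] := hOm x Ox.
  rewrite cardh// -(size_map pi); apply: h.
    by apply: (uniq_pi x) => // z /hT'[].
  move=> _ /mapP[z zT ->]; have [Oz _] := hT' z zT.
  have [s [Is sr [y [Fz Fx]]]] := hT z zT; exists s; split => //; exists (pi y).
  by move: Fz Fx => /(liftE _ _ _ Oz)[_ ?] /(liftE _ _ _ Ox)[_ ?].
have overh r y (T : seq X') : I r -> uniq T -> (forall z, z \in T -> Fh r z y) ->
    forall x, x \in T -> (size T)%:R <= C * cardR R (Fh r x).
  move=> Ir uT hT x xT; have Fxy := hT x xT; have [Ox|nO] := pselect (Om x); last first.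
    apply: small => // z /hT Fz; move: Fxy; rewrite FhN//= => e; subst y.
    apply: contrapT => zx; have Oz : Om z by apply: contrapT => nz; move: Fz; rewrite FhN//= => e; apply: zx.
    by apply: nO; move: Fz => /(liftE _ _ _ Oz)[Ezx _]; exact: OmE Ezx.
  have hT' z : z \in T -> Om z /\ E' (x, z).
    by move=> /hT Fz; exact: (samecl r r x y z).
  have [[_ _ _ /(_ r Ir)[_ h]] _ _ _] := hOm x Ox.
  rewrite cardh// -(size_map pi); apply: (h (pi y)).
  - by apply: (uniq_pi x) => // z /hT'[].
  - move=> _ /mapP[z zT ->]; have [Oz _] := hT' z zT.
    by have /(liftE _ _ _ Oz)[] := hT z zT.
  - by move: Fxy => /(liftE _ _ _ Ox)[].
have bdh n x : average Fh (fun z => (`[< ~ Fh r x (ph n z) >])%:R) r x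
    @[r --> within I (pinfty_nbhs R)] --> (0 : R).
  have [Ox|nO] := pselect (Om x); last first.
    apply: cvg_near_cst; apply: filterS (withinT _ _) => r Ir.
    rewrite averageE; last exact: finh.
    rewrite FhN// fset_set1 big_seq_fset1 phN//.
    by case: asboolP => [[]//|_]; rewrite mulr0.
  have [[_ _ /(_ n) h _] _ _ _] := hOm x Ox.
  apply: cvg_trans h; apply: near_eq_cvg; apply: filterS (withinT _ _) => r Ir.
  rewrite /escape !averageE; try by [exact: finh|exact: (finite_family HF (pi x) Ir)].
  rewrite cardh//; congr (_ * _); rewrite -(perm_big _ (permh r x Ir Ox))/= big_map.
  rewrite big_seq [RHS]big_seq; apply: eq_bigr => z; rewrite in_fset_set; last exact: finh.
  move=> /set_mem/(liftE _ _ _ Ox)[Exz _]; have Oz := OmE _ _ Ox Exz.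
  have [_ _ /(_ n)[Ezp ep] _] := hOm z Oz.
  congr (nat_of_bool _)%:R; apply/asboolP/asboolP; rewrite -ep => nF.
    by move=> /(liftE _ _ _ Ox)[_]; rewrite phO.
  by move=> Fp; apply: nF; apply/liftE => //; rewrite phO//; split => //; exact: (pmp_trans HE' Exz Ezp).
have [h [Ih ih ch cvgh]] := pointwise_ergodic mph mph' phK ph'K pph meq natI finh F0h Fsubh mFh C0
  lowh overh bdh If.
have mh := L1_measurable Ih.
exists h; last first.
  apply: filterS2 cvgh aeOm => x hx Ox; apply: cvg_trans hx; apply: near_eq_cvg.
  by apply: nearW => r; rewrite /average FhO.
split => //.
- move=> B mB; split; first by rewrite -[X in measurable X]setTI; exact: mh.
  (* [h] is invariant only almost everywhere; on the points along whose class it is constant, its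
     level sets are truly invariant. *)
  pose Good := [set x | Om x /\ forall y, E' (x, y) -> h y = h x].
  exists (Good `&` h @^-1` B); split.
    move=> x y Exy [[Ox hx] Bx]; split; last by rewrite /= hx.
    split; first exact: OmE Exy.
    by move=> z Eyz; rewrite (hx y Exy); apply: hx; exact: (pmp_trans HE' Exy Eyz).
  have : {ae mu', forall x, Good x}.
    apply: filterS2 (ae_foralln ih) aeOm => x hx Ox; split => // y Exy.
    by have [n <-] := class_orbit (hOm x Ox) Exy; rewrite -phO.
  apply: negligibleS => x [[Bx nG]|[[Gx Bx] nB]] //= Gx; first by apply: nG.
- move=> A [mA [B [hB nAB]]].
  (* [A] differs from the invariant [B] by a null set, whose preimage under [ph n] is null too. *)
  have iA : ae_invariant mu' ph (\1_A).
    move=> n; have ae1 : {ae mu', forall x, ~ (A `+` B) x}.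
      by apply: negligibleS nAB => x /= /contrapT.
    have [N [mN N0 hN]] := ae1.
    have ae2 : {ae mu', forall x, ~ (A `+` B) (ph n x)}.
      exists (ph n @^-1` N); split; [|by rewrite pph|by move=> x hx; exact: hN].
      by rewrite -[X in measurable X]setTI; exact: mph.
    have AB y : ~ (A `+` B) y -> (A y <-> B y).
      move=> nA; split=> [Ay|By]; apply: contrapT => nn; apply: nA; [by left|by right].
    apply: filterS2 ae1 ae2 => x /AB h1 /AB h2; rewrite !indicE; congr (nat_of_bool _)%:R.
    apply/idP/idP => /set_mem Ax; apply/mem_set.
      by apply/h1; apply: (hB (ph n x)); [exact: pmp_sym HE' _ _ (Eph n x)|exact/h2].
    by apply/h2; apply: (hB x) (Eph n x) _; exact/h1.
  have mint (g : X' -> R) : L1 mu' g -> (\int[mu']_(x in A) (g x)%:E = (mean mu' (fun x => \1_A x * g x))%:E)%E.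
    move=> Ig; rewrite EFin_mean; last first.
      have [mi [b hb]] := bounded_mfun_ind R mA; exact: L1M_bounded hb.
    rewrite integral_mkcond; apply: eq_integral => x _; rewrite patchE indicE.
    by case: (x \in A); rewrite ?mul1r ?mul0r.
  by rewrite !mint// ch.
Qed.


End Extension.

Theorem theorem2p5 (R : realType) (d : measure_display) (X : measurableType d)
    (mu : probability X R) (E : set (X * X)) (I : set R)
    (F : R -> X -> set X) :
  discrete_pmp mu E ->
  I = natI R \/ I = posI R ->
  borel_family I E F ->
  (asymptotically_invariant I mu E F /\ regular I mu F) \/
  [/\ asymptotically_invariant I mu E F, uniform I mu F & tempered I mu F] ->
  pointwise_ergodic_family_L1 I mu E F.
Proof.
move=> HE HI HF hyp d' X' mu' E' pi Hpi f If.
have sX := pmp_standard HE.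
(* Zero is not an index in [posI], hence the successor. *)
have I_S n : I n.+1%:R by case: HI => ->; [exists n.+1|rewrite /posI /= ltr0n].
have mI : measurable (I : set (measurableTypeR R)).
  case: HI => ->.
    have -> : natI R = \bigcup_n [set (n%:R : R)].
      by apply/seteqP; split=> x; [move=> [n _ <-]; exists n|move=> [n _ ->]; exists n].
    by apply: bigcup_measurable => n _; exact: measurable_set1.
  have -> : posI R = `]0, +oo[%classic.
    by apply/seteqP; split=> x; rewrite /posI /= in_itv /= andbT.
  exact: measurable_itv.
have [[F_ge1 [Psi [cPsi PsiE [N [mN NE N0 gen]] hPsi]]] [C C1 hC]] :
    asymptotically_invariant I mu E F /\
    exists2 C, 1 <= C & {ae mu, forall x, forall r, I r -> overlaps_le I F C r x}.
  case: hyp => [[? ?]|[? ? ?]]; split => //; first exact: (regular_overlaps_le HF).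
  exact: (tempered_overlaps_le HE HF).
(* The whole group is enumerated, not only [Psi], since a single [psi n] has to carry [x] to any
   given point of its class. *)
have [psi [Gpsi psiG]] := countable_enum (countable_generated_group cPsi) (generated_id Psi).
have Ipsi n := generated_group_Inn HE PsiE (Gpsi n).
have /choice[psi' hpsi'] : forall n, exists psi', [/\ cancel (psi n) psi', cancel psi' (psi n),
    measurable_fun setT (psi n) & measurable_fun setT psi'].
  by move=> n; have [] := Ipsi n.
apply: (@lifted_average_cvg _ _ _ _ _ mu E I F mu' E' pi HE HF Hpi mI I_S psi psi' _ _ _ _ _ C C1 _ f If).
- by move=> n; have [] := hpsi' n.
- by move=> n; have [] := hpsi' n.
- by move=> n; have [] := hpsi' n.
- by move=> n; have [] := hpsi' n.
- by move=> n; have [] := Ipsi n.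
have aeN : {ae mu, forall x, forall y, ~ N (x, y)}.
  apply: negligibleS (left_count_negligible sX mN N0) => x /= /existsNP[y /contrapT Nxy].
  by exists y.
have ae_escape : {ae mu, forall x, forall n,
    escape F (psi n) r x @[r --> within I (pinfty_nbhs R)] --> (0 : R)}.
  by apply: ae_foralln => n; exact: (generated_group_escape HE PsiE (fun r x => finite_family HF x)).
apply: filterS (filterI (filterI aeN F_ge1) (filterI ae_escape hC)) => x [[h1 h2] [h3 h4]].
split => //.
- move=> y Exy; have [g Gg <-] := gen x y Exy (h1 y).
  by have [n <-] := psiG g Gg; exists n.
- by move=> r Ir; apply/(counting_ge1 R); exact: h2.
Qed.
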